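(* Let $X$ be a finite space and $\Omega\in D^b_c(X)$ a canonical complex on $X$. (1) If $U$ is an open subset of $X$, then $\Omega_{|U}$ is a canonical complex on $U$. (2) If $i\colon K\hookrightarrow X$ is a closed subset, then $i^{-1}\mathbb R\mathcal{H}om_X^{\bullet}(\mathbb Z_K,\Omega)$ is a canonical complex on $K$.
   Context: A finite space is a finite $T_0$ topological space. Sheaves are of abelian groups; $D(X)$ the derived category; $D_c(X)$ the complexes whose cohomology sheaves have finitely generated stalks; $D^b_c(X)$ those moreover with bounded cohomology. $\mathbb Z_K$ is the constant sheaf on $K$ extended by zero. A canonical complex on $X$ is a complex $\Omega\in D^b_c(X)$ such that for every $F\in D_c(X)$ the natural morphism $F\to\mathbb R\mathcal{H}om_X^{\bullet}(\mathbb R\mathcal{H}om_X^{\bullet}(F,\Omega),\Omega)$ is an isomorphism. *)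

(* Defs.v *)
From HB Require Import structures.
From mathcomp Require Import all_boot all_order all_algebra all_classical.
From mathcomp Require Import topology.

Set Implicit Arguments.
Unset Strict Implicit.
Unset Printing Implicit Defensive.

Import GRing.Theory.
Local Open Scope classical_set_scope.
Local Open Scope ring_scope.

Definition mk_additive (U V : zmodType) (f : U -> V) (fB : zmod_morphism f) :
    {additive U -> V} :=
  HB.pack f (GRing.isZmodMorphism.Build U V f fB).

Definition pi_type (I : Type) (M : I -> zmodType) : Type := forall i, M i.

HB.instance Definition _ I (M : I -> zmodType) := gen_eqMixin (pi_type M).
HB.instance Definition _ I (M : I -> zmodType) := gen_choiceMixin (pi_type M).

Section PiZmod.
Variables (I : Type) (M : I -> zmodType).
Implicit Types f g h : pi_type M.

Definition pi_add f g : pi_type M := fun i => f i + g i.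
Definition pi_opp f : pi_type M := fun i => - f i.
Definition pi_zero : pi_type M := fun=> 0.

Lemma pi_addA : associative pi_add.
Proof. by move=> f g h; apply: functional_extensionality_dep => i; exact: addrA. Qed.

Lemma pi_addC : commutative pi_add.
Proof. by move=> f g; apply: functional_extensionality_dep => i; exact: addrC. Qed.

Lemma pi_add0 : left_id pi_zero pi_add.
Proof. by move=> f; apply: functional_extensionality_dep => i; exact: add0r. Qed.

Lemma pi_addN : left_inverse pi_zero pi_opp pi_add.
Proof. by move=> f; apply: functional_extensionality_dep => i; exact: addNr. Qed.

HB.instance Definition _ :=
  GRing.isZmodule.Build (pi_type M) pi_addA pi_addC pi_add0 pi_addN.
End PiZmod.

Definition pi_zmod I (M : I -> zmodType) : zmodType := pi_type M.

Record subgroup (M : zmodType) := Subgroup {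
  sg_set :> M -> Prop;
  sg_closed : sg_set 0 /\ forall x y, sg_set x -> sg_set y -> sg_set (x - y) }.

Definition sg_pred (M : zmodType) (S : subgroup M) : {pred M} :=
  fun x => `[< S x >].

Lemma sg_predP (M : zmodType) (S : subgroup M) : zmod_closed (sg_pred S).
Proof.
split=> [|x y]; first by apply/asboolP; exact: (sg_closed S).1.
by move=> /asboolP Sx /asboolP Sy; apply/asboolP; exact: (sg_closed S).2.
Qed.

HB.instance Definition _ (M : zmodType) (S : subgroup M) :=
  GRing.isZmodClosed.Build M (sg_pred S) (sg_predP S).

Definition sub_type (M : zmodType) (S : subgroup M) : Type :=
  {x : M | x \in sg_pred S}.

HB.instance Definition _ (M : zmodType) (S : subgroup M) :=
  SubType.on (sub_type S).
HB.instance Definition _ (M : zmodType) (S : subgroup M) :=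
  Choice.on (sub_type S).
HB.instance Definition _ (M : zmodType) (S : subgroup M) :=
  [SubChoice_isSubZmodule of sub_type S by <:].

Definition sub_zmod (M : zmodType) (S : subgroup M) : zmodType := sub_type S.

Definition sub_mk (M : zmodType) (S : subgroup M) (x : M) (Sx : S x) :
  sub_zmod S := exist _ x (asboolT Sx).
Definition sub_val (M : zmodType) (S : subgroup M) (x : sub_zmod S) : M :=
  sval x.

Section SubZmod.
Variables (M : zmodType) (S : subgroup M).

Lemma sub_valP (x : sub_zmod S) : S (sub_val x).
Proof. by case: x => x /= /asboolP. Qed.

Lemma sub_val_inj : injective (@sub_val M S).
Proof. exact: val_inj. Qed.

Lemma sub_valB : zmod_morphism (@sub_val M S).
Proof. by []. Qed.

Lemma sub_val0 : sub_val (0 : sub_zmod S) = 0.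
Proof. by []. Qed.
End SubZmod.

Section SubMap.
Variables (M N : zmodType) (S : subgroup M) (T : subgroup N).
Variables (f : {additive M -> N}) (fS : forall x, S x -> T (f x)).

Definition sub_map_fun (x : sub_zmod S) : sub_zmod T := sub_mk (fS (sub_valP x)).

Lemma sub_map_zmod_morphism : zmod_morphism sub_map_fun.
Proof. by move=> x y; apply: sub_val_inj; rewrite /= raddfB. Qed.

Definition sub_map : {additive sub_zmod S -> sub_zmod T} :=
  mk_additive sub_map_zmod_morphism.
End SubMap.


Definition quo_zmod (M : zmodType) (S : subgroup M) : zmodType :=
  Quotient.quot (sg_pred S).

Section QuoZmod.
Variables (M : zmodType) (S : subgroup M).

Lemma quo_pi_zmod_morphism :
  zmod_morphism (fun x => \pi_(Quotient.quot (sg_pred S)) x : quo_zmod S)%qT.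
Proof.
move=> x y; apply: (etrans (Quotient.pi_add (sg_pred S) x (- y))).
by congr (_ + _); exact: Quotient.pi_opp.
Qed.

Definition quo_pi : {additive M -> quo_zmod S} := mk_additive quo_pi_zmod_morphism.

Lemma quo_piE x y : quo_pi x = quo_pi y <-> S (x - y).
Proof.
have E : (x - y \in sg_pred S) = (quo_pi x == quo_pi y).
  exact: (Quotient.idealrBE (sg_pred S) x y).
split=> [e|Sxy]; first by apply/asboolP; move/eqP: e; rewrite -E.
by apply/eqP; rewrite -E; apply/asboolP.
Qed.

Lemma quo_pi_surj (c : quo_zmod S) : exists x, quo_pi x = c.
Proof. by exists (repr c)%qT; exact: reprK. Qed.
End QuoZmod.

Section QuoMap.
Variables (M N : zmodType) (S : subgroup M) (T : subgroup N).
Variables (f : {additive M -> N}) (fS : forall x, S x -> T (f x)).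

Definition quo_map_fun (c : quo_zmod S) : quo_zmod T := quo_pi T (f (repr c)%qT).

Lemma quo_map_funE x : quo_map_fun (quo_pi S x) = quo_pi T (f x).
Proof.
apply/quo_piE; rewrite -raddfB; apply: fS; apply/quo_piE.
exact: reprK.
Qed.

Lemma quo_map_zmod_morphism : zmod_morphism quo_map_fun.
Proof.
move=> c d; have [x <-] := quo_pi_surj c; have [y <-] := quo_pi_surj d.
by rewrite -raddfB !quo_map_funE !raddfB.
Qed.

Definition quo_map : {additive quo_zmod S -> quo_zmod T} :=
  mk_additive quo_map_zmod_morphism.

Lemma quo_mapE x : quo_map (quo_pi S x) = quo_pi T (f x).
Proof. exact: quo_map_funE. Qed.
End QuoMap.

Definition fingen (M : zmodType) :=
  exists s : seq M, forall x, exists c : nat -> int,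
    x = \sum_(i < size s) s`_i *~ c i.

Record finspace := FinSpace {
  fs_top :> topologicalType;
  fs_finite : finite_set [set: fs_top];
  fs_T0 : kolmogorov_space fs_top }.

Record opens (X : topologicalType) := Opens {
  oset :> set X;
  oset_open : open oset }.

Lemma opens_eq (X : topologicalType) (V W : opens X) :
  (V : set X) = W -> V = W.
Proof.
case: V W => [V Vo] [W Wo] /= e; subst W; congr Opens; exact: Prop_irrelevance.
Qed.

Section Subspace.
Variables (X : finspace) (A : set X).

Lemma sub_finite : finite_set [set: A].
Proof.
have : finite_set ((set_val : A -> X) @^-1` [set: X]).
  apply: finite_preimage; last exact: fs_finite.
  by move=> x y _ _; exact: val_inj.
by rewrite preimage_setT.
Qed.

Lemma incl_continuous : continuous (set_val : A -> X).
Proof. exact: initial_continuous. Qed.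

Lemma sub_T0 : kolmogorov_space A.
Proof.
move=> x y xy.
have vxy : set_val x != set_val y by apply: contra_neq xy; exact: val_inj.
have [B] := fs_T0 vxy.
case=> -[/[1!inE] nB yB]; exists (set_val @^-1` B); [left|right].
  split; first by rewrite inE; exact: incl_continuous.
  by move: yB; rewrite !inE.
split; first by rewrite inE; exact: incl_continuous.
by move: yB; rewrite !inE.
Qed.

Definition subspace_of : finspace := FinSpace sub_finite sub_T0.

Definition incl : subspace_of -> X := set_val.

Lemma incl_inj : injective incl.
Proof. exact: val_inj. Qed.
End Subspace.

Section MinOpen.
Variable X : finspace.
Implicit Types A B : set X.

Definition minset A : set X :=
  \bigcap_(V in [set V : set X | open V /\ A `<=` V]) V.

Lemma minset_open A : open (minset A).
Proof.
rewrite -closedC.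
suff -> : ~` minset A = \bigcup_(y in ~` minset A)
    ~` (get [set V : set X | [/\ open V, A `<=` V & ~ V y]]).
  apply: closed_bigcup => [|y /existsNP[V /not_implyP[[Vo AV] Vy]]].
    by apply: sub_finite_set (fs_finite X).
  apply/open_closedC; set P := [set V | _].
  have [] : P (get P) by apply: getPex; exists V.
  by [].
apply/seteqP; split=> [y my|z [y /existsNP[V /not_implyP[[Vo AV] Vy]]]].
  exists y => //; move: (my) => /existsNP[V /not_implyP[[Vo AV] Vy]].
  set P := [set V | _].
  have [] : P (get P) by apply: getPex; exists V.
  by [].
set P := [set V | _].
have [Po AP _] : P (get P) by apply: getPex; exists V.
by move=> nz mz; apply: nz; exact: mz.
Qed.

Definition minopen A : opens X := Opens (minset_open A).

Lemma minopen_sub A (V : opens X) : A `<=` V -> minopen A `<=` V.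
Proof. by move=> AV x; apply; split=> //; exact: oset_open. Qed.

Lemma sub_minopen A : A `<=` minopen A.
Proof. by move=> x Ax V [_]; exact. Qed.

Lemma minopenS A B : A `<=` B -> minopen A `<=` minopen B.
Proof. by move=> AB; apply: minopen_sub => x /AB; exact: sub_minopen. Qed.

Definition nbd (x : X) : opens X := minopen [set x].

Lemma nbd_id x : oset (nbd x) x.
Proof. exact: sub_minopen. Qed.

Lemma nbd_sub x (V : opens X) : oset V x -> nbd x `<=` V.
Proof. by move=> Vx; apply: minopen_sub => y ->. Qed.
End MinOpen.
Arguments nbd_id {X} x.

Record presheaf (X : finspace) := Presheaf {
  sec :> opens X -> zmodType;
  res : forall V W : opens X, W `<=` V -> {additive sec V -> sec W};
  res_id : forall (V : opens X) (h : V `<=` V) s, res h s = s;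
  res_comp : forall (V W T : opens X) (h : W `<=` V) (k : T `<=` W) (l : T `<=` V) s,
    res k (res h s) = res l s }.
Arguments res {X} p {V W}.

Definition is_sheaf (X : finspace) (F : presheaf X) :=
  forall (I : Type) (V : opens X) (W : I -> opens X)
    (WV : forall i, W i `<=` V), V `<=` \bigcup_i W i ->
  (forall s t : F V, (forall i, res F (WV i) s = res F (WV i) t) -> s = t) /\
  (forall s : forall i, F (W i),
    (forall i j (T : opens X) (Ti : T `<=` W i) (Tj : T `<=` W j),
      res F Ti (s i) = res F Tj (s j)) ->
    exists t : F V, forall i, res F (WV i) t = s i).

Record sheaf (X : finspace) := Sheaf {
  psh :> presheaf X;
  sheafP : is_sheaf psh }.

Record mor (X : finspace) (F G : presheaf X) := Mor {
  app :> forall V, {additive F V -> G V};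
  app_res : forall (V W : opens X) (h : W `<=` V) s,
    app W (res F h s) = res G h (app V s) }.

Definition mor_iso (X : finspace) (F G : presheaf X) (u : mor F G) :=
  forall V, bijective (u V).

Definition id_add (M : zmodType) : {additive M -> M} :=
  @mk_additive M M id (fun _ _ => erefl).

Definition mor_id (X : finspace) (F : presheaf X) : mor F F :=
  @Mor X F F (fun V => id_add (F V)) (fun _ _ _ _ => erefl).

Section MorComp.
Variables (X : finspace) (F G H : presheaf X) (v : mor G H) (u : mor F G).

Lemma comp_zmod_morphism V : zmod_morphism (fun s => v V (u V s)).
Proof. by move=> s t; rewrite !raddfB. Qed.

Lemma comp_res (V W : opens X) (h : W `<=` V) s :
  mk_additive (@comp_zmod_morphism W) (res F h s) =
  res H h (mk_additive (@comp_zmod_morphism V) s).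
Proof. by rewrite /= !app_res. Qed.

Definition mor_comp : mor F H := Mor comp_res.
End MorComp.

(* The colimit defining the stalk at x is attained at the smallest open
   neighbourhood of x. *)
Definition stalk (X : finspace) (F : presheaf X) (x : X) : zmodType := F (nbd x).

Definition germ (X : finspace) (F : presheaf X) (V : opens X) (x : X)
  (Vx : oset V x) : {additive F V -> stalk F x} := res F (nbd_sub Vx).
Arguments germ {X} F {V x} Vx.

Section Sheafify.
Variables (X : finspace) (P : presheaf X).

(* A section of the sheafification is a family of germs that comes locally
   from sections of P. *)
Definition germs (V : opens X) : zmodType :=
  pi_zmod (fun x : X => pi_zmod (fun _ : oset V x => stalk P x)).

Definition loc_section (V : opens X) (s : germs V) :=
  forall x, oset V x -> exists (W : opens X) (WV : W `<=` V) (t : P W),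
    oset W x /\ forall y (Wy : oset W y), s y (WV y Wy) = germ P Wy t.

Lemma loc_section_closed V : loc_section (0 : germs V) /\
  forall s t : germs V, loc_section s -> loc_section t -> loc_section (s - t).
Proof.
split=> [x Vx|s t ls lt x Vx].
  by exists V, (@subset_refl _ V), 0; split=> // y Wy; rewrite raddf0.
have [W [WV [s' [Wx sE]]]] := ls x Vx; have [W' [W'V [t' [W'x tE]]]] := lt x Vx.
have NW := nbd_sub Wx; have NW' := nbd_sub W'x.
exists (nbd x), (subset_trans NW WV), (res P NW s' - res P NW' t').
split=> [|y Ny]; first exact: nbd_id.
rewrite raddfB /germ (res_comp _ _ (nbd_sub (NW y Ny))).
rewrite (res_comp _ _ (nbd_sub (NW' y Ny))) -/(germ P _ _) -/(germ P _ _) -sE -tE.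
by congr (s y _ - t y _); exact: Prop_irrelevance.
Qed.

Definition shf_sec V : zmodType := sub_zmod (Subgroup (loc_section_closed V)).

Definition shf_at V (s : shf_sec V) x (Vx : oset V x) : stalk P x :=
  sub_val s x Vx.

Lemma shf_atP V (s : shf_sec V) x : oset V x ->
  exists (W : opens X) (WV : W `<=` V) (t : P W),
    oset W x /\ forall y (Wy : oset W y), shf_at s (WV y Wy) = germ P Wy t.
Proof. exact: (sub_valP s x). Qed.

Lemma shf_eq V (s t : shf_sec V) :
  (forall x (Vx : oset V x), shf_at s Vx = shf_at t Vx) -> s = t.
Proof.
move=> e; apply: sub_val_inj; apply: functional_extensionality_dep => x.
by apply: functional_extensionality_dep => Vx; exact: e.
Qed.

Lemma shf_at_irr V (s : shf_sec V) x (h k : oset V x) : shf_at s h = shf_at s k.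
Proof. by rewrite (Prop_irrelevance h k). Qed.

Section Res.
Variables (V W : opens X) (WV : W `<=` V).

Definition shf_res_raw (s : shf_sec V) : germs W :=
  fun x Wx => shf_at s (WV Wx).

Lemma shf_res_loc s : loc_section (shf_res_raw s).
Proof.
move=> x Wx; have [T [TV [t [Tx tE]]]] := shf_atP s (WV Wx).
have NT := nbd_sub Tx.
exists (nbd x), (nbd_sub Wx), (res P NT t); split=> [|y Ny]; first exact: nbd_id.
rewrite /germ (res_comp _ _ (nbd_sub (NT y Ny))) -/(germ P _ _) -tE.
exact: shf_at_irr.
Qed.

Definition shf_res_fun s : shf_sec W := sub_mk (S := Subgroup _) (shf_res_loc s).

Lemma shf_resB : zmod_morphism shf_res_fun.
Proof. by move=> s t; apply: shf_eq. Qed.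

Definition shf_res : {additive shf_sec V -> shf_sec W} := mk_additive shf_resB.

Lemma shf_resE s x (Wx : oset W x) : shf_at (shf_res s) Wx = shf_at s (WV Wx).
Proof. by []. Qed.
End Res.

Lemma shf_res_id (V : opens X) (h : V `<=` V) s : shf_res h s = s.
Proof. by apply: shf_eq => x Vx; rewrite !shf_resE; exact: shf_at_irr. Qed.

Lemma shf_res_comp (V W T : opens X) (h : W `<=` V) (k : T `<=` W) (l : T `<=` V) s :
  shf_res k (shf_res h s) = shf_res l s.
Proof. by apply: shf_eq => x Vx; rewrite !shf_resE; exact: shf_at_irr. Qed.

Definition shf_psh : presheaf X := Presheaf shf_res_id shf_res_comp.

Lemma shf_is_sheaf : is_sheaf shf_psh.
Proof.
move=> I V W WV cov; split=> [s t e|s e].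
  apply: shf_eq => x Vx; have [i _ Wx] := cov x Vx.
  have /(congr1 (fun u : shf_psh (W i) => shf_at u Wx)) := e i.
  by rewrite !shf_resE !(shf_at_irr _ (WV i x Wx) Vx).
have cov' x : oset V x -> {i | oset (W i) x}.
  by move=> Vx; apply: cid; have [i] := cov x Vx; exists i.
pose t : germs V := fun x Vx =>
  shf_at (s (sval (cov' x Vx))) (svalP (cov' x Vx)).
have tE i x (Wx : oset (W i) x) (Vx : oset V x) : t x Vx = shf_at (s i) Wx.
  rewrite /t; case: (cov' x Vx) => j Wjx /=.
  have /(congr1 (fun u : shf_psh (nbd x) => shf_at u (nbd_id x))) :=
    e j i (nbd x) (nbd_sub Wjx) (nbd_sub Wx).
  rewrite !shf_resE => E.
  by apply: etrans (etrans E _); exact: shf_at_irr.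
have tl : loc_section t.
  move=> x Vx; have [i _ Wx] := cov x Vx.
  have [T [TW [u [Tx uE]]]] := shf_atP (s i) Wx.
  exists T, (subset_trans TW (WV i)), u; split=> // y Ty.
  by rewrite -uE; exact: tE.
exists (sub_mk (S := Subgroup _) tl : shf_psh V) => i.
by apply: shf_eq => x Wx; rewrite -(tE i x Wx (WV i x Wx)).
Qed.

Definition sheafify : sheaf X := Sheaf shf_is_sheaf.
End Sheafify.

Section SheafifyMor.
Variables (X : finspace) (P Q : presheaf X) (u : mor P Q).

Definition shf_map_raw V (s : sheafify P V) : germs Q V :=
  fun x Vx => u (nbd x) (shf_at s Vx).

Lemma shf_map_loc V (s : sheafify P V) : loc_section (shf_map_raw s).
Proof.
move=> x Vx; have [W [WV [t [Wx tE]]]] := shf_atP s Vx.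
exists W, WV, (u W t); split=> // y Wy.
by rewrite /shf_map_raw tE /germ app_res.
Qed.

Definition shf_map_fun V (s : sheafify P V) : sheafify Q V :=
  sub_mk (S := Subgroup _) (shf_map_loc s).

Lemma shf_mapB V : zmod_morphism (@shf_map_fun V).
Proof.
move=> s t; apply: shf_eq => x Vx.
by rewrite /shf_at /= /shf_map_raw /shf_at sub_valB raddfB.
Qed.

Lemma shf_map_res (V W : opens X) (h : W `<=` V) s :
  mk_additive (@shf_mapB W) (res (sheafify P) h s) =
  res (sheafify Q) h (mk_additive (@shf_mapB V) s).
Proof. by apply: shf_eq. Qed.

Definition shf_map : mor (sheafify P) (sheafify Q) := Mor shf_map_res.
End SheafifyMor.

Record complex (X : finspace) := Complex {
  ob :> int -> sheaf X;
  dif : forall p q, q = p + 1 -> mor (ob p) (ob q);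
  dif_dif : forall p q r (e : q = p + 1) (e' : r = q + 1) V s,
    dif e' V (dif e V s) = 0 }.
Arguments dif {X} c {p q}.

Record cmap (X : finspace) (F G : complex X) := Cmap {
  cm :> forall n, mor (F n) (G n);
  cm_dif : forall p q (e : q = p + 1) V s,
    cm q V (dif F e V s) = dif G e V (cm p V s) }.

Definition cmap_id (X : finspace) (F : complex X) : cmap F F :=
  @Cmap X F F (fun n => mor_id (F n)) (fun _ _ _ _ _ => erefl).

Lemma cmap_comp_dif (X : finspace) (F G H : complex X) (v : cmap G H)
    (u : cmap F G) p q (e : q = p + 1) V s :
  mor_comp (v q) (u q) V (dif F e V s) = dif H e V (mor_comp (v p) (u p) V s).
Proof. by rewrite /= !cm_dif. Qed.

Definition cmap_comp (X : finspace) (F G H : complex X) (v : cmap G H)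
  (u : cmap F G) : cmap F H := Cmap (@cmap_comp_dif X F G H v u).

Section Cohomology.
Variables (X : finspace) (F : complex X) (n : int).

Definition cocycle V (z : F n V) := dif F (erefl (n + 1)) V z = 0.

Lemma cocycle_closed V : cocycle (0 : F n V) /\
  forall y z : F n V, cocycle y -> cocycle z -> cocycle (y - z).
Proof.
split=> [|y z yc zc]; first exact: raddf0.
by rewrite /cocycle raddfB yc zc subrr.
Qed.

Definition cocycles V : subgroup (F n V) := Subgroup (cocycle_closed V).

Definition coboundary V (z : sub_zmod (cocycles V)) :=
  exists p (e : n = p + 1) (y : F p V), sub_val z = dif F e V y.

Lemma coboundary_closed V : @coboundary V 0 /\
  forall y z, @coboundary V y -> coboundary z -> coboundary (y - z).
Proof.
split=> [|y z [p [e [s ys]]] [q [e' [t zt]]]].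
  by exists (n - 1), (esym (subrK 1 n)), 0; rewrite raddf0.
have pq : p = q by apply: (addIr 1); rewrite -e -e'.
subst q; exists p, e, (s - t).
by rewrite sub_valB ys zt raddfB (eq_irrelevance e e').
Qed.

Definition coboundaries V : subgroup (sub_zmod (cocycles V)) :=
  Subgroup (coboundary_closed V).

Definition coh_sec V : zmodType := quo_zmod (coboundaries V).
End Cohomology.

Section CohomologyMap.
Variables (X : finspace) (F G : complex X) (n : int) (V W : opens X).
Variable f : forall n, {additive F n V -> G n W}.
Hypothesis f_dif : forall p q (e : q = p + 1) s,
  f q (dif F e V s) = dif G e W (f p s).

Lemma coh_map_cocycle s : cocycles F n V s -> cocycles G n W (f n s).
Proof.
by move=> sc; rewrite /cocycles /= /cocycle -f_dif [dif _ _ _ _]sc raddf0.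
Qed.

Lemma coh_map_coboundary s : coboundaries F n V s ->
  coboundaries G n W (sub_map coh_map_cocycle s).
Proof.
move=> [p [e [t st]]]; exists p, e, (f p t).
by rewrite -f_dif -st.
Qed.

Definition coh_map_at : {additive coh_sec F n V -> coh_sec G n W} :=
  quo_map coh_map_coboundary.

Lemma coh_map_atE z :
  coh_map_at (quo_pi _ z) = quo_pi _ (sub_map coh_map_cocycle z).
Proof. exact: quo_mapE. Qed.
End CohomologyMap.

Section CohomologySheaf.
Variables (X : finspace) (F : complex X) (n : int).

Lemma res_dif (V W : opens X) (h : W `<=` V) p q (e : q = p + 1) s :
  res (F q) h (dif F e V s) = dif F e W (res (F p) h s).
Proof. by rewrite app_res. Qed.

Definition coh_res (V W : opens X) (h : W `<=` V) :
    {additive coh_sec F n V -> coh_sec F n W} :=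
  coh_map_at n (f := fun n => res (F n) h) (@res_dif V W h).

Lemma coh_res_id (V : opens X) (h : V `<=` V) c : coh_res h c = c.
Proof.
have [z <-] := quo_pi_surj c; rewrite coh_map_atE; congr (quo_pi _ _).
by apply: sub_val_inj; exact: res_id.
Qed.

Lemma coh_res_comp (V W T : opens X) (h : W `<=` V) (k : T `<=` W)
  (l : T `<=` V) c : coh_res k (coh_res h c) = coh_res l c.
Proof.
have [z <-] := quo_pi_surj c.
rewrite [coh_res h _]coh_map_atE [LHS]coh_map_atE [RHS]coh_map_atE; congr (quo_pi _ _).
by apply: sub_val_inj; exact: (res_comp h k l (sub_val z)).
Qed.

Definition coh_psh : presheaf X := Presheaf coh_res_id coh_res_comp.

Definition coh : sheaf X := sheafify coh_psh.
End CohomologySheaf.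

Section CohomologyMor.
Variables (X : finspace) (F G : complex X) (u : cmap F G) (n : int).

Definition coh_app V : {additive coh_psh F n V -> coh_psh G n V} :=
  coh_map_at n (f := fun n => u n V) (fun p q e => cm_dif u e (V := V)).

Lemma coh_app_res (V W : opens X) (h : W `<=` V) c :
  coh_app W (res (coh_psh F n) h c) = res (coh_psh G n) h (coh_app V c).
Proof.
have [z <-] := quo_pi_surj c.
rewrite [res _ h _]coh_map_atE [coh_app V _]coh_map_atE.
rewrite [LHS]coh_map_atE [RHS]coh_map_atE; congr (quo_pi _ _).
by apply: sub_val_inj; exact: (app_res (u n) h (sub_val z)).
Qed.

Definition coh_map : mor (coh F n) (coh G n) := shf_map (Mor coh_app_res).
End CohomologyMor.

Definition qis (X : finspace) (F G : complex X) (u : cmap F G) :=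
  forall n, mor_iso (coh_map u n).

Definition zero_psh (X : finspace) (F : presheaf X) := forall V (s : F V), s = 0.

Definition acyclic (X : finspace) (F : complex X) :=
  forall n, zero_psh (coh F n).

(* The derived category: the localisation of the category of complexes at the
   quasi-isomorphisms. A morphism is a zigzag of chain maps whose backward
   arrows are quasi-isomorphisms, up to the congruence zeq. *)

Inductive zigzag (X : finspace) : complex X -> complex X -> Type :=
| Znil F : zigzag F F
| Zfwd F G H (u : cmap F G) (z : zigzag G H) : zigzag F H
| Zbwd F G H (u : cmap G F) (uq : qis u) (z : zigzag G H) : zigzag F H.

Fixpoint zcat (X : finspace) (F G H : complex X) (z : zigzag F G) :
    zigzag G H -> zigzag F H :=
  match z in zigzag F G return zigzag G H -> zigzag F H with
  | Znil _ => fun t => t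
  | Zfwd _ _ _ u z => fun t => Zfwd u (zcat z t)
  | Zbwd _ _ _ u uq z => fun t => Zbwd uq (zcat z t)
  end.

Inductive zeq (X : finspace) :
    forall F G : complex X, zigzag F G -> zigzag F G -> Prop :=
| zeq_refl F G (z : zigzag F G) : zeq z z
| zeq_sym F G (z t : zigzag F G) : zeq z t -> zeq t z
| zeq_trans F G (z t w : zigzag F G) : zeq z t -> zeq t w -> zeq z w
| zeq_fwd F G H (u : cmap F G) (z t : zigzag G H) :
    zeq z t -> zeq (Zfwd u z) (Zfwd u t)
| zeq_bwd F G H (u : cmap G F) (uq : qis u) (z t : zigzag G H) :
    zeq z t -> zeq (Zbwd uq z) (Zbwd uq t)
| zeq_id F G (z : zigzag F G) : zeq (Zfwd (cmap_id F) z) z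
| zeq_comp F G H K (u : cmap F G) (v : cmap G H) (z : zigzag H K) :
    zeq (Zfwd u (Zfwd v z)) (Zfwd (cmap_comp v u) z)
| zeq_fwd_bwd F G H (u : cmap F G) (uq : qis u) (z : zigzag F H) :
    zeq (Zfwd u (Zbwd uq z)) z
| zeq_bwd_fwd F G H (u : cmap G F) (uq : qis u) (z : zigzag F H) :
    zeq (Zbwd uq (Zfwd u z)) z.

Definition D_mor (X : finspace) (F G : complex X) (u : cmap F G) : zigzag F G :=
  Zfwd u (Znil G).

Definition D_iso (X : finspace) (F G : complex X) (z : zigzag F G) :=
  exists t : zigzag G F, zeq (zcat z t) (Znil F) /\ zeq (zcat t z) (Znil G).

Definition Dc (X : finspace) (F : complex X) :=
  forall n x, fingen (stalk (coh F n) x).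

Definition Dbc (X : finspace) (F : complex X) :=
  Dc F /\ exists N : nat, forall n : int, (N < `|n|)%N -> zero_psh (coh F n).

Section ProdSheaf.
Variables (X : finspace) (I : Type) (F : I -> sheaf X).

Definition prod_sec V : zmodType := pi_zmod (fun i => F i V).

Section Res.
Variables (V W : opens X) (WV : W `<=` V).

Definition prod_res_fun (s : prod_sec V) : prod_sec W :=
  fun i => res (F i) WV (s i).

Lemma prod_resB : zmod_morphism prod_res_fun.
Proof.
move=> s t; apply: functional_extensionality_dep => i.
by rewrite /prod_res_fun raddfB.
Qed.

Definition prod_res : {additive prod_sec V -> prod_sec W} :=
  mk_additive prod_resB.
End Res.

Lemma prod_res_id (V : opens X) (h : V `<=` V) s : prod_res h s = s.
Proof. by apply: functional_extensionality_dep => i; exact: res_id. Qed.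

Lemma prod_res_comp (V W T : opens X) (h : W `<=` V) (k : T `<=` W)
  (l : T `<=` V) s : prod_res k (prod_res h s) = prod_res l s.
Proof. by apply: functional_extensionality_dep => i; exact: res_comp. Qed.

Definition prod_psh : presheaf X := Presheaf prod_res_id prod_res_comp.

Lemma prod_is_sheaf : is_sheaf prod_psh.
Proof.
move=> J V W WV cov; split=> [s t e|s e].
  apply: functional_extensionality_dep => i.
  apply: (sheafP (F i) WV cov).1 => j.
  exact: (congr1 (fun u : prod_psh (W j) => u i) (e j)).
have /(_ _)/cid t_ i : exists t : F i V, forall j, res (F i) (WV j) t = s j i.
  apply: (sheafP (F i) WV cov).2 => j k T Tj Tk.
  exact: (congr1 (fun u : prod_psh T => u i) (e j k T Tj Tk)).
exists (fun i => sval (t_ i)) => j.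
by apply: functional_extensionality_dep => i; exact: (svalP (t_ i)).
Qed.

Definition prod_sheaf : sheaf X := Sheaf prod_is_sheaf.
End ProdSheaf.

Section HomSheaf.
Variables (X : finspace) (F G : sheaf X).

(* An element of hom_sec V is a morphism of sheaves from F|V to G|V. *)
Definition hom_raw (V : opens X) : zmodType :=
  pi_zmod (fun W : opens X =>
    pi_zmod (fun _ : W `<=` V => ((F W -> G W) : zmodType))).

Definition is_hom (V : opens X) (f : hom_raw V) :=
  (forall (W : opens X) (WV : W `<=` V), zmod_morphism (f W WV)) /\
  (forall (W T : opens X) (WV : W `<=` V) (TV : T `<=` V) (TW : T `<=` W) s,
    f T TV (res F TW s) = res G TW (f W WV s)).

Lemma is_hom_closed V : is_hom (0 : hom_raw V) /\
  forall f g : hom_raw V, is_hom f -> is_hom g -> is_hom (f - g).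
Proof.
split=> [|f g [fB fr] [gB gr]].
  split=> [W WV s t|W T WV TV TW s]; first by rewrite subrr.
  by rewrite raddf0.
have E W WV s : (f - g) W WV s = f W WV s - g W WV s by [].
split=> [W WV s t|W T WV TV TW s]; rewrite !E.
  by rewrite fB gB !opprD !opprK addrACA.
by rewrite fr gr raddfB.
Qed.

Definition hom_sec V : zmodType := sub_zmod (Subgroup (@is_hom_closed V)).

Definition hom_at V (f : hom_sec V) (W : opens X) (WV : W `<=` V) :
    {additive F W -> G W} :=
  mk_additive ((sub_valP f).1 W WV).

Lemma hom_at_res V (f : hom_sec V) (W T : opens X) (WV : W `<=` V)
    (TV : T `<=` V) (TW : T `<=` W) s :
  hom_at f TV (res F TW s) = res G TW (hom_at f WV s).
Proof. exact: (sub_valP f).2. Qed.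

Lemma hom_at_irr V (f : hom_sec V) (W : opens X) (h k : W `<=` V) s :
  hom_at f h s = hom_at f k s.
Proof. by rewrite (Prop_irrelevance h k). Qed.

Lemma hom_eq V (f g : hom_sec V) :
  (forall (W : opens X) (WV : W `<=` V) s, hom_at f WV s = hom_at g WV s) ->
  f = g.
Proof.
move=> e; apply: sub_val_inj; apply: functional_extensionality_dep => W.
by do 2![apply: functional_extensionality_dep => ?]; exact: e.
Qed.

Section Mk.
Variables (V : opens X)
  (f : forall W : opens X, W `<=` V -> {additive F W -> G W}).
Hypothesis f_res : forall (W T : opens X) (WV : W `<=` V) (TV : T `<=` V)
  (TW : T `<=` W) s, f TV (res F TW s) = res G TW (f WV s).

Lemma mk_hom_subproof : is_hom ((fun W WV => f WV) : hom_raw V).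
Proof. by split=> // W WV s t; rewrite raddfB. Qed.

Definition mk_hom : hom_sec V := sub_mk (S := Subgroup _) mk_hom_subproof.

Lemma mk_homE (W : opens X) (WV : W `<=` V) s : hom_at mk_hom WV s = f WV s.
Proof. by []. Qed.
End Mk.

Section Res.
Variables (V W : opens X) (WV : W `<=` V).

Definition hom_res_fun (f : hom_sec V) : hom_sec W :=
  mk_hom (f := fun T TW => hom_at f (subset_trans TW WV))
    (fun T T' TW T'W => hom_at_res f (subset_trans TW WV) (subset_trans T'W WV)).

Lemma hom_resB : zmod_morphism hom_res_fun.
Proof. by move=> f g; exact: hom_eq. Qed.

Definition hom_res : {additive hom_sec V -> hom_sec W} := mk_additive hom_resB.

Lemma hom_resE f (T : opens X) (TW : T `<=` W) (TV : T `<=` V) s :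
  hom_at (hom_res f) TW s = hom_at f TV s.
Proof. exact: (hom_at_irr f (subset_trans TW WV) TV). Qed.
End Res.

Lemma hom_res_id (V : opens X) (h : V `<=` V) f : hom_res h f = f.
Proof. by apply: hom_eq => W WV s; exact: hom_resE. Qed.

Lemma hom_res_comp (V W T : opens X) (h : W `<=` V) (k : T `<=` W)
  (l : T `<=` V) f : hom_res k (hom_res h f) = hom_res l f.
Proof.
apply: hom_eq => S ST s.
by rewrite (hom_resE l _ _ (subset_trans ST l)) (hom_resE k _ _ (subset_trans ST k))
  (hom_resE h _ _ (subset_trans ST l)).
Qed.

Definition hom_psh : presheaf X := Presheaf hom_res_id hom_res_comp.

Definition opensI (V W : opens X) : opens X :=
  Opens (openI (oset_open V) (oset_open W)).

Lemma hom_is_sheaf : is_sheaf hom_psh.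
Proof.
move=> I V W WV cov; split=> [f g e|f e].
  apply: hom_eq => T TV s.
  have TWT i : opensI T (W i) `<=` T by move=> x [].
  have TWW i : opensI T (W i) `<=` W i by move=> x [].
  have covT : T `<=` \bigcup_i opensI T (W i).
    by move=> x Tx; have [i _ Wx] := cov x (TV x Tx); exists i.
  apply: (sheafP G TWT covT).1 => i.
  have TWV := subset_trans (TWT i) TV.
  rewrite -!(hom_at_res _ TV TWV).
  have /(congr1 (fun u : hom_psh (W i) => hom_at u (TWW i) (res F (TWT i) s))) := e i.
  by rewrite !(hom_resE _ _ _ TWV).
have glue (T : opens X) (TV : T `<=` V) (s : F T) : {t : G T |
    forall i (S : opens X) (ST : S `<=` T) (SW : S `<=` W i),
      res G ST t = hom_at (f i) SW (res F ST s)}.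
  apply: cid.
  have TWT i : opensI T (W i) `<=` T by move=> x [].
  have TWW i : opensI T (W i) `<=` W i by move=> x [].
  have covT : T `<=` \bigcup_i opensI T (W i).
    by move=> x Tx; have [i _ Wx] := cov x (TV x Tx); exists i.
  have [t tE] : exists t : G T, forall i,
      res G (TWT i) t = hom_at (f i) (TWW i) (res F (TWT i) s).
    apply: (sheafP G TWT covT).2 => i j S Si Sj.
    have SWi := subset_trans Si (TWW i); have SWj := subset_trans Sj (TWW j).
    have ST := subset_trans Si (TWT i).
    rewrite -(hom_at_res _ _ SWi) -(hom_at_res _ _ SWj).
    rewrite !(res_comp _ _ ST).
    have /(congr1 (fun u : hom_psh S =>
      hom_at u (@subset_refl _ S) (res F ST s))) := e i j S SWi SWj.
    by rewrite (hom_resE _ _ _ SWi) (hom_resE _ _ _ SWj).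
  exists t => i S ST SW.
  have STW : S `<=` opensI T (W i) by move=> x Sx; split; [exact: ST|exact: SW].
  rewrite -(res_comp (TWT i) STW ST) tE -(hom_at_res _ _ SW).
  by rewrite (res_comp _ _ ST).
pose g (T : opens X) (TV : T `<=` V) (s : F T) := sval (glue T TV s).
have gE (T : opens X) (TV : T `<=` V) s i (S : opens X) (ST : S `<=` T) (SW : S `<=` W i) :
    res G ST (g T TV s) = hom_at (f i) SW (res F ST s).
  exact: (svalP (glue T TV s)).
have uniq (T : opens X) (TV : T `<=` V) (s t : G T) :
    (forall i (S : opens X) (ST : S `<=` T) (SW : S `<=` W i),
      res G ST s = res G ST t) -> s = t.
  move=> st.
  have TWT i : opensI T (W i) `<=` T by move=> x [].
  have TWW i : opensI T (W i) `<=` W i by move=> x [].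
  have covT : T `<=` \bigcup_i opensI T (W i).
    by move=> x Tx; have [i _ Wx] := cov x (TV x Tx); exists i.
  by apply: (sheafP G TWT covT).1 => i; exact: (st i).
have gB (T : opens X) (TV : T `<=` V) : zmod_morphism (g T TV).
  move=> s t; apply: (uniq T TV) => i S ST SW.
  by rewrite (gE _ _ _ i S ST SW) !raddfB !(gE _ _ _ i S ST SW).
have gr (T T' : opens X) (TV : T `<=` V) (T'V : T' `<=` V) (TT : T' `<=` T) s :
    mk_additive (gB T' T'V) (res F TT s) = res G TT (mk_additive (gB T TV) s).
  apply: (uniq T' T'V) => i S ST SW /=.
  have SST := subset_trans ST TT.
  by rewrite (res_comp _ _ SST) (gE _ _ _ i S ST SW) (gE _ _ _ i S SST SW)
    (res_comp _ _ SST).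
exists (mk_hom gr : hom_psh V) => i; apply: hom_eq => T TW s.
rewrite (hom_resE _ _ _ (subset_trans TW (WV i))) mk_homE /=.
have := gE T (subset_trans TW (WV i)) s i T (@subset_refl _ T) TW.
by rewrite !res_id.
Qed.

Definition hom : sheaf X := Sheaf hom_is_sheaf.
End HomSheaf.

Section HomMap.
Variables (X : finspace) (A A' B B' : sheaf X) (u : mor A' A) (v : mor B B').

Section At.
Variable V : opens X.

Section Fun.
Variable f : hom A B V.

Lemma hom_map_B (W : opens X) (WV : W `<=` V) :
  zmod_morphism (fun s => v W (hom_at f WV (u W s))).
Proof. by move=> s t; rewrite !raddfB. Qed.

Lemma hom_map_res (W T : opens X) (WV : W `<=` V) (TV : T `<=` V)
    (TW : T `<=` W) s :
  mk_additive (hom_map_B TV) (res A' TW s) =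
  res B' TW (mk_additive (hom_map_B WV) s).
Proof.
rewrite -[LHS]/(v T (hom_at f TV (u T (res A' TW s)))).
rewrite -[RHS]/(res B' TW (v W (hom_at f WV (u W s)))).
by rewrite (app_res u) (hom_at_res f WV) (app_res v).
Qed.

Definition hom_map_fun : hom A' B' V := mk_hom hom_map_res.
End Fun.

Lemma hom_map_zmod_morphism : zmod_morphism hom_map_fun.
Proof.
move=> f g; apply: hom_eq => W WV s.
rewrite mk_homE /= -[RHS]/(v W (hom_at f WV (u W s)) - v W (hom_at g WV (u W s))).
by rewrite -raddfB.
Qed.

Definition hom_map_at : {additive hom A B V -> hom A' B' V} :=
  mk_additive hom_map_zmod_morphism.

Lemma hom_mapE f (W : opens X) (WV : W `<=` V) s :
  hom_at (hom_map_at f) WV s = v W (hom_at f WV (u W s)).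
Proof. by []. Qed.
End At.

Lemma hom_map_app_res (V W : opens X) (h : W `<=` V) f :
  hom_map_at W (res (hom A B) h f) = res (hom A' B') h (hom_map_at V f).
Proof. by apply: hom_eq. Qed.

Definition hom_map : mor (hom A B) (hom A' B') := Mor hom_map_app_res.
End HomMap.

(* Bideg p q stands for a component from degree p to degree q = p + n. The proof
   of q = p + n is stored so that no transport along equalities of integers is
   needed. *)
Record bideg (n : int) := Bideg {
  bsrc : int;
  btgt : int;
  bdegE : btgt = bsrc + n }.

Section HomComplex.
Variables (X : finspace) (F G : complex X).

Definition hom_ob (n : int) : sheaf X :=
  prod_sheaf (fun b : bideg n => hom (F (bsrc b)) (G (btgt b))).

Lemma bideg_r (n m : int) (e : m = n + 1) (b : bideg m) : btgt b = bsrc b + n + 1.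
Proof. by rewrite -addrA -e bdegE. Qed.

Lemma bideg_l (n m : int) (e : m = n + 1) (b : bideg m) : btgt b = bsrc b + 1 + n.
Proof. by rewrite -addrA [1 + n]addrC -e bdegE. Qed.

(* d f = d o f - (-1)^n f o d for f of degree n. *)
Section Dif.
Variables (n m : int) (e : m = n + 1) (V : opens X).

Definition hom_dif_fun (f : hom_ob n V) : hom_ob m V := fun b =>
  hom_map (mor_id (F (bsrc b))) (dif G (bideg_r e b)) V
    (f (Bideg (erefl (bsrc b + n))))
  - hom_map (dif F (erefl (bsrc b + 1))) (mor_id (G (btgt b))) V
      (f (Bideg (bideg_l e b))) *~ (-1) ^ n.

Lemma hom_difB : zmod_morphism hom_dif_fun.
Proof.
move=> f g; apply: functional_extensionality_dep => b.
pose P := hom_map (mor_id (F (bsrc b))) (dif G (bideg_r e b)) V.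
pose Q := hom_map (dif F (erefl (bsrc b + 1))) (mor_id (G (btgt b))) V.
set c := Bideg (erefl (bsrc b + n)); set c' := Bideg (bideg_l e b).
rewrite -[LHS]/(P (f c - g c) - Q (f c' - g c') *~ (-1) ^ n).
rewrite -[RHS]/(P (f c) - Q (f c') *~ (-1) ^ n - (P (g c) - Q (g c') *~ (-1) ^ n)).
by rewrite (raddfB P) (raddfB Q) mulrzBl !opprD !opprK addrACA.
Qed.

Definition hom_dif_at : {additive hom_ob n V -> hom_ob m V} :=
  mk_additive hom_difB.

End Dif.

Lemma hom_at_mulz (A B : sheaf X) (V : opens X) (f : hom A B V) (k : int) (W : opens X)
  (WV : W `<=` V) s : hom_at (f *~ k) WV s = hom_at f WV s *~ k.
Proof.
have B0 : zmod_morphism (fun g : hom A B V => hom_at g WV s) by [].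
exact: (raddfMz (mk_additive B0)).
Qed.

Lemma hom_difE (n m : int) (e : m = n + 1) (V : opens X) f (b : bideg m) (W : opens X)
    (WV : W `<=` V) s :
  hom_at (hom_dif_at e V f b) WV s =
  dif G (bideg_r e b) W (hom_at (f (Bideg (erefl (bsrc b + n)))) WV s)
  - hom_at (f (Bideg (bideg_l e b))) WV
      (dif F (erefl (bsrc b + 1)) W s) *~ (-1) ^ n.
Proof.
rewrite -[LHS]/(_ - hom_at (_ *~ _) WV s).
by rewrite hom_at_mulz.
Qed.

Lemma hom_dif_res (n m : int) (e : m = n + 1) (V W : opens X) (h : W `<=` V) f :
  hom_dif_at e W (res (hom_ob n) h f) = res (hom_ob m) h (hom_dif_at e V f).
Proof.
apply: functional_extensionality_dep => b.
rewrite /= /hom_dif_fun /prod_res_fun raddfB raddfMz.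
by rewrite -!app_res.
Qed.

Definition hom_dif (n m : int) (e : m = n + 1) : mor (hom_ob n) (hom_ob m) :=
  Mor (hom_dif_res e).

Lemma hom_at_tgt (n : int) (V : opens X) (f : hom_ob n V) p q q' t (e : q = p + n) (e' : q' = p + n)
    (k : t = q + 1) (k' : t = q' + 1) (W : opens X) (WV : W `<=` V) s :
  dif G k W (hom_at (f (Bideg e)) WV s) = dif G k' W (hom_at (f (Bideg e')) WV s).
Proof.
have qq : q = q' by rewrite e e'.
by case: q' / qq e' k' => e' k'; rewrite (eq_irrelevance e e') (eq_irrelevance k k').
Qed.

Arguments hom_at_tgt {n V} f {p q q' t} e e' k k' {W} WV s.

Lemma hom_dif_dif (n m l : int) (e : m = n + 1) (e' : l = m + 1) (V : opens X) f :
  hom_dif e' V (hom_dif e V f) = 0.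
Proof.
subst m; set e := erefl (n + 1).
apply: functional_extensionality_dep => b; apply: hom_eq => W WV s.
rewrite [LHS]hom_difE !hom_difE (raddfB (dif G (bideg_r e' b) W)) raddfMz.
rewrite !dif_dif raddf0 mul0rz sub0r subr0.
rewrite (hom_at_tgt f _ (erefl (bsrc b + 1 + n)) _
  (bideg_r e (Bideg (bideg_l e' b)))).
have -> : (-1) ^ (n + 1) = - (-1) ^ n :> int by rewrite exprzDr // expr1z mulrN1.
by rewrite mulrNz opprK addNr.
Qed.

Definition homc : complex X := Complex hom_dif_dif.
End HomComplex.
Arguments hom_at_tgt {X F G n V} f {p q q' t} e e' k k' {W} WV s.

Section Bidual.
Variables (X : finspace) (F I : complex X).

Lemma bideg_swap (m : int) (b : bideg m) : btgt b = m + bsrc b.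
Proof. by rewrite bdegE addrC. Qed.

Section At.
Variables (m : int) (V : opens X).

Section Fun.
Variables (s : F m V) (b : bideg m).

(* s of degree m is sent to phi |-> (-1)^(m p) phi(s) for phi of degree p; the
   sign makes this a chain map. *)
Lemma bidual_B (W : opens X) (WV : W `<=` V) :
  zmod_morphism (fun f : homc F I (bsrc b) W =>
    hom_at (f (Bideg (bideg_swap b))) (@subset_refl _ W) (res (F m) WV s)
      *~ (-1) ^ (m * bsrc b)).
Proof. by move=> f g; rewrite -mulrzBl. Qed.

Lemma bidual_hom_res (W T : opens X) (WV : W `<=` V) (TV : T `<=` V)
    (TW : T `<=` W) f :
  mk_additive (bidual_B TV) (res (homc F I (bsrc b)) TW f) =
  res (I (btgt b)) TW (mk_additive (bidual_B WV) f).
Proof.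
rewrite /= raddfMz /=; congr (_ *~ _).
by rewrite -(hom_at_res _ _ TW) (res_comp _ _ TV) [LHS](hom_resE TW _ _ TW).
Qed.

Definition bidual_hom : hom (homc F I (bsrc b)) (I (btgt b)) V :=
  mk_hom bidual_hom_res.
End Fun.

Definition bidual_fun (s : F m V) : homc (homc F I) I m V := bidual_hom s.

Lemma bidual_funE s (b : bideg m) (W : opens X) (WV : W `<=` V) f :
  hom_at (bidual_fun s b) WV f =
  hom_at (f (Bideg (bideg_swap b))) (@subset_refl _ W) (res (F m) WV s)
      *~ (-1) ^ (m * bsrc b).
Proof. by []. Qed.

Lemma bidual_funB : zmod_morphism bidual_fun.
Proof.
move=> s t; apply: functional_extensionality_dep => b.
apply: hom_eq => W WV f.
rewrite -[RHS]/(hom_at (bidual_fun s b) WV f - hom_at (bidual_fun t b) WV f).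
by rewrite !bidual_funE !raddfB mulrzBl.
Qed.

Definition bidual_at : {additive F m V -> homc (homc F I) I m V} :=
  mk_additive bidual_funB.

Lemma bidualE s (b : bideg m) (W : opens X) (WV : W `<=` V) f :
  hom_at (bidual_at s b) WV f =
  hom_at (f (Bideg (bideg_swap b))) (@subset_refl _ W) (res (F m) WV s)
      *~ (-1) ^ (m * bsrc b).
Proof. by []. Qed.
End At.

Lemma bidual_res m (V W : opens X) (h : W `<=` V) s :
  bidual_at m W (res (F m) h s) = res (homc (homc F I) I m) h (bidual_at m V s).
Proof.
apply: functional_extensionality_dep => b; apply: hom_eq => T TW f.
rewrite [RHS](hom_resE h _ _ (subset_trans TW h)) !bidualE.
by rewrite (res_comp h TW (subset_trans TW h)).
Qed.

Definition bidual_mor m : mor (F m) (homc (homc F I) I m) := Mor (@bidual_res m).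

Lemma bidual_dif m n (e : n = m + 1) V s :
  bidual_mor n V (dif F e V s) = dif (homc (homc F I) I) e V (bidual_mor m V s).
Proof.
subst n; apply: functional_extensionality_dep => b; apply: hom_eq => W WV f.
rewrite [RHS]hom_difE !bidualE [in RHS]raddfMz.
rewrite [hom_at (dif (homc F I) _ W f _) _ _]hom_difE -!app_res.
rewrite (hom_at_tgt f _ (erefl (m + bsrc b)) _
  (bideg_r (erefl (bsrc b + 1))
    (Bideg (bideg_swap (Bideg (bideg_l (erefl (m + 1)) b)))))).
rewrite (eq_irrelevance (bideg_l _ (Bideg _)) (bideg_swap b)).
set x := dif I _ W _; set y := hom_at _ _ _.
have sq (k : int) : (-1) ^ k * (-1) ^ k = 1 :> int.
  by rewrite -exprzMl // mulrNN mulr1 exp1rz.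
have S : (-1) ^ (m * (bsrc b + 1)) * (-1) ^ m = (-1) ^ (m * bsrc b) :> int.
  by rewrite mulrDr mulr1 exprzDr // -mulrA sq mulr1.
have T : (-1) ^ bsrc b * (-1) ^ (m * bsrc b) = (-1) ^ ((m + 1) * bsrc b) :> int.
  by rewrite -exprzDr // mulrDl mul1r addrC.
rewrite -[_ *~ _ *~ _]mulrzA [bsrc (Bideg _)]/= S mulrzBl -[y *~ _ *~ _]mulrzA T.
by rewrite opprB addrCA subrr addr0.
Qed.


Definition bidual : cmap F (homc (homc F I) I) := Cmap bidual_dif.
End Bidual.

Section Pull.
Variables (X Y : finspace) (phi : opens Y -> opens X).
Hypothesis phiS : forall V W : opens Y, W `<=` V -> phi W `<=` phi V.

Section Psh.
Variable P : presheaf X.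

Definition pull_res (V W : opens Y) (h : W `<=` V) :
  {additive P (phi V) -> P (phi W)} := res P (phiS h).

Lemma pull_res_id (V : opens Y) (h : V `<=` V) s : pull_res h s = s.
Proof. exact: res_id. Qed.

Lemma pull_res_comp (V W T : opens Y) (h : W `<=` V) (k : T `<=` W)
  (l : T `<=` V) s : pull_res k (pull_res h s) = pull_res l s.
Proof. exact: res_comp. Qed.

Definition pull_psh : presheaf Y := Presheaf pull_res_id pull_res_comp.
End Psh.

Definition pull_mor (P Q : presheaf X) (u : mor P Q) :
    mor (pull_psh P) (pull_psh Q) :=
  @Mor Y (pull_psh P) (pull_psh Q) (fun V => u (phi V))
    (fun V W h s => app_res u (phiS h) s).

Hypothesis phi_cover : forall (I : Type) (V : opens Y) (W : I -> opens Y),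
  V `<=` \bigcup_i W i -> phi V `<=` \bigcup_i phi (W i).
Hypothesis phi_meet : forall (V W : opens Y) (T : opens X),
  T `<=` phi V -> T `<=` phi W ->
  exists S : opens Y, [/\ S `<=` V, S `<=` W & T `<=` phi S].

Lemma pull_is_sheaf (F : sheaf X) : is_sheaf (pull_psh F).
Proof.
move=> I V W WV cov.
have [sep glue] := sheafP F (fun i => phiS (WV i)) (phi_cover cov).
split=> [|s e]; first exact: sep.
apply: glue => i j T Ti Tj; have [S [Si Sj TS]] := phi_meet Ti Tj.
rewrite -(res_comp (phiS Si) TS Ti) -(res_comp (phiS Sj) TS Tj).
by congr (res _ _ _); exact: e.
Qed.

Definition pull_sheaf (F : sheaf X) : sheaf Y := Sheaf (pull_is_sheaf F).
End Pull.

Section ConstantSheaf.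
Variables (X : finspace) (M : zmodType).

Definition const_psh : presheaf X :=
  @Presheaf X (fun=> M) (fun _ _ _ => id_add M)
    (fun _ _ _ => erefl) (fun _ _ _ _ _ _ _ => erefl).

Definition const_sheaf : sheaf X := sheafify const_psh.
End ConstantSheaf.

Section Concentrated.
Variables (X : finspace) (F : sheaf X).

Definition zero_sheaf : sheaf X :=
  const_sheaf X (pi_zmod (fun _ : void => (int : zmodType))).

Definition conc_ob (n : int) : sheaf X := if n == 0 then F else zero_sheaf.

Lemma zero_mor_B (P Q : presheaf X) V : zmod_morphism (fun _ : P V => 0 : Q V).
Proof. by move=> s t; rewrite subrr. Qed.

Lemma zero_mor_res (P Q : presheaf X) (V W : opens X) (h : W `<=` V) s :
  mk_additive (@zero_mor_B P Q W) (res P h s) =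
  res Q h (mk_additive (@zero_mor_B P Q V) s).
Proof. by rewrite /= raddf0. Qed.

Definition zero_mor (P Q : presheaf X) : mor P Q := Mor (@zero_mor_res P Q).

Definition conc : complex X :=
  @Complex X conc_ob (fun p q _ => zero_mor (conc_ob p) (conc_ob q))
    (fun _ _ _ _ _ _ _ => erefl).
End Concentrated.

Section OpenRestriction.
Variables (X : finspace) (U : set X) (Uo : open U).

Lemma incl_image_open (V : opens (subspace_of U)) : open (incl (A := U) @` V).
Proof.
have [O Oo <-] := oset_open V.
suff -> : incl (A := U) @` (set_val @^-1` O) = U `&` O by exact: openI.
apply/seteqP; split=> [_ [x Ox <-]|x [Ux Ox]].
  by split=> //; exact: set_valP.
by exists (exist _ x (mem_set Ux)).
Qed.

Definition open_image (V : opens (subspace_of U)) : opens X :=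
  Opens (incl_image_open V).

Lemma open_imageS (V W : opens (subspace_of U)) :
  W `<=` V -> open_image W `<=` open_image V.
Proof. exact: image_subset. Qed.

Lemma open_image_cover (I : Type) (V : opens (subspace_of U))
    (W : I -> opens (subspace_of U)) :
  V `<=` \bigcup_i W i -> open_image V `<=` \bigcup_i open_image (W i).
Proof. by move=> cov _ [x /cov[i _ Wx] <-]; exists i => //; exists x. Qed.

Lemma open_image_meet (V W : opens (subspace_of U)) (T : opens X) :
  T `<=` open_image V -> T `<=` open_image W ->
  exists S : opens (subspace_of U), [/\ S `<=` V, S `<=` W & T `<=` open_image S].
Proof.
move=> TV TW; exists (opensI V W); split=> [x []|x []|x Tx] //.
have [y Vy yx] := TV x Tx; have [z Wz zx] := TW x Tx.
have yz : y = z by apply: incl_inj; rewrite yx zx.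
by subst z; exists y.
Qed.

(* For U open, (F|U)(V) = F(V). *)
Definition restr_sheaf (F : sheaf X) : sheaf (subspace_of U) :=
  pull_sheaf open_imageS open_image_cover open_image_meet F.

Definition restr (F : complex X) : complex (subspace_of U) :=
  @Complex _ (fun n => restr_sheaf (F n))
    (fun p q e => pull_mor open_imageS (dif F e))
    (fun _ _ _ e e' V s => dif_dif e e' s).
End OpenRestriction.

Section Inclusion.
Variables (X : finspace) (K : set X).

Definition preim_opens (V : opens X) : opens (subspace_of K) :=
  Opens (open_comp (fun x _ => @incl_continuous X K x) (oset_open V)).

Lemma preim_opensS (V W : opens X) : W `<=` V -> preim_opens W `<=` preim_opens V.
Proof. by move=> WV x; exact: WV. Qed.

Lemma preim_opens_cover (I : Type) (V : opens X) (W : I -> opens X) :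
  V `<=` \bigcup_i W i -> preim_opens V `<=` \bigcup_i preim_opens (W i).
Proof. by move=> cov x /cov[i _ Wx]; exists i. Qed.

Lemma preim_opens_meet (V W : opens X) (T : opens (subspace_of K)) :
  T `<=` preim_opens V -> T `<=` preim_opens W ->
  exists S : opens X, [/\ S `<=` V, S `<=` W & T `<=` preim_opens S].
Proof.
move=> TV TW; exists (opensI V W); split=> [x []|x []|x Tx] //.
by split; [exact: TV|exact: TW].
Qed.

Definition direct_image (F : sheaf (subspace_of K)) : sheaf X :=
  pull_sheaf preim_opensS preim_opens_cover preim_opens_meet F.

(* The colimit of F(V) over the open V containing i(W) is attained at the
   smallest such V. *)
Definition image_nbd (W : opens (subspace_of K)) : opens X :=
  minopen (incl (A := K) @` W).

Lemma image_nbdS (V W : opens (subspace_of K)) :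
  W `<=` V -> image_nbd W `<=` image_nbd V.
Proof. by move=> WV; apply: minopenS; exact: image_subset. Qed.

Definition inv_image_sheaf (F : sheaf X) : sheaf (subspace_of K) :=
  sheafify (pull_psh image_nbdS F).

Lemma inv_image_dif_dif (F : complex X) (p q r : int) (e : q = p + 1)
    (e' : r = q + 1) V (s : inv_image_sheaf (F p) V) :
  shf_map (pull_mor image_nbdS (dif F e')) V
    (shf_map (pull_mor image_nbdS (dif F e)) V s) = 0.
Proof. by apply: shf_eq => x Vx; exact: dif_dif. Qed.

Definition inv_image (F : complex X) : complex (subspace_of K) :=
  @Complex _ (fun n => inv_image_sheaf (F n))
    (fun p q e => shf_map (pull_mor image_nbdS (dif F e)))
    (@inv_image_dif_dif F).

(* The constant sheaf Z on K extended by zero; for K closed the extension by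
   zero is the direct image. *)
Definition Z_ext : sheaf X := direct_image (const_sheaf (subspace_of K) int).
End Inclusion.

Definition null_homotopic (X : finspace) (F G : complex X) (u : cmap F G) :=
  exists h : forall p q : int, p = q + 1 -> mor (F p) (G q),
    forall (q p r : int) (e : p = q + 1) (e' : r = p + 1) V s,
      u p V s = dif G e V (h p q e V s) + h r p e' V (dif F e' V s).

Definition Kinjective (X : finspace) (I : complex X) :=
  forall (A : complex X) (u : cmap A I), acyclic A -> null_homotopic u.

Record Kresolution (X : finspace) (G : complex X) := KResolution {
  Kres_ob :> complex X;
  Kres_map : cmap G Kres_ob;
  Kres_qis : qis Kres_map;
  Kres_Kinj : Kinjective Kres_ob }.

(* RHom(F, G) is computed as Hom(F, I) from a K-injective resolution G -> I. *)
Definition RHom (X : finspace) (F G : complex X) (I : Kresolution G) :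
  complex X := homc F I.

Definition biduality (X : finspace) (F G : complex X) (I : Kresolution G) :
    zigzag F (RHom (RHom F I) I) :=
  D_mor (bidual F I).

(* K-injective resolutions are unique up to homotopy equivalence under Omega, so
   the condition does not depend on the resolution that computes
   RHom(-, Omega). *)
Definition canonical_complex (X : finspace) (Omega : complex X) :=
  Dbc Omega /\ exists I : Kresolution Omega,
    forall F : complex X, Dc F -> D_iso (biduality F I).

(* Main.v *)
(* Both parts transport biduality along an adjunction. For U open, extension by
   zero j_! is an exact left adjoint of restriction, so I|U is K-injective when I
   is; as restriction commutes with Hom, biduality of G for I|U is the
   restriction to U of biduality of j_! G for I. For K closed, the complex
   J = i^-1 Hom(Z_K, I) consists of the sections of I supported in K and i_* is
   an exact left adjoint of I |-> J, so J is K-injective and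
   i_* Hom(G, J) = Hom(i_* G, I); hence biduality of i_* G for I is the direct
   image of biduality of G for J.

   It remains to see that J has finitely generated and bounded cohomology. For
   opens V1 <= V the complex Z_V1 -> Z_V -> Z_(V \ V1) is acyclic, which yields
   the long exact sequence of the sections of I on V, on V1, and on V vanishing
   on V1. With excision, adding to V1 the smallest neighbourhood of one point at
   a time gives the finiteness of the cohomology of every open set, and then of
   the sections on V vanishing on V \ K. *)
Require Import Defs.
From mathcomp Require Import all_boot all_order all_algebra all_classical.
From mathcomp Require Import topology.
From mathcomp Require Import zify finmap.
(* Restores [Defs.hom], hidden by the [hom] of mathcomp's vector library. *)
Import Defs.

Set Implicit Arguments.
Unset Strict Implicit.
Unset Printing Implicit Defensive.

Import GRing.Theory.
Local Open Scope classical_set_scope.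
Local Open Scope ring_scope.

(** Everything is read off sections over the smallest neighbourhoods [nbd x]: there sheafification
    changes nothing, so quasi-isomorphism and finiteness become statements about honest cocycles. A
    zigzag induces a relation on cohomology, hence a chain map is invertible in the derived category
    exactly when it is a quasi-isomorphism, and biduality can be handled without zigzags.

    The definition provides biduality for one K-injective resolution, while part (2) concerns the
    complex built from an arbitrary one. The two are compared by homotopy equivalences, obtained
    from mapping cones.

    Long exact sequences are never formed as such. Each use is an additive relation exhibiting one
    subquotient as a subquotient of another, so finiteness rests on the fact that subgroups of
    finitely generated abelian groups are finitely generated. A boolean lets the same devissage
    prove finite generation and vanishing. For vanishing the upper bound moves by one degree per
    point, which on a finite space still leaves the cohomology bounded. *)

Lemma subrACA (M : zmodType) (x y z t : M) :
  (x - y) - (z - t) = (x - z) - (y - t).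
Proof. by rewrite opprD addrACA -opprD. Qed.

(** * Finitely generated subquotients of abelian groups *)

Section Subquotients.
Variable M : zmodType.
Implicit Types (Z B : M -> Prop) (s : seq M).

Definition zclosed Z := Z 0 /\ forall x y, Z x -> Z y -> Z (x - y).

Lemma zclosedN Z x : zclosed Z -> Z x -> Z (- x).
Proof. by move=> [Z0 ZB] Zx; rewrite -sub0r; exact: ZB. Qed.

Lemma zclosedD Z x y : zclosed Z -> Z x -> Z y -> Z (x + y).
Proof.
by move=> Zc Zx Zy; rewrite -[y]opprK; apply: Zc.2 => //; exact: zclosedN.
Qed.

Lemma zclosed_mulz Z x (k : int) : zclosed Z -> Z x -> Z (x *~ k).
Proof.
move=> Zc Zx.
have Zn n : Z (x *+ n).
  by elim: n => [|n IH]; [exact: Zc.1|rewrite mulrS; exact: zclosedD].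
by case: k => n; [exact: Zn|rewrite NegzE mulrNz; apply: zclosedN => //; exact: Zn].
Qed.

(** Membership in B plus the span of [s]. Peeling off one generator at a time turns the later
    arguments into inductions on [s], without sums. *)
Fixpoint gen B s : M -> Prop :=
  if s is a :: s' then fun z => exists k : int, gen B s' (z - a *~ k) else B.

Lemma gen_closed B s : zclosed B -> zclosed (gen B s).
Proof.
move=> Bc; elim: s => [//|a s [IH0 IHB]] /=; split=> [|x y [k xk] [l yl]].
  by exists 0; rewrite mulr0z subr0.
by exists (k - l); rewrite mulrzBr subrACA; exact: IHB.
Qed.

Lemma gen_cat B s t : gen B (s ++ t) = gen (gen B t) s.
Proof. by elim: s => [//|a s /= ->]. Qed.

Lemma gen_mono B B' s z : (forall x, B x -> B' x) -> gen B s z -> gen B' s z.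
Proof.
by move=> BB'; elim: s z => [|a s IH] z /=; [exact: BB'|case=> k /IH; exists k].
Qed.

(* [fgq false Z B] says that (Z + B) / B is finitely generated, [fgq true Z B]
   that it vanishes. *)
Definition fgq (b : bool) Z B := exists s,
  [/\ b -> s = [::], forall x, x \in s -> Z x & forall z, Z z -> gen B s z].

Lemma fgq_zero b Z B : (forall z, Z z -> B z) -> fgq b Z B.
Proof. by move=> ZB; exists [::]. Qed.

Lemma fgq_true Z B z : fgq true Z B -> Z z -> B z.
Proof. by move=> [s [/(_ isT) -> _]]; exact. Qed.

(** Extensions: generators modulo K bring [z] into K, and generators of K modulo B do the rest. *)
Lemma fgq_ext b Z K B : (forall z, K z -> Z z) ->
  fgq b Z K -> fgq b K B -> fgq b Z B.
Proof.
move=> KZ [s [sb sZ sg]] [t [tb tK tg]]; exists (s ++ t); split.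
- by move=> bt; rewrite sb // tb.
- by move=> x; rewrite mem_cat => /orP[/sZ|/tK/KZ].
- by move=> z /sg; rewrite gen_cat; exact: gen_mono.
Qed.

End Subquotients.

(** Euclidean division: [g] is the least positive element, or 0 when there is none, and remainders
    modulo [g] stay in A. *)
Lemma int_subgroup (A : int -> Prop) : zclosed (M := int) A ->
  exists2 g, A g & forall k, A k -> exists q, k = g * q.
Proof.
move=> Ac.
have [[n [n0 An]]|no] := pselect (exists n : nat, (0 < n)%N /\ A n%:Z); last first.
  exists 0; first exact: Ac.1.
  move=> k Ak; exists 0; rewrite mulr0; apply: contrapT => k0; apply: no.
  exists `|k|%N; split; first by rewrite absz_gt0; apply/eqP.
  by case: k Ak k0 => // m /(zclosedN Ac); rewrite NegzE opprK.
have ex : exists n, (0 < n)%N && `[< A n%:Z >].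
  by exists n; rewrite n0; apply/asboolP.
case: (ex_minnP ex) => g /andP[g0 /asboolP Ag] gmin.
exists g%:Z => // k Ak; exists (k %/ g)%Z.
have r0 : (0 <= (k %% g)%Z)%R by rewrite modz_ge0 // -lt0n.
have rlt : ((k %% g)%Z < g%:Z)%R by rewrite ltz_pmod.
have Ar : A (k %% g)%Z.
  have -> : (k %% g)%Z = k - g%:Z *~ (k %/ g)%Z.
    by rewrite mulrzz mulrC {2}(divz_eq k g) addrC addKr.
  by apply: Ac.2 => //; exact: zclosed_mulz.
move: rlt r0 Ar; rewrite {4}(divz_eq k g).
case: (k %% g)%Z => // r rlt _ Ar.
suff -> : r = 0%N by rewrite addr0 mulrC.
apply/eqP; rewrite eqn0Ngt; apply/negP => r_gt0.
have := gmin r; rewrite r_gt0 /=; move/asboolP: Ar => -> /(_ isT).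
by rewrite leqNgt; case/negP.
Qed.

(** The coefficients at [a] of the elements of Z form a subgroup of the integers. An element [z0] of
    Z realising its generator reduces the others to elements generated by the tail. Keeping the
    length of the list means that an empty list stays empty, so vanishing is covered too. *)
Lemma gen_sub (M : zmodType) (Z B : M -> Prop) (s : seq M) :
  zclosed Z -> zclosed B -> (forall z, Z z -> gen B s z) ->
  exists t, [/\ size t = size s, forall x, x \in t -> Z x &
    forall z, Z z -> gen B t z].
Proof.
elim: s Z => [|a s IH] Z Zc Bc Zs; first by exists [::].
pose A (k : int) := exists2 z, Z z & gen B s (z - a *~ k).
have [|g [z0 Z0 z0g] gA] := @int_subgroup A.
  split=> [|k l [z Zz zk] [w Zw wl]].
    exists 0; first exact: Zc.1.
    by rewrite mulr0z subr0; apply: (gen_closed _ Bc).1.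
  exists (z - w); first exact: Zc.2.
  by rewrite mulrzBr subrACA; exact: (gen_closed _ Bc).2.
have [||t [ts tZ tg]] := IH (fun z => Z z /\ gen B s z) _ Bc.
- split; first by split; [exact: Zc.1|exact: (gen_closed _ Bc).1].
  by move=> x y [? ?] [? ?]; split; [exact: Zc.2|exact: (gen_closed _ Bc).2].
- by move=> z [].
exists (z0 :: t); split=> [|x|z Zz]; first by rewrite /= ts.
  by rewrite inE => /orP[/eqP ->|/tZ[]].
have [k zk] := Zs z Zz; have [|q kq] := gA k; first by exists z.
exists q; apply: tg; split; first by apply: Zc.2 => //; exact: zclosed_mulz.
have := (gen_closed s Bc).2 _ _ zk (zclosed_mulz q (gen_closed s Bc) z0g).
by rewrite mulrzBl -mulrzA -kq opprB addrA subrK.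
Qed.

(** Each generator gets a partner under [rho]. As [rho] is a subgroup of the product, subtracting
    the same combination on both sides keeps the pair related, until the first component is in BM
    and the second therefore in BN. *)
Lemma gen_rel (M N : zmodType) (rho : M -> N -> Prop) (BM : M -> Prop)
    (BN : N -> Prop) (s : seq M) :
  zclosed (M := (M * N)%type) (fun u => rho u.1 u.2) ->
  (forall m z, BM m -> rho m z -> BN z) ->
  (forall x, x \in s -> exists z, rho x z) ->
  exists t : seq N, [/\ size t = size s,
    forall z, z \in t -> exists m, rho m z &
    forall m z, gen BM s m -> rho m z -> gen BN t z].
Proof.
move=> rc BMN; elim: s => [|a s IH] sr; first by exists [::].
have [t [ts tr tg]] := IH (fun x xs => sr x (mem_behead (s := a :: s) xs)).
have [a' aa'] := sr a (mem_head a s).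
exists (a' :: t); split=> [|z|m z [k mk] mz]; first by rewrite /= ts.
  by rewrite inE => /orP[/eqP ->|/tr//]; exists a.
exists k; apply: (tg (m - a *~ k)) => //.
have E : (a, a') *~ k = (a *~ k, a' *~ k) :> M * N.
  have En n : (a, a') *+ n = (a *+ n, a' *+ n) :> M * N.
    by elim: n => [//|n IHn]; rewrite !mulrS IHn.
  by case: k {mk} => n; rewrite ?NegzE ?mulrNz -!pmulrn En.
have := zclosed_mulz k rc (aa' : (fun u => rho u.1 u.2) (a, a')).
by rewrite E => /(rc.2 (m, z) (a *~ k, a' *~ k) mz).
Qed.

Lemma zclosed_pair (M N : zmodType) (rho : M -> N -> Prop) :
  rho 0 0 ->
  (forall m z m' z', rho m z -> rho m' z' -> rho (m - m') (z - z')) ->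
  zclosed (M := (M * N)%type) (fun u => rho u.1 u.2).
Proof. by move=> r0 rB; split=> // -[m z] [m' z']; exact: rB. Qed.

(* [rho] is an additive relation inducing an injection of the second subquotient
   into a quotient of a subgroup of the first. *)
Lemma fgq_rel (M N : zmodType) (rho : M -> N -> Prop) b (ZM BM : M -> Prop)
    (ZN BN : N -> Prop) :
  zclosed ZM -> zclosed BM ->
  zclosed (M := (M * N)%type) (fun u => rho u.1 u.2) ->
  (forall m z, rho m z -> ZN z) ->
  (forall z, ZN z -> exists2 m, ZM m & rho m z) ->
  (forall m z, BM m -> rho m z -> BN z) ->
  fgq b ZM BM -> fgq b ZN BN.
Proof.
move=> ZMc BMc rc rN tot inj [s [sb sZ sg]].
pose Z' m := ZM m /\ exists z, rho m z.
have Z'c : zclosed Z'.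
  split; first by split; [exact: ZMc.1|exists 0; exact: rc.1].
  move=> x y [Zx [z xz]] [Zy [w yw]]; split; first exact: ZMc.2.
  by exists (z - w); exact: (rc.2 (x, z) (y, w)).
have [t [ts tZ tg]] := gen_sub Z'c BMc (fun z h => sg z h.1).
have [u [us uZ ug]] := gen_rel rc inj (fun x xt => (tZ x xt).2).
exists u; split=> [bt|z /uZ[m /rN]|z Zz] //.
  by apply/nilP; rewrite /nilp us ts sb.
by have [m Zm mz] := tot z Zz; apply: (ug m) => //; apply: tg; split; [|exists z].
Qed.

Lemma fingenP (M : zmodType) : fingen M <-> exists s : seq M, forall z, gen (eq^~ 0) s z.
Proof.
have E s (z : M) : (exists c : nat -> int, z = \sum_(i < size s) s`_i *~ c i) <->
    gen (eq^~ 0) s z.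
  elim: s z => [|a s IH] z /=; split=> [[c ->]|].
  - by rewrite big_ord0.
  - by move=> ->; exists (fun=> 0); rewrite big_ord0.
  - exists (c 0%N); apply/IH; exists (fun i => c i.+1).
    by rewrite big_ord_recl addrC addKr.
  - move=> [k /IH[c cE]]; exists (fun i => if i is j.+1 then c j else k).
    by rewrite big_ord_recl /= -cE addrC subrK.
by split=> -[s sg]; exists s => z; apply/E.
Qed.

(** * Sheaves on a finite space through their stalks *)

Section Points.
Variable X : finspace.
Implicit Types (F : sheaf X) (V W : opens X).

Lemma nbd_cover V : V `<=` \bigcup_(p : {x | oset V x}) nbd (sval p).
Proof. by move=> x Vx; exists (exist _ x Vx) => //; exact: nbd_id. Qed.

Lemma res_irr (F : presheaf X) V W (h k : W `<=` V) s : res F h s = res F k s.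
Proof. by rewrite (Prop_irrelevance h k). Qed.

Lemma nbd_sep F V (s t : F V) :
  (forall x (Vx : oset V x), germ F Vx s = germ F Vx t) -> s = t.
Proof.
move=> e; apply: (sheafP F (fun p : {x | oset V x} => nbd_sub (svalP p))
  (@nbd_cover V)).1 => p; exact: (e _ (svalP p)).
Qed.

Lemma nbd_glue F V (s : forall x, oset V x -> stalk F x) :
  (forall x y (Vx : oset V x) (Vy : oset V y) (yx : nbd y `<=` nbd x),
    res F yx (s x Vx) = s y Vy) ->
  exists t : F V, forall x (Vx : oset V x), germ F Vx t = s x Vx.
Proof.
move=> sc.
have [|t te] := (sheafP F (fun p : {x | oset V x} => nbd_sub (svalP p))
  (@nbd_cover V)).2 (fun p => s _ (svalP p)).
  move=> p q T Tp Tq; apply: nbd_sep => x Tx; rewrite /germ.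
  have Vx : oset V x by apply: (nbd_sub (svalP p)); exact: Tp.
  rewrite (res_comp _ _ (nbd_sub (Tp x Tx))) (res_comp _ _ (nbd_sub (Tq x Tx))).
  by rewrite !(sc _ x _ Vx).
exists t => x Vx; rewrite /germ.
have := te (exist _ x Vx); move: (svalP _) => /= Vx'.
by rewrite (Prop_irrelevance Vx' Vx).
Qed.

Lemma sheaf_empty F V (s t : F V) : (forall x, ~ oset V x) -> s = t.
Proof. by move=> V0; apply: nbd_sep => x Vx; case: (V0 x Vx). Qed.

(** A sheaf on a finite space amounts to a functor on its points: the stalks are values at [nbd x],
    and [nbd_glue] recovers the other sections. Hence a morphism into a sheaf may be given on
    stalks. *)
Lemma mor_of_stalks (P : presheaf X) F
    (m : forall x, {additive P (nbd x) -> F (nbd x)}) :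
  (forall x y (h : nbd y `<=` nbd x) s, m y (res P h s) = res F h (m x s)) ->
  exists u : mor P F, forall x s, u (nbd x) s = m x s.
Proof.
move=> mr.
have ex V (s : P V) : {t : F V | forall x (Vx : oset V x),
    germ F Vx t = m x (germ P Vx s)}.
  apply/cid/nbd_glue => x y Vx Vy h; rewrite -mr; congr (m y _).
  by rewrite /germ (res_comp _ _ (nbd_sub Vy)).
have uB V : zmod_morphism (fun s => sval (ex V s)).
  move=> s t; apply: nbd_sep => x Vx; rewrite raddfB.
  by rewrite (svalP (ex V _) x Vx) (svalP (ex V s) x Vx) (svalP (ex V t) x Vx)
    !raddfB.
have ur V W (h : W `<=` V) s :
    mk_additive (uB W) (res P h s) = res F h (mk_additive (uB V) s).
  apply: nbd_sep => x Wx.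
  rewrite [LHS](svalP (ex W _) x Wx) /germ (res_comp _ _ (nbd_sub (h x Wx))).
  by rewrite (res_comp _ _ (nbd_sub (h x Wx))) [RHS](svalP (ex V s) x (h x Wx)).
exists (Mor ur) => x s; rewrite /=.
have := svalP (ex (nbd x) s) x (nbd_id x); rewrite /germ !res_id; exact.
Qed.

Lemma mor_ext_stalks (P : presheaf X) F (u v : mor P F) :
  (forall x s, u (nbd x) s = v (nbd x) s) -> forall V s, u V s = v V s.
Proof.
by move=> e V s; apply: nbd_sep => x Vx; rewrite /germ -!app_res; exact: e.
Qed.

Lemma shf_at_res (P : presheaf X) V (s : sheafify P V) x y (Vx : oset V x)
    (Vy : oset V y) (h : nbd y `<=` nbd x) :
  shf_at s Vy = res P h (shf_at s Vx).
Proof.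
have [W [WV [t [Wx tE]]]] := shf_atP s Vx.
have Wy : oset W y by apply: (nbd_sub Wx); apply: h; exact: nbd_id.
rewrite (shf_at_irr s Vy (WV _ Wy)) (shf_at_irr s Vx (WV _ Wx)) !tE /germ.
by rewrite (res_comp _ _ (nbd_sub Wy)).
Qed.

Section Unit.
Variables (P : presheaf X) (V : opens X).

Lemma shf_unit_loc (s : P V) :
  loc_section ((fun x (Vx : oset V x) => germ P Vx s) : germs P V).
Proof.
move=> x Vx; exists V, (@subset_refl _ V), s; split=> // y Vy.
exact: res_irr.
Qed.

Definition shf_unit (s : P V) : sheafify P V :=
  sub_mk (S := Subgroup _) (shf_unit_loc s).

Lemma shf_unitE s x (Vx : oset V x) : shf_at (shf_unit s) Vx = germ P Vx s.
Proof. by []. Qed.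
End Unit.

(** With [shf_unit_nbdK]: sheafification does not change the sections over [nbd x], since the germ
    at [x] restricts to all the others. *)
Lemma shf_nbdE (P : presheaf X) x (s : sheafify P (nbd x)) :
  s = shf_unit (shf_at s (nbd_id x)).
Proof.
apply: shf_eq => y xy; rewrite shf_unitE.
by rewrite (shf_at_res _ (nbd_id x) xy (nbd_sub xy)).
Qed.

Lemma shf_unit_nbdK (P : presheaf X) x (s : P (nbd x)) :
  shf_at (shf_unit s) (nbd_id x) = s.
Proof. by rewrite shf_unitE /germ res_id. Qed.

Lemma shf_map_at (P Q : presheaf X) (u : mor P Q) V s x (Vx : oset V x) :
  shf_at (shf_map u V s) Vx = u (nbd x) (shf_at s Vx).
Proof. by []. Qed.

Lemma shf_map_iso (P Q : presheaf X) (u : mor P Q) :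
  mor_iso (shf_map u) <-> forall x, bijective (u (nbd x)).
Proof.
split=> [bu x|bu V].
  have [v uv vu] := bu (nbd x).
  exists (fun t => shf_at (v (shf_unit t)) (nbd_id x)) => [s|t].
    have -> : shf_unit (u (nbd x) s) = shf_map u (nbd x) (shf_unit s).
      by apply: shf_eq => y xy; rewrite shf_map_at !shf_unitE /germ app_res.
    by rewrite uv shf_unit_nbdK.
  by rewrite -shf_map_at vu shf_unit_nbdK.
have v x : {v : Q (nbd x) -> P (nbd x) | cancel (u (nbd x)) v /\ cancel v (u (nbd x))}.
  by apply: cid; have [w] := bu x; exists w.
have lv (s : sheafify Q V) : loc_section
    ((fun x Vx => sval (v x) (shf_at s Vx)) : germs P V).
  move=> x Vx; exists (nbd x), (nbd_sub Vx), (sval (v x) (shf_at s Vx)).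
  split=> [|y xy]; first exact: nbd_id.
  apply: (can_inj (svalP (v y)).1); rewrite (svalP (v y)).2 /germ app_res.
  rewrite (svalP (v x)).2; exact: shf_at_res.
exists (fun s => sub_mk (S := Subgroup _) (lv s)) => s; apply: shf_eq => x Vx.
  rewrite [LHS]/(sval (v x) (u (nbd x) (shf_at s Vx))).
  exact: (svalP (v x)).1.
by rewrite shf_map_at; exact: (svalP (v x)).2.
Qed.
End Points.

(** * Cohomology at the stalks *)

Section Coh.
Variable X : finspace.
Implicit Types (F G : complex X) (V : opens X).

Definition cobound F n V (z : F n V) :=
  exists p (e : n = p + 1) (y : F p V), z = dif F e V y.

Lemma cocycleE F n m (e : m = n + 1) V (z : F n V) :
  cocycle z <-> dif F e V z = 0.
Proof. by subst m. Qed.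

Lemma cocycle_zclosed F n V : zclosed (@cocycle X F n V).
Proof. exact: cocycle_closed. Qed.

Lemma coboundE F n V (z : sub_zmod (cocycles F n V)) :
  coboundaries F n V z <-> cobound (sub_val z).
Proof. by []. Qed.

Lemma coboundP F n m (e : n = m + 1) V (z : F n V) :
  cobound z <-> exists y, z = dif F e V y.
Proof.
split=> [[p [e' [y ->]]]|[y ->]]; last by exists m, e, y.
have pm : p = m by apply: (addIr 1); rewrite -e -e'.
by subst p; exists y; rewrite (eq_irrelevance e e').
Qed.

Lemma cobound_zclosed F n V : zclosed (@cobound F n V).
Proof.
have e : n = (n - 1) + 1 by rewrite subrK.
split=> [|x y /(coboundP e)[s ->] /(coboundP e)[t ->]]; apply/(coboundP e).
  by exists 0; rewrite raddf0.
by exists (s - t); rewrite raddfB.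
Qed.

Lemma quo_pi_eq0 (M : zmodType) (S : subgroup M) x : quo_pi S x = 0 <-> S x.
Proof. by rewrite -(raddf0 (quo_pi S)) quo_piE subr0. Qed.

Lemma coh_map_bij F G (u : cmap F G) n x :
  bijective (coh_app u n (nbd x)) <->
  (forall z : F n (nbd x), cocycle z -> cobound (u n _ z) -> cobound z) /\
  (forall z : G n (nbd x), cocycle z -> exists2 y : F n (nbd x), cocycle y &
    cobound (z - u n _ y)).
Proof.
split=> [[v uv vu]|[inj sur]].
  split=> z zc.
    move=> uz; apply: (coboundE (sub_mk (S := cocycles F n _) zc)).1.
    apply: (quo_pi_eq0 _ _).1.
    apply: (can_inj uv); rewrite raddf0 [LHS]coh_map_atE.
    exact: (quo_pi_eq0 _ _).2.
  have [y yE] := quo_pi_surj (v (quo_pi _ (sub_mk (S := cocycles G n _) zc))).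
  exists (sub_val y); first exact: sub_valP y.
  have /(congr1 (coh_app u n (nbd x))) := yE.
  by rewrite vu [LHS]coh_map_atE => /esym/quo_piE/coboundE.
have injb : injective (coh_app u n (nbd x)).
  move=> c d; have [y <-] := quo_pi_surj c; have [z <-] := quo_pi_surj d.
  rewrite [LHS]coh_map_atE [RHS]coh_map_atE => /quo_piE/coboundE yz.
  apply/quo_piE/coboundE; apply: inj; first exact: sub_valP (y - z).
  by move: yz; rewrite !sub_valB raddfB.
have surb c : exists d, coh_app u n (nbd x) d = c.
  have [z <-] := quo_pi_surj c; have [y yc zy] := sur _ (sub_valP z).
  exists (quo_pi _ (sub_mk (S := cocycles F n _) yc)).
  by apply/esym; rewrite [RHS]coh_map_atE; apply/quo_piE/coboundE.
exists (fun c => sval (cid (surb c))) => c; last exact: svalP (cid (surb c)).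
by apply: injb; exact: svalP (cid (surb _)).
Qed.

Lemma qisP F G (u : cmap F G) : qis u <-> forall n x,
  (forall z : F n (nbd x), cocycle z -> cobound (u n _ z) -> cobound z) /\
  (forall z : G n (nbd x), cocycle z -> exists2 y : F n (nbd x), cocycle y &
    cobound (z - u n _ y)).
Proof.
split=> [qu n x|qu n].
  by apply/coh_map_bij; exact: ((shf_map_iso _).1 (qu n) x).
by apply/shf_map_iso => x; apply/coh_map_bij.
Qed.

(** For V = [nbd x] this concerns the stalk of the cohomology sheaf. For other V it concerns the
    cohomology of the complex of sections, which is the hypercohomology of V when F is
    K-injective. *)
Definition coh_fg b F n V := fgq b (@cocycle X F n V) (@cobound F n V).

Lemma gen_quo F n V (s : seq (F n V)) (z : sub_zmod (cocycles F n V)) t :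
  s = map (@sub_val _ _) t ->
  gen (@cobound F n V) s (sub_val z) <->
  gen (eq^~ 0) (map (quo_pi (coboundaries F n V)) t) (quo_pi _ z).
Proof.
move=> ->; elim: t z => [|a t IH] z /=; first by rewrite quo_pi_eq0.
have valM k : sub_val z - sub_val a *~ k = sub_val (z - a *~ k).
  rewrite sub_valB; congr (_ - _).
  exact: esym (raddfMz (mk_additive (@sub_valB _ (cocycles F n V))) k a).
split=> -[k kz]; exists k.
  by move: kz; rewrite valM IH raddfB raddfMz.
by rewrite valM IH raddfB raddfMz.
Qed.

Lemma stalk_coh_fg F n x : fingen (stalk (coh F n) x) <-> coh_fg false F n (nbd x).
Proof.
pose at_ (c : stalk (coh F n) x) := shf_at c (nbd_id x).
have atB : zmod_morphism at_ by [].
have atM c d k : at_ (c - d *~ k) = at_ c - at_ d *~ k.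
  by rewrite atB; congr (_ - _); exact: (raddfMz (mk_additive atB)).
have at_inj c : at_ c = 0 -> c = 0.
  move=> c0; rewrite (shf_nbdE c) [X in shf_unit X]c0.
  by apply: shf_eq => y xy; rewrite shf_unitE raddf0.
rewrite fingenP; split=> [[s sg]|[s [_ sZ sg]]].
  have [t tE] : exists t, map at_ s = map (quo_pi (coboundaries F n (nbd x))) t.
    elim: s {sg} => [|a s [t /= ->]]; first by exists [::].
    by have [b <-] := quo_pi_surj (at_ a); exists (b :: t).
  exists (map (@sub_val _ _) t); split=> // [|z zc].
    by move=> _ /mapP[y _ ->]; exact: sub_valP y.
  pose z' := sub_mk (S := cocycles F n _) zc.
  rewrite -[z]/(sub_val z') (gen_quo z' erefl) -tE.
  rewrite -(shf_unit_nbdK (P := coh_psh F n) (quo_pi _ z')).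
  have {sg} := sg (shf_unit (P := coh_psh F n) (quo_pi _ z')).
  move: (shf_unit _) => c; rewrite -/(at_ c).
  elim: s c {tE} => [|a s IH] c /=; first by move=> ->.
  by move=> [k /IH kc]; exists k; rewrite -[X in gen _ _ X]atM.
have [t tE] : exists t, s = map (@sub_val _ (cocycles F n (nbd x))) t.
  elim: s sZ {sg} => [|a s IH] sZ; first by exists [::].
  have [t tE] := IH (fun z zs => sZ z (mem_behead (s := a :: s) zs)).
  have ac := sZ a (mem_head a s).
  by exists (sub_mk (S := cocycles F n _) ac :: t); rewrite /= -tE.
exists (map (fun y => shf_unit (P := coh_psh F n) (quo_pi _ y)) t) => c.
have [y yc] := quo_pi_surj (at_ c).
have := sg _ (sub_valP y); rewrite (gen_quo y tE) yc {s sZ sg tE yc}.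
elim: t c => [|a t IH] c /=; first exact: at_inj.
move=> [k kc]; exists k; apply: IH.
by rewrite atM /at_ shf_unit_nbdK.
Qed.

Lemma zero_cohP F n :
  zero_psh (coh F n) <-> forall x, coh_fg true F n (nbd x).
Proof.
split=> [z0 x|z0 V s].
  apply: fgq_zero => z zc.
  apply: (coboundE (sub_mk (S := cocycles F n _) zc)).1.
  apply: (quo_pi_eq0 _ _).1.
  rewrite -[LHS](shf_unit_nbdK (P := coh_psh F n)).
  by rewrite (z0 _ (shf_unit (P := coh_psh F n) _)).
apply: shf_eq => x Vx; have [y <-] := quo_pi_surj (shf_at s Vx).
apply: (quo_pi_eq0 _ _).2; apply: (coboundE _).2.
by apply: (fgq_true (z0 x)); exact: sub_valP y.
Qed.

Lemma acyclicP F : acyclic F <->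
  forall n x (z : F n (nbd x)), cocycle z -> cobound z.
Proof.
split=> [a n x z|a n].
  by move/(zero_cohP F n): (a n) => /(_ x) /fgq_true; exact.
by apply/zero_cohP => x; apply: fgq_zero; exact: a.
Qed.

Lemma DbcP F : Dbc F <->
  (forall n x, coh_fg false F n (nbd x)) /\
  exists N : nat, forall n x, (N < `|n|)%N -> coh_fg true F n (nbd x).
Proof.
split=> -[Fc [N FN]]; split.
- by move=> n x; apply/stalk_coh_fg.
- by exists N => n x /FN/zero_cohP.
- by move=> n x; apply/stalk_coh_fg.
- by exists N => n nN; apply/zero_cohP => x; exact: FN.
Qed.
End Coh.

(** * Isomorphisms of the derived category *)

Section DerivedIso.
Variable X : finspace.
Implicit Types (F G H : complex X) (V W : opens X).

Lemma coh_map_id F n V a : coh_map (cmap_id F) n V a = a.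
Proof.
apply: shf_eq => x Vx; rewrite shf_map_at.
have [z <-] := quo_pi_surj (shf_at a Vx).
by rewrite [LHS]coh_map_atE; congr (quo_pi _ _); exact: sub_val_inj.
Qed.

Lemma coh_map_comp F G H (v : cmap G H) (u : cmap F G) n V a :
  coh_map (cmap_comp v u) n V a = coh_map v n V (coh_map u n V a).
Proof.
apply: shf_eq => x Vx; rewrite !shf_map_at.
have [z <-] := quo_pi_surj (shf_at a Vx).
rewrite -[RHS]/(coh_app v n _ (coh_app u n _ (quo_pi _ z))).
rewrite [LHS]coh_map_atE [coh_app u _ _ _]coh_map_atE.
by rewrite [RHS]coh_map_atE; congr (quo_pi _ _); exact: sub_val_inj.
Qed.

(* The graph of the map induced by a zigzag on cohomology. *)
Fixpoint zrel F G (z : zigzag F G) n V : coh F n V -> coh G n V -> Prop :=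
  match z in zigzag F G return coh F n V -> coh G n V -> Prop with
  | Znil _ => fun a b => a = b
  | Zfwd _ _ _ u z => fun a b => zrel z (coh_map u n V a) b
  | Zbwd _ _ _ u _ z => fun a b => exists2 a', coh_map u n V a' = a & zrel z a' b
  end.

Lemma zrel_cat F G H (z : zigzag F G) (t : zigzag G H) n V a c :
  zrel (zcat z t) a c <-> exists2 b : coh G n V, zrel z a b & zrel t b c.
Proof.
elim: z t a => [F'|F' G' H' u z IH|F' G' H' u uq z IH] t a /=.
- by split=> [tac|[b ->]]; first exists a.
- exact: IH.
- split=> [[a' ua' /IH[b zb tb]]|[b [a' ua' zb] tb]].
    by exists b => //; exists a'.
  by exists a' => //; apply/IH; exists b.
Qed.

(** Cohomology inverts quasi-isomorphisms, so it factors through the localisation. Relations in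
    place of maps avoid choosing inverses for the backward arrows. *)
Lemma zrel_eq F G (z t : zigzag F G) : zeq z t ->
  forall n V a b, @zrel F G z n V a b <-> zrel t a b.
Proof.
elim=> {F G z t}.
- by [].
- by move=> F G z t _ IH n V a b; split=> /IH.
- by move=> F G z t w _ IH1 _ IH2 n V a b; split=> [/IH1/IH2|/IH2/IH1].
- by move=> F G H u z t _ IH n V a b /=.
- move=> F G H u uq z t _ IH n V a b /=.
  by split=> -[a' ua' /IH zb]; exists a'.
- move=> F G z n V a b.
  by rewrite -[X in X <-> _]/(zrel z (coh_map (cmap_id F) n V a) b) coh_map_id.
- move=> F G H K u v z n V a b.
  rewrite -[X in X <-> _]/(zrel z (coh_map v n V (coh_map u n V a)) b).
  by rewrite -[X in _ <-> X]/(zrel z (coh_map (cmap_comp v u) n V a) b)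
    coh_map_comp.
- move=> F G H u uq z n V a b /=; split=> [[a' /(bij_inj (uq n V)) ->]|] //.
  by exists a.
- move=> F G H u uq z n V a b /=; split=> [[a' <-]|] //.
  have [v uv vu] := uq n V; rewrite -{1}[a]vu => zb.
  by exists (v a); first exact: vu.
Qed.

(** An inverse zigzag induces on cohomology the relation converse to the graph of [u], which makes
    [u] bijective there. Conversely a single backward arrow is the inverse. *)
Lemma D_iso_qis F G (u : cmap F G) : D_iso (D_mor u) <-> qis u.
Proof.
split=> [[t [ut tu]] n V|uq].
  have tE c a : zrel t c a <-> coh_map u n V a = c.
    have := zrel_eq tu c (coh_map u n V a); rewrite /= zrel_cat /= => tuE.
    split=> [ta|<-]; first by apply/esym/tuE; exists a.
    by have := zrel_eq ut a a; rewrite /= => ->.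
  have ex c : exists a, coh_map u n V a = c.
    have [_ /(_ erefl)] := zrel_eq tu c c; rewrite zrel_cat => -[a ta _].
    by exists a; apply/tE.
  exists (fun c => sval (cid (ex c))) => a; last exact: svalP (cid (ex a)).
  have e := svalP (cid (ex (coh_map u n V a))); move: (sval _) e => b e.
  by have [+ _] := zrel_eq ut a b; rewrite /= tE => /(_ e).
exists (Zbwd uq (Znil F)); split.
  exact: (zeq_trans (zeq_fwd_bwd uq _) (zeq_refl _)).
exact: zeq_bwd_fwd.
Qed.

Lemma qis_id F : qis (cmap_id F).
Proof.
move=> n V; exists id => a; first exact: coh_map_id.
by rewrite coh_map_id.
Qed.

Lemma cocycle_cm F G (u : cmap F G) n V (z : F n V) :
  cocycle z -> cocycle (u n V z).
Proof. by rewrite /cocycle -cm_dif => ->; rewrite raddf0. Qed.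

Lemma cobound_cm F G (u : cmap F G) n V (z : F n V) :
  cobound z -> cobound (u n V z).
Proof. by move=> [p [e [y ->]]]; exists p, e, (u p V y); rewrite cm_dif. Qed.

Lemma cocycle_res F n V W (h : W `<=` V) (z : F n V) :
  cocycle z -> cocycle (res (F n) h z).
Proof. by rewrite /cocycle app_res => ->; rewrite raddf0. Qed.

Lemma cocycle_inj F G (u : cmap F G) n V (z : F n V) :
  injective (u (n + 1) V) -> cocycle (u n V z) -> cocycle z.
Proof. by move=> ui; rewrite /cocycle -cm_dif => e; apply: ui; rewrite e raddf0. Qed.

Definition cmap_bij F G (u : cmap F G) := forall n V, bijective (u n V).

Lemma cmap_bij_cocycle F G (u : cmap F G) n V (z : F n V) : cmap_bij u ->
  cocycle (u n V z) <-> cocycle z.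
Proof.
move=> ub; split; last exact: cocycle_cm.
by apply: cocycle_inj; exact: bij_inj (ub _ _).
Qed.

Lemma cmap_bij_cobound F G (u : cmap F G) n V (z : F n V) : cmap_bij u ->
  cobound (u n V z) <-> cobound z.
Proof.
move=> ub; split; last exact: cobound_cm.
move=> [p [e [y zy]]]; have [v uv vu] := ub p V.
exists p, e, (v y); apply: (bij_inj (ub n V)).
by rewrite zy cm_dif vu.
Qed.

(** Stated for a commutative square with bijective sides, so that no inverse has to be shown to be a
    chain map. *)
Lemma qis_square F F' G H K (u : cmap F G) (a : cmap F F') (v : cmap F' H)
    (p : cmap G K) (q : cmap H K) :
  cmap_bij a -> cmap_bij p -> cmap_bij q ->
  (forall n V s, p n V (u n V s) = q n V (v n V (a n V s))) ->
  qis u <-> qis v.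
Proof.
move=> ab pb qb sq; split=> /qisP h; apply/qisP => n x; have [inj sur] := h n x.
- have [a' aa' a'a] := ab n (nbd x); have [q' qq' q'q] := qb n (nbd x).
  have [p' pp' p'p] := pb n (nbd x).
  split=> z zc.
    rewrite -(cmap_bij_cobound _ qb) -[z]a'a -sq (cmap_bij_cobound _ pb) => uz.
    apply: cobound_cm; apply: inj uz; apply/(cmap_bij_cocycle _ ab).
    by rewrite a'a.
  have [|y yc zy] := sur (p' (q n _ z)).
    by apply/(cmap_bij_cocycle _ pb); rewrite p'p; exact: cocycle_cm.
  exists (a n _ y); first exact: cocycle_cm.
  apply/(cmap_bij_cobound _ qb); rewrite raddfB -sq -[q n _ z]p'p -raddfB.
  exact: cobound_cm.
- have [a' aa' a'a] := ab n (nbd x); have [q' qq' q'q] := qb n (nbd x).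
  split=> z zc.
    rewrite -(cmap_bij_cobound _ pb) sq (cmap_bij_cobound _ qb) => uz.
    apply/(cmap_bij_cobound _ ab); apply: inj uz; exact: cocycle_cm.
  have [|y yc zy] := sur (q' (p n _ z)).
    by apply/(cmap_bij_cocycle _ qb); rewrite q'q; exact: cocycle_cm.
  exists (a' y); first by apply/(cmap_bij_cocycle _ ab); rewrite a'a.
  apply/(cmap_bij_cobound _ pb); rewrite raddfB sq a'a -[p n _ z]q'q -raddfB.
  exact: cobound_cm.
Qed.
End DerivedIso.

(** * Lifting chain maps to K-injective complexes *)

Section Cast.
Variables (X : finspace) (F : complex X).
Implicit Types V W : opens X.

(** Degrees such as [n - 1 + 1] and [n] are equal only by a proof, which the shift in the cone makes
    visible. *)
Definition castm (p q : int) (e : p = q) : mor (F p) (F q) :=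
  match e in _ = q return mor (F p) (F q) with erefl => mor_id (F p) end.

Lemma castm_id p (e : p = p) V s : castm e V s = s.
Proof. by rewrite (eq_irrelevance e erefl). Qed.

Lemma dif_castm p q r (h : p = q) (e : r = q + 1) (e' : r = p + 1) V s :
  dif F e V (castm h V s) = dif F e' V s.
Proof. by subst q; rewrite castm_id (eq_irrelevance e e'). Qed.

Lemma castm_dif p q r (e : q = p + 1) (h : q = r) (e' : r = p + 1) V s :
  castm h V (dif F e V s) = dif F e' V s.
Proof. by subst r; rewrite castm_id (eq_irrelevance e e'). Qed.

Lemma castm_comp p q r (h : p = q) (k : q = r) (l : p = r) V s :
  castm k V (castm h V s) = castm l V s.
Proof. by subst r q; rewrite !castm_id. Qed.
End Cast.

Section Cone.
Variables (X : finspace) (A B : complex X) (q : cmap A B).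
Implicit Types V W : opens X.

(* The degree n part is A^n + B^(n-1), a shift of the mapping cone, with
   d (s, t) = (d s, q s - d t). *)
Definition cone_fam (n : int) (b : bool) : sheaf X := if b then A n else B (n - 1).

Definition cone_ob (n : int) : sheaf X := prod_sheaf (cone_fam n).

Definition cone_mk n V (s : A n V) (t : B (n - 1) V) : cone_ob n V :=
  fun b => match b return cone_fam n b V with true => s | false => t end.

Definition cone_fst n V (c : cone_ob n V) : A n V := c true.
Definition cone_snd n V (c : cone_ob n V) : B (n - 1) V := c false.

Lemma cone_eq n V (c d : cone_ob n V) :
  cone_fst c = cone_fst d -> cone_snd c = cone_snd d -> c = d.
Proof. by move=> e1 e2; apply: functional_extensionality_dep => -[]. Qed.

Lemma cone_mkB n V (s s' : A n V) (t t' : B (n - 1) V) :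
  cone_mk s t - cone_mk s' t' = cone_mk (s - s') (t - t').
Proof. exact: cone_eq. Qed.

Lemma cone_mk_res n V W (h : W `<=` V) s t :
  res (cone_ob n) h (cone_mk s t) = cone_mk (res (A n) h s) (res (B (n - 1)) h t).
Proof. exact: cone_eq. Qed.

Section Dif.
Variables (n m : int) (e : m = n + 1).

Lemma cone_e1 : n = m - 1. Proof. by rewrite e addrK. Qed.
Lemma cone_e2 : m - 1 = n - 1 + 1. Proof. by rewrite e addrK subrK. Qed.

Definition cone_dif_fun V (c : cone_ob n V) : cone_ob m V :=
  cone_mk (dif A e V (cone_fst c))
    (castm B cone_e1 V (q n V (cone_fst c)) - dif B cone_e2 V (cone_snd c)).

Lemma cone_snd_dif V (c : cone_ob n V) : cone_snd (cone_dif_fun c) =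
  castm B cone_e1 V (q n V (cone_fst c)) - dif B cone_e2 V (cone_snd c).
Proof. by []. Qed.

Lemma cone_difB V : zmod_morphism (@cone_dif_fun V).
Proof.
move=> c d; apply: cone_eq; first exact: raddfB.
rewrite -[RHS]/(cone_snd (cone_dif_fun c) - cone_snd (cone_dif_fun d)).
by rewrite !cone_snd_dif -subrACA -!raddfB.
Qed.

Lemma cone_dif_res V W (h : W `<=` V) c :
  mk_additive (@cone_difB W) (res (cone_ob n) h c) =
  res (cone_ob m) h (mk_additive (@cone_difB V) c).
Proof.
rewrite [RHS]cone_mk_res.
by rewrite raddfB -!app_res.
Qed.

Definition cone_dif : mor (cone_ob n) (cone_ob m) := Mor cone_dif_res.
End Dif.

Lemma cone_dif_dif p r t (e : r = p + 1) (e' : t = r + 1) V c :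
  cone_dif e' V (cone_dif e V c) = 0.
Proof.
apply: cone_eq; first exact: dif_dif.
rewrite [LHS](cone_snd_dif e') -[cone_fst _]/(dif A e V (cone_fst c)).
rewrite (cone_snd_dif e).
have e2 : t - 1 = p + 1 by rewrite e' addrK e.
rewrite raddfB dif_dif subr0 cm_dif (castm_dif _ _ e2) (dif_castm _ _ e2).
by rewrite subrr.
Qed.

Definition cone : complex X := Complex cone_dif_dif.

(** A cocycle (s, t) has q s = d t. Injectivity on cohomology gives s = d y; then t - q y is a
    cocycle, and surjectivity gives a cocycle z with t - q y - q z = d w. The primitive is (y + z, -
    w). *)
Lemma cone_acyclic : qis q -> acyclic cone.
Proof.
move=> /qisP qq; apply/acyclicP => n x c cc.
have [qi _] := qq n x; have [_ qs] := qq (n - 1) x.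
have e : n = (n - 1) + 1 by rewrite subrK.
have c1 : cocycle (cone_fst c) by exact: (congr1 (@cone_fst _ _) cc).
have c2 : castm B (cone_e1 (erefl (n + 1))) _ (q n _ (cone_fst c)) =
    dif B (cone_e2 (erefl (n + 1))) _ (cone_snd c).
  by apply/eqP; rewrite -subr_eq0; apply/eqP; exact: (congr1 (@cone_snd _ _) cc).
have qE : q n _ (cone_fst c) = dif B e _ (cone_snd c).
  have e' := esym (cone_e1 (erefl (n + 1))).
  have := congr1 (castm B e' _) c2.
  by rewrite (castm_comp _ e' erefl) castm_id (castm_dif _ e' e).
have /(coboundP e)[y yE] : cobound (cone_fst c).
  by apply: qi => //; apply/(coboundP e); exists (cone_snd c).
have [|z zc] := qs (cone_snd c - q _ _ y).
  by apply/(cocycleE e); rewrite raddfB -cm_dif -yE qE subrr.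
move=> /(coboundP (cone_e2 e))[w wE].
apply/(coboundP e); exists (cone_mk (y + z) (- w)).
apply: cone_eq; first by
  rewrite /= [RHS]raddfD -yE [dif A e _ z](cocycleE e _).1 // addr0.
rewrite [RHS](cone_snd_dif e) -[cone_fst _]/(y + z) -[cone_snd (cone_mk _ _)]/(- w).
by rewrite castm_id raddfN opprK raddfD -addrA (addrC (q _ _ z)) -[in RHS]wE
  subrK addrC subrK.
Qed.
End Cone.

Section KinjLift.
Variables (X : finspace) (A B : complex X) (q : cmap A B).
Implicit Types V W : opens X.

Lemma cone_inlB n V : zmod_morphism (fun s => cone_mk s 0 : cone_ob A B n V).
Proof. by move=> s t; rewrite cone_mkB subrr. Qed.

Lemma cone_inl_res n V W (h : W `<=` V) s :
  mk_additive (@cone_inlB n W) (res (A n) h s) =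
  res (cone_ob A B n) h (mk_additive (@cone_inlB n V) s).
Proof. by rewrite [RHS]cone_mk_res raddf0. Qed.

Definition cone_inl n : mor (A n) (cone q n) := Mor (@cone_inl_res n).

Lemma cone_inrB n V : zmod_morphism (fun t => cone_mk 0 t : cone_ob A B n V).
Proof. by move=> s t; rewrite cone_mkB subrr. Qed.

Lemma cone_inr_res n V W (h : W `<=` V) t :
  mk_additive (@cone_inrB n W) (res (B (n - 1)) h t) =
  res (cone_ob A B n) h (mk_additive (@cone_inrB n V) t).
Proof. by rewrite [RHS]cone_mk_res raddf0. Qed.

Definition cone_inr n : mor (B (n - 1)) (cone q n) := Mor (@cone_inr_res n).

Lemma cone_fstB n V : zmod_morphism (fun c : cone_ob A B n V => cone_fst c).
Proof. by []. Qed.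

Definition cone_fst_mor n : mor (cone q n) (A n) :=
  @Mor X (cone q n) (A n) (fun V => mk_additive (@cone_fstB n V))
    (fun _ _ _ _ => erefl).

Lemma dif_cone_inl p r (e : r = p + 1) (k : p = r - 1) V s :
  dif (cone q) e V (cone_inl p V s) =
  cone_inl r V (dif A e V s) + cone_inr r V (castm B k V (q p V s)).
Proof.
apply: cone_eq.
  rewrite -[RHS]/(dif A e V s + 0) addr0; exact: erefl.
rewrite [LHS](cone_snd_dif q e) -[cone_snd _]/(0 : B (p - 1) V) raddf0 subr0.
rewrite -[RHS]/(0 + castm B k V (q p V s)) add0r.
by rewrite (eq_irrelevance (cone_e1 e) k).
Qed.

Lemma dif_cone_inr p r (e : r = p + 1) (k : r - 1 = p - 1 + 1) V t :
  dif (cone q) e V (cone_inr p V t) = - cone_inr r V (dif B k V t).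
Proof.
apply: cone_eq; first by rewrite -[RHS]/(- 0) oppr0; exact: raddf0.
rewrite [LHS](cone_snd_dif q e) -[cone_fst _]/(0 : A p V) !raddf0 sub0r.
by rewrite (eq_irrelevance (cone_e2 e) k).
Qed.

Lemma Kinj_lift (I : complex X) (f : cmap A I) : Kinjective I -> qis q ->
  exists (w : cmap B I) (h : forall p q : int, p = q + 1 -> mor (A p) (I q)),
    forall (t p r : int) (e : p = t + 1) (e' : r = p + 1) V s,
      f p V s = w p V (q p V s) +
        (dif I e V (h p t e V s) + h r p e' V (dif A e' V s)).
Proof.
move=> IK qq.
pose u n := mor_comp (f n) (cone_fst_mor n).
have ud (p r : int) (e : r = p + 1) V c :
    u r V (dif (cone q) e V c) = dif I e V (u p V c).
  by rewrite -[RHS]cm_dif.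
have [h0 hE] := IK _ (Cmap ud) (cone_acyclic qq).
have k (n : int) : n = n + 1 - 1 by rewrite addrK.
pose w n := mor_comp (h0 (n + 1) n erefl)
  (mor_comp (cone_inr (n + 1)) (castm B (k n))).
have wE n V t :
    w n V t = h0 (n + 1) n erefl V (cone_inr (n + 1) V (castm B (k n) V t)).
  by [].
have wd (p r : int) (e : r = p + 1) V t : w r V (dif B e V t) = dif I e V (w p V t).
  subst r; rewrite !wE; set t' := castm B (k p) V t.
  (* On the summand B the map [u] is zero, so the homotopy identity reduces to the compatibility of
     [w] with the differentials. *)
  have := hE p (p + 1) (p + 1 + 1) erefl erefl V (cone_inr (p + 1) V t').
  have e2 : p + 1 + 1 - 1 = p + 1 - 1 + 1 by rewrite subrK addrK.
  rewrite [X in X = _](raddf0 (f (p + 1) V)) (dif_cone_inr _ e2) raddfN => /eqP.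
  rewrite eq_sym subr_eq0 => /eqP ->; congr (h0 _ _ _ _ (cone_inr _ _ _)).
  have e3 : p + 1 + 1 - 1 = p + 1 by rewrite addrK.
  by rewrite (castm_dif _ _ (etrans e3 erefl)) (dif_castm _ _ (etrans e3 erefl)).
exists (Cmap wd), (fun p t e => mor_comp (h0 p t e) (cone_inl p)).
move=> t p r e e' V s; subst r.
have := hE t p (p + 1) e erefl V (cone_inl p V s).
rewrite -[X in X = _]/(f p V s) => ->.
rewrite (dif_cone_inl _ (k p)) raddfD addrA addrC; congr (_ + _).
Qed.
End KinjLift.

(** Two out of three for quasi-isomorphisms: [f] and [w q], being homotopic, agree on cohomology. *)
Lemma qis_of_comp (X : finspace) (A B I : complex X) (f : cmap A I) (q : cmap A B)
    (w : cmap B I) (h : forall p q : int, p = q + 1 -> mor (A p) (I q)) :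
  (forall (t p r : int) (e : p = t + 1) (e' : r = p + 1) V s,
      f p V s = w p V (q p V s) +
        (dif I e V (h p t e V s) + h r p e' V (dif A e' V s))) ->
  qis f -> qis q -> qis w.
Proof.
move=> hE /qisP qf /qisP qq; apply/qisP => n x.
have [fi fs] := qf n x; have [qi qs] := qq n x.
have en : n = (n - 1) + 1 by rewrite subrK.
have fE s : cocycle s -> cobound (f n (nbd x) s - w n _ (q n _ s)).
  move=> sc; rewrite (hE _ _ _ en erefl) [dif A _ _ s]sc raddf0 addr0 addrC addKr.
  by apply/(coboundP en); exists (h n (n - 1) en _ s).
have Bc := cobound_zclosed I n (nbd x); split=> z zc.
  move=> wz; have [s sc zs] := qs z zc.
  have : cobound (f n _ s).
    rewrite -[f n _ s](subrK (w n _ (q n _ s))).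
    apply: zclosedD => //; first exact: fE.
    rewrite -[w n _ (q n _ s)](subKr (w n _ z)) -raddfB.
    by apply: Bc.2 => //; exact: cobound_cm.
  move/(fi _ sc)/(cobound_cm q) => qsb; rewrite -[z](subrK (q n _ s)).
  by apply: zclosedD => //; exact: cobound_zclosed.
have [s sc zs] := fs z zc; exists (q n _ s); first exact: cocycle_cm.
rewrite -[z](subrK (f n _ s)) -addrA; apply: zclosedD => //; exact: fE.
Qed.

(** * Biduality along a pull-back with a counit *)

Section HomMapBij.
Variables (X : finspace) (A A' B : sheaf X) (u : mor A' A).
Hypothesis ub : mor_iso u.
Implicit Types V W T : opens X.

Lemma hom_map_bij V : bijective (hom_map u (mor_id B) V).
Proof.
have v W : {v : A W -> A' W | cancel (u W) v /\ cancel v (u W)}.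
  by apply: cid; have [w] := ub W; exists w.
have vB W : zmod_morphism (sval (v W)).
  move=> s t; apply: (can_inj (svalP (v W)).1); rewrite raddfB.
  by rewrite !(svalP (v W)).2.
have vr W T (h : T `<=` W) s :
    mk_additive (vB T) (res A h s) = res A' h (mk_additive (vB W) s).
  by apply: (can_inj (svalP (v T)).1); rewrite app_res !(svalP (v _)).2.
exists (hom_map (Mor vr) (mor_id B) V) => f; apply: hom_eq => W WV s.
  rewrite -[LHS]/(hom_at f WV (u W (sval (v W) s))).
  by rewrite (svalP (v W)).2.
rewrite -[LHS]/(hom_at f WV (sval (v W) (u W s))).
by rewrite (svalP (v W)).1.
Qed.
End HomMapBij.

Section HomcMap.
Variables (X : finspace) (F F' I : complex X) (u : cmap F' F).
Implicit Types V W T : opens X.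

Lemma homc_mapB n V : zmod_morphism (fun f : homc F I n V =>
  (fun b => hom_map (u (bsrc b)) (mor_id (I (btgt b))) V (f b)) : homc F' I n V).
Proof.
by move=> f g; apply: functional_extensionality_dep => b; apply: hom_eq.
Qed.

Lemma homc_map_res n V W (h : W `<=` V) f :
  mk_additive (@homc_mapB n W) (res (homc F I n) h f) =
  res (homc F' I n) h (mk_additive (@homc_mapB n V) f).
Proof. by apply: functional_extensionality_dep => b; apply: hom_eq. Qed.

Lemma homc_map_dif n m (e : m = n + 1) V f :
  Mor (@homc_map_res m) V (dif (homc F I) e V f) =
  dif (homc F' I) e V (Mor (@homc_map_res n) V f).
Proof.
apply: functional_extensionality_dep => b; apply: hom_eq => W WV s.
rewrite [RHS]hom_difE [LHS](hom_difE e f (b := b) WV (u (bsrc b) W s)).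
by rewrite -cm_dif.
Qed.

Definition homc_map : cmap (homc F I) (homc F' I) := Cmap homc_map_dif.

Lemma homc_mapE n V (f : homc F I n V) b W (WV : W `<=` V) s :
  hom_at (homc_map n V f b) WV s = hom_at (f b) WV (u (bsrc b) W s).
Proof. by []. Qed.

Lemma homc_map_bij : cmap_bij u -> cmap_bij homc_map.
Proof.
move=> ub n V.
have v (b : bideg n) : {v | cancel (hom_map (u (bsrc b)) (mor_id (I (btgt b))) V) v
    /\ cancel v (hom_map (u (bsrc b)) (mor_id (I (btgt b))) V)}.
  apply: cid; have [v uv vu] := hom_map_bij (I (btgt b)) (ub (bsrc b)) V.
  by exists v.
exists (fun f b => sval (v b) (f b)) => f; apply: functional_extensionality_dep => b.
  exact: (svalP (v b)).1.
exact: (svalP (v b)).2.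
Qed.
End HomcMap.

Section PullComplex.
Variables (X Y : finspace) (phi : opens Y -> opens X).
Hypothesis phiS : forall V W : opens Y, W `<=` V -> phi W `<=` phi V.
Hypothesis phi_cover : forall (I : Type) (V : opens Y) (W : I -> opens Y),
  V `<=` \bigcup_i W i -> phi V `<=` \bigcup_i phi (W i).
Hypothesis phi_meet : forall (V W : opens Y) (T : opens X),
  T `<=` phi V -> T `<=` phi W ->
  exists S : opens Y, [/\ S `<=` V, S `<=` W & T `<=` phi S].
Implicit Types V W T : opens Y.

(** One construction for two functors: restriction to an open subset, where [phi] takes images of
    opens, and direct image from a subspace, where [phi] takes traces. *)
Definition pullc (F : complex X) : complex Y :=
  @Complex _ (fun n => pull_sheaf phiS phi_cover phi_meet (F n))
    (fun p q e => pull_mor phiS (dif F e))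
    (fun _ _ _ e e' V s => dif_dif e e' s).

Lemma pull_cmap_dif F G (u : cmap F G) p q (e : q = p + 1) V s :
  pull_mor phiS (u q) V (dif (pullc F) e V s) =
  dif (pullc G) e V (pull_mor phiS (u p) V s).
Proof. exact: cm_dif. Qed.

Definition pull_cmap F G (u : cmap F G) : cmap (pullc F) (pullc G) :=
  @Cmap _ (pullc F) (pullc G) (fun n => pull_mor phiS (u n)) (pull_cmap_dif u).

Section HomPull.
Variables (A B : sheaf X) (C : sheaf Y) (e : mor (pull_psh phiS B) C).
Local Notation pA := (pull_sheaf phiS phi_cover phi_meet A).

Section At.
Variable V : opens Y.

Section Fun.
Variable f : hom A B (phi V).

Lemma hom_pull_B W (WV : W `<=` V) :
  zmod_morphism (fun s : pA W => e W (hom_at f (phiS WV) s)).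
Proof. by move=> s t; rewrite !raddfB. Qed.

Lemma hom_pull_res (W T : opens Y) (WV : W `<=` V) (TV : T `<=` V)
    (TW : T `<=` W) (s : pA W) :
  mk_additive (hom_pull_B TV) (res pA TW s) =
  res C TW (mk_additive (hom_pull_B WV) s).
Proof.
rewrite [LHS]/= [mk_additive _ _]/=.
rewrite -[LHS]/(e T (hom_at f (phiS TV) (res A (phiS TW) s))).
rewrite -[RHS]/(res C TW (e W (hom_at f (phiS WV) s))).
by rewrite (hom_at_res f (phiS WV)) -app_res.
Qed.

Definition hom_pull_fun : hom pA C V := mk_hom hom_pull_res.
End Fun.

Lemma hom_pull_zmod_morphism : zmod_morphism hom_pull_fun.
Proof. by move=> f g; apply: hom_eq => W WV s; exact: (raddfB (e W)). Qed.

(** Used where it is bijective: for an open subset with [e] the identity, and for a closed one with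
    [e] the inclusion of the sections supported there. *)
Definition hom_pull : {additive hom A B (phi V) -> hom pA C V} :=
  mk_additive hom_pull_zmod_morphism.

Lemma hom_pullE f W (WV : W `<=` V) (s : pA W) :
  hom_at (hom_pull f) WV s = e W (hom_at f (phiS WV) s).
Proof. by []. Qed.
End At.
End HomPull.

Variables (J : complex X) (I : complex Y) (eps : cmap (pullc J) I).

Section Homc.
Variable F : complex X.

Lemma homc_pullB n V : zmod_morphism (fun f : homc F J n (phi V) =>
  (fun b => hom_pull (F (bsrc b)) (eps (btgt b)) V (f b)) : homc (pullc F) I n V).
Proof.
move=> f g; apply: functional_extensionality_dep => b.
exact: (raddfB (hom_pull (F (bsrc b)) (eps (btgt b)) V)).
Qed.

Lemma homc_pull_res n V W (h : W `<=` V) f :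
  mk_additive (@homc_pullB n W) (res (pullc (homc F J) n) h f) =
  res (homc (pullc F) I n) h (mk_additive (@homc_pullB n V) f).
Proof.
apply: functional_extensionality_dep => b; apply: hom_eq => T TW s.
rewrite [RHS](hom_resE h _ _ (subset_trans TW h)) [RHS]hom_pullE [LHS]hom_pullE.
congr (eps _ _ _).
by rewrite [LHS](hom_resE (phiS h) _ _ (phiS (subset_trans TW h))).
Qed.

Lemma homc_pull_dif n m (e : m = n + 1) V f :
  Mor (@homc_pull_res m) V (dif (pullc (homc F J)) e V f) =
  dif (homc (pullc F) I) e V (Mor (@homc_pull_res n) V f).
Proof.
apply: functional_extensionality_dep => b; apply: hom_eq => W WV s.
rewrite [RHS]hom_difE [LHS]hom_pullE.
rewrite [X in eps _ _ X](hom_difE e f (b := b) (phiS WV) s) raddfB raddfMz.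
by rewrite -[eps _ _ (dif J _ _ _)]/(eps _ _ (dif (pullc J) _ _ _)) cm_dif.
Qed.

Definition homc_pull : cmap (pullc (homc F J)) (homc (pullc F) I) :=
  @Cmap _ (pullc (homc F J)) _ _ homc_pull_dif.

Lemma homc_pullE n V (f : homc F J n (phi V)) b W (WV : W `<=` V)
  (s : pullc F (bsrc b) W) :
  hom_at (homc_pull n V f b) WV s = eps (btgt b) W (hom_at (f b) (phiS WV) s).
Proof. by []. Qed.

Lemma homc_pull_bij :
  (forall (A : sheaf X) n V, bijective (hom_pull A (eps n) V)) ->
  cmap_bij homc_pull.
Proof.
move=> hb n V.
have v (b : bideg n) : {v | cancel (hom_pull (F (bsrc b)) (eps (btgt b)) V) v
    /\ cancel v (hom_pull (F (bsrc b)) (eps (btgt b)) V)}.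
  apply: cid; have [v uv vu] := hb (F (bsrc b)) (btgt b) V.
  by exists v.
exists (fun f b => sval (v b) (f b)) => f; apply: functional_extensionality_dep => b.
  exact: (svalP (v b)).1.
exact: (svalP (v b)).2.
Qed.
End Homc.

Lemma cmap_comp_bij F G H (v : cmap (X := Y) G H) (u : cmap F G) :
  cmap_bij v -> cmap_bij u -> cmap_bij (cmap_comp v u).
Proof. by move=> vb ub n V; exact: (bij_comp (vb n V) (ub n V)). Qed.

(* Both sides of the biduality square for G = pullc F land in
   Hom(pullc (Hom(F, J)), I), where they send s to f |-> eps (f s), up to sign. *)
Lemma bidual_pull (F : complex X) (G : complex Y) (eta : cmap G (pullc F)) :
  (forall (A : sheaf X) n V, bijective (hom_pull A (eps n) V)) ->
  cmap_bij eta ->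
  qis (bidual G I) <-> qis (pull_cmap (bidual F J)).
Proof.
move=> hb etab.
pose p := homc_map I (cmap_comp (homc_map I eta) (homc_pull F)).
apply: (@qis_square _ _ _ _ _ _ (bidual G I) eta (pull_cmap (bidual F J)) p
  (homc_pull (homc F J))) => //.
- apply: homc_map_bij; apply: cmap_comp_bij; last exact: homc_pull_bij.
  exact: homc_map_bij.
- exact: homc_pull_bij.
move=> n V s; apply: functional_extensionality_dep => b.
apply: hom_eq => W WV f.
rewrite homc_mapE [LHS]bidualE homc_pullE.
rewrite [X in _ = eps _ _ X](bidualE (I := J) (eta n V s) (b := b) (phiS WV) f).
rewrite raddfMz; congr (_ *~ _).
rewrite -[LHS]/(eps _ W (hom_at (f (Bideg (bideg_swap b)))
  (phiS (@subset_refl _ W)) (eta n W (res (G n) WV s)))).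
by rewrite app_res (hom_at_irr _ _ (@subset_refl _ (phi W))).
Qed.
End PullComplex.

Lemma inj_surj_bij (T T' : Type) (f : T -> T') :
  injective f -> (forall y, exists x, f x = y) -> bijective f.
Proof.
move=> fi fs; exists (fun y => sval (cid (fs y))) => [x|y].
  by apply: fi; exact: svalP (cid (fs _)).
exact: svalP (cid (fs y)).
Qed.

Lemma cmap_bij_qis (X : finspace) (F G : complex X) (u : cmap F G) :
  cmap_bij u -> qis u.
Proof.
move=> ub; apply/qisP => n x; split=> z zc; first by move/(cmap_bij_cobound _ ub).
have [v uv vu] := ub n (nbd x); exists (v z).
  by apply/(cmap_bij_cocycle _ ub); rewrite vu.
by rewrite vu subrr; exact: (cobound_zclosed _ _ _).1.
Qed.

Lemma qis_coh_fg (X : finspace) (F G : complex X) (u : cmap F G) b n x :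
  qis u -> coh_fg b F n (nbd x) <-> coh_fg b G n (nbd x).
Proof.
move=> /qisP /(_ n x)[ui us].
have Fc := cocycle_zclosed F n (nbd x); have Gc := cocycle_zclosed G n (nbd x).
have Fb := cobound_zclosed F n (nbd x); have Gb := cobound_zclosed G n (nbd x).
split.
  pose rho m z := [/\ cocycle m, cocycle z & cobound (z - u n (nbd x) m)].
  apply: (fgq_rel (rho := rho)) => //.
  - apply: zclosed_pair => [|m z m' z' [mc zc mz] [m'c z'c mz']].
      split; [exact: Fc.1|exact: Gc.1|rewrite raddf0 subr0; exact: Gb.1].
    by split; [exact: Fc.2|exact: Gc.2|rewrite raddfB subrACA; exact: Gb.2].
  - by move=> m z [].
  - by move=> z zc; have [m mc mz] := us z zc; exists m.
  - move=> m z mb [_ _ mz]; rewrite -[z](subrK (u n _ m)).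
    by apply: zclosedD => //; exact: cobound_cm.
pose rho m z := cocycle z /\ m = u n (nbd x) z.
apply: (fgq_rel (rho := rho)) => //.
- apply: zclosed_pair => [|m z m' z' [zc ->] [z'c ->]].
    by split; [exact: Fc.1|rewrite raddf0].
  by split; [exact: Fc.2|rewrite raddfB].
- by move=> m z [].
- by move=> z zc; exists (u n _ z) => //; exact: cocycle_cm.
- by move=> m z + [zc mz]; rewrite mz; exact: ui.
Qed.

(** * Smallest neighbourhoods in a subspace, and direct images *)

Section Subspace.
Variables (X : finspace) (K : set X).
Implicit Types V W T : opens X.

Lemma preim_nbd (y : subspace_of K) : preim_opens K (nbd (incl y)) = nbd y.
Proof.
apply: opens_eq; apply/seteqP; split=> [z|].
  have [O Oo OE] := oset_open (nbd y).
  have Oy : oset (Opens Oo) (incl y).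
    by change ((set_val @^-1` O) y); rewrite OE; exact: (nbd_id y).
  by move=> /(nbd_sub Oy); change (O (incl z) -> oset (nbd y) z); rewrite -OE.
by apply: (nbd_sub (V := preim_opens K _)); exact: (nbd_id (incl y)).
Qed.

Definition dirc : complex (subspace_of K) -> complex X :=
  pullc (@preim_opensS X K) (@preim_opens_cover X K) (@preim_opens_meet X K).

Lemma dirc_empty (F : complex (subspace_of K)) n V (s t : dirc F n V) :
  (forall x, oset V x -> ~ K x) -> s = t.
Proof.
move=> VK; apply: (sheaf_empty (F := F n)) => y Vy.
by apply: (VK _ Vy); exact: set_valP.
Qed.
End Subspace.

(** * Sections supported in an open subset, and extension by zero *)

Section Supp.
Variables (X : finspace) (U : set X).
Implicit Types V W T : opens X.

Section Sheaf.
Variable F : sheaf X.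

Definition supp_in V (s : F V) :=
  forall x (Vx : oset V x), ~ U x -> germ F Vx s = 0.

Lemma supp_in_closed V : zclosed (@supp_in V).
Proof.
split=> [x Vx _|s t sU tU x Vx xU]; first exact: raddf0.
by rewrite raddfB sU // tU // subrr.
Qed.

Definition supp_sg V : subgroup (F V) := Subgroup (supp_in_closed V).

Lemma supp_in_res V W (h : W `<=` V) s : supp_in s -> supp_in (res F h s).
Proof.
move=> sU x Wx xU; rewrite /germ (res_comp _ _ (nbd_sub (h x Wx))).
exact: sU.
Qed.

Definition supp_res V W (h : W `<=` V) :
    {additive sub_zmod (supp_sg V) -> sub_zmod (supp_sg W)} :=
  sub_map (S := supp_sg V) (T := supp_sg W) (@supp_in_res V W h).

Lemma supp_res_id V (h : V `<=` V) s : supp_res h s = s.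
Proof. by apply: sub_val_inj; exact: res_id. Qed.

Lemma supp_res_comp V W T (h : W `<=` V) (k : T `<=` W) (l : T `<=` V) s :
  supp_res k (supp_res h s) = supp_res l s.
Proof. by apply: sub_val_inj; exact: (res_comp h k l (sub_val s)). Qed.

Definition supp_psh : presheaf X := Presheaf supp_res_id supp_res_comp.

Lemma supp_is_sheaf : is_sheaf supp_psh.
Proof.
move=> I V W WV cov; have [sep glue] := sheafP F WV cov; split=> [s t e|s e].
  apply: sub_val_inj; apply: sep => i.
  exact: (congr1 (@sub_val _ (supp_sg (W i))) (e i)).
have [|t te] := glue (fun i => sub_val (s i)).
  by move=> i j T Ti Tj; exact: (congr1 (@sub_val _ (supp_sg T)) (e i j T Ti Tj)).
have tU : supp_sg V t.
  move=> x Vx xU; have [i _ Wx] := cov x Vx.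
  have := sub_valP (s i) x Wx xU; rewrite -te /germ.
  by rewrite (res_comp _ _ (nbd_sub Vx)).
by exists (sub_mk tU) => i; apply: sub_val_inj; exact: te.
Qed.

Definition supp_sheaf : sheaf X := Sheaf supp_is_sheaf.
End Sheaf.

Lemma supp_in_mor (F G : sheaf X) (u : mor F G) V (s : F V) :
  supp_in s -> supp_in (u V s).
Proof. by move=> sU x Vx xU; rewrite /germ -app_res [res _ _ _]sU // raddf0. Qed.

Definition supp_mor_at (F G : sheaf X) (u : mor F G) V :
    {additive supp_sheaf F V -> supp_sheaf G V} :=
  sub_map (S := supp_sg F V) (T := supp_sg G V) (@supp_in_mor F G u V).

Lemma supp_mor_res (F G : sheaf X) (u : mor F G) V W (h : W `<=` V) s :
  supp_mor_at u W (res (supp_sheaf F) h s) =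
  res (supp_sheaf G) h (supp_mor_at u V s).
Proof. by apply: sub_val_inj; exact: (app_res u h (sub_val s)). Qed.

Definition supp_mor (F G : sheaf X) (u : mor F G) :
  mor (supp_sheaf F) (supp_sheaf G) := Mor (supp_mor_res u).

Lemma supp_dif_dif (F : complex X) p q r (e : q = p + 1) (e' : r = q + 1) V s :
  supp_mor (dif F e') V (supp_mor (dif F e) V s) = 0.
Proof. by apply: sub_val_inj; exact: (dif_dif e e' (sub_val s)). Qed.

Definition suppc (F : complex X) : complex X :=
  @Complex _ (fun n => supp_sheaf (F n)) (fun p q e => supp_mor (dif F e))
    (@supp_dif_dif F).

Lemma supp_nbd0 (F : sheaf X) x (s : supp_sheaf F (nbd x)) : ~ U x -> s = 0.
Proof.
move=> xU; apply: sub_val_inj.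
by have := sub_valP s x (nbd_id x) xU; rewrite /germ res_id.
Qed.
End Supp.

Section OpenSubspace.
Variables (X : finspace) (U : set X) (Uo : open U).
Local Notation Y := (subspace_of U).
Local Notation oi := (open_image Uo).

Lemma preim_image (W : opens Y) : preim_opens U (oi W) = W.
Proof.
apply: opens_eq; apply/seteqP; split=> [y [z Wz]|y Wy]; last by exists y.
by move/incl_inj <-.
Qed.

Lemma image_preim (W : opens X) : W `<=` U -> oi (preim_opens U W) = W.
Proof.
move=> WU; apply: opens_eq; apply/seteqP; split=> [_ [y Wy <-] //|x Wx].
by exists (exist _ x (mem_set (WU x Wx))).
Qed.

Lemma open_image_nbd (y : Y) : oi (nbd y) = nbd (incl y).
Proof.
rewrite -preim_nbd image_preim //.
by apply: (nbd_sub (V := Opens Uo)); exact: set_valP.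
Qed.

Lemma image_sub (W : opens Y) : oi W `<=` U.
Proof. by move=> _ [y _ <-]; exact: set_valP. Qed.

Lemma restr_coh_fg b (F : complex X) n y :
  coh_fg b (restr Uo F) n (nbd y) = coh_fg b F n (nbd (incl y)).
Proof. by rewrite -open_image_nbd. Qed.

Definition restr_map (F G : complex X) (u : cmap F G) :
    cmap (restr Uo F) (restr Uo G) :=
  pull_cmap (open_imageS (Uo := Uo)) (open_image_cover (Uo := Uo))
    (open_image_meet (Uo := Uo)) u.

Lemma restr_qis (F G : complex X) (u : cmap F G) : qis u -> qis (restr_map u).
Proof.
move=> /qisP uq; apply/qisP => n y.
have := uq n (incl y); rewrite -open_image_nbd; exact.
Qed.

(** Every open subset of [oi V] is the image of an open subset of V, so both sides are made of the
    same families of maps. *)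
Lemma restr_hom_bij (A B : sheaf X) V :
  bijective (hom_pull (open_image_cover (Uo := Uo))
    (open_image_meet (Uo := Uo)) A (mor_id (restr_sheaf Uo B)) V).
Proof.
apply: inj_surj_bij => [f g fg|g].
  apply: hom_eq => W WV s.
  have [W' W'V WE] : exists2 W' : opens Y, W' `<=` V & W = oi W'.
    exists (preim_opens U W).
      by rewrite -[V]preim_image; exact: preim_opensS.
    by rewrite image_preim //; apply: subset_trans WV _; exact: image_sub.
  subst W; rewrite !(hom_at_irr _ WV (open_imageS W'V)).
  have E := congr1 (fun u : hom (restr_sheaf Uo A) (restr_sheaf Uo B) V =>
    hom_at u W'V s) fg.
  exact: E.
(* For W inside [oi V] the inclusions [le1] and [le2] are equalities; restricting along them
   replaces transport along equal opens. *)
have le1 (W : opens X) : oi (preim_opens U W) `<=` W by move=> _ [y Wy <-].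
have le2 (W : opens X) : W `<=` oi V -> W `<=` oi (preim_opens U W).
  move=> WV; rewrite image_preim //; apply: subset_trans WV _; exact: image_sub.
have le3 (W : opens X) : W `<=` oi V -> preim_opens U W `<=` V.
  by move=> WV; rewrite -[V]preim_image; exact: preim_opensS.
have fB (W : opens X) (WV : W `<=` oi V) : zmod_morphism (fun s : A W =>
    res B (le2 W WV) (hom_at g (le3 W WV) (res A (le1 W) s))).
  by move=> s t; rewrite (raddfB (res A _)) raddfB raddfB.
have fr (W T : opens X) (WV : W `<=` oi V) (TV : T `<=` oi V) (TW : T `<=` W) s :
    mk_additive (fB T TV) (res A TW s) = res B TW (mk_additive (fB W WV) s).
  rewrite -[LHS]/(res B (le2 T TV)
    (hom_at g (le3 T TV) (res A (le1 T) (res A TW s)))).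
  rewrite -[RHS]/(res B TW
    (res B (le2 W WV) (hom_at g (le3 W WV) (res A (le1 W) s)))).
  have TW' : preim_opens U T `<=` preim_opens U W by exact: preim_opensS.
  pose TW2 := open_imageS (Uo := Uo) TW'.
  have l := subset_trans (le1 T) TW.
  rewrite (res_comp _ _ l) -(res_comp (le1 W) TW2 l).
  rewrite -[res A TW2 _]/(res (restr_sheaf Uo A) TW' (res A (le1 W) s)).
  rewrite (hom_at_res g (le3 W WV)).
  have l' := subset_trans TW (le2 W WV).
  rewrite [RHS](res_comp _ _ l') -[LHS]/(res B (le2 T TV) (res B TW2 _)).
  by rewrite (res_comp _ _ l').
exists (mk_hom fr); apply: hom_eq => W WV s.
rewrite -[LHS]/(res B (le2 _ (open_imageS WV))
  (hom_at g (le3 _ (open_imageS WV)) (res A (le1 _) s))).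
move: (le1 (oi W)) (le2 _ (open_imageS WV)) (le3 _ (open_imageS WV)).
rewrite preim_image => k1 k2 k3.
by rewrite !res_id; exact: hom_at_irr.
Qed.
End OpenSubspace.

Section ExtensionByZero.
Variables (X : finspace) (U : set X) (Uo : open U).
Local Notation Y := (subspace_of U).
Local Notation oi := (open_image Uo).
Variable A : complex Y.
Implicit Types V W : opens Y.

(** Extension by zero, found inside the direct image as the sections whose germs vanish outside U;
    no sheafification is involved. *)
Definition ext0 : complex X := suppc U (dirc A).

Definition ext0_sec n (V : opens X) (s : ext0 n V) : A n (preim_opens U V) := sub_val s.

Lemma ext0_eq n (V : opens X) (s t : ext0 n V) : ext0_sec s = ext0_sec t -> s = t.
Proof. exact: sub_val_inj. Qed.

Lemma image_supp n (W : opens Y) (s : dirc A n (oi W)) : supp_in U s.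
Proof. by move=> x Wx xU; case: xU; exact: image_sub Wx. Qed.

Lemma preim_image_sub W : preim_opens U (oi W) `<=` W.
Proof. by rewrite preim_image. Qed.

Lemma sub_preim_image W : W `<=` preim_opens U (oi W).
Proof. by rewrite preim_image. Qed.

Definition ext0_unit_fun n W (s : A n W) : restr Uo ext0 n W :=
  sub_mk (S := supp_sg U (dirc A n) (oi W))
    (image_supp (W := W) (res (A n) (@preim_image_sub W) s)).

Lemma ext0_unitE n W (s : A n W) :
  ext0_sec (ext0_unit_fun s) = res (A n) (@preim_image_sub W) s.
Proof. by []. Qed.

Lemma ext0_unitB n W : zmod_morphism (@ext0_unit_fun n W).
Proof. by move=> s t; apply: ext0_eq; exact: raddfB. Qed.

Lemma ext0_unit_res n V W (h : W `<=` V) s :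
  mk_additive (@ext0_unitB n W) (res (A n) h s) =
  res (restr Uo ext0 n) h (mk_additive (@ext0_unitB n V) s).
Proof.
apply: ext0_eq; rewrite [LHS]ext0_unitE.
rewrite -[RHS]/(res (A n) (preim_opensS (open_imageS h))
  (res (A n) (@preim_image_sub V) s)).
have l := subset_trans (@preim_image_sub W) h.
by rewrite (res_comp _ _ l) (res_comp _ _ l).
Qed.

Lemma ext0_unit_dif n m (e : m = n + 1) W s :
  Mor (@ext0_unit_res m) W (dif A e W s) =
  dif (restr Uo ext0) e W (Mor (@ext0_unit_res n) W s).
Proof. by apply: ext0_eq; rewrite [LHS]ext0_unitE -app_res. Qed.

Definition ext0_unit : cmap A (restr Uo ext0) := Cmap ext0_unit_dif.

Lemma ext0_unit_bij : cmap_bij ext0_unit.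
Proof.
move=> n W; apply: inj_surj_bij => [s t /(congr1 (@ext0_sec n (oi W)))|t].
  rewrite [LHS]ext0_unitE [RHS]ext0_unitE.
  move/(congr1 (res (A n) (@sub_preim_image W))).
  by rewrite !(res_comp _ _ (@subset_refl _ W)) !res_id.
exists (res (A n) (@sub_preim_image W) (ext0_sec t)).
apply: ext0_eq; rewrite [LHS]ext0_unitE (res_comp _ _ (@subset_refl _ _)).
exact: res_id.
Qed.

(** The stalks are unchanged on U and zero outside. With [b] true this is how acyclicity passes to
    the extension by zero. *)
Lemma ext0_coh_fg b n x :
  (forall y, coh_fg b A n (nbd y)) -> coh_fg b ext0 n (nbd x).
Proof.
move=> Afg; have [xU|xU] := pselect (U x); last first.
  apply: fgq_zero => z _; rewrite (supp_nbd0 z xU); exact: (cobound_zclosed _ _ _).1.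
pose y : Y := exist _ x (mem_set xU).
rewrite -[x]/(incl y) -(restr_coh_fg Uo b ext0).
by apply/(qis_coh_fg b n y (cmap_bij_qis ext0_unit_bij)).
Qed.

Section Adjunction.
Variables (I : complex X) (u : cmap A (restr Uo I)).

Lemma nbd_image_preim x : U x -> nbd x `<=` oi (preim_opens U (nbd x)).
Proof.
by move=> Ux; rewrite image_preim //; exact: (nbd_sub (V := Opens Uo)).
Qed.

Lemma ext0_adj_stalkB n x : zmod_morphism (fun s : ext0 n (nbd x) =>
  match pselect (U x) return I n (nbd x) with
  | left Ux => res (I n) (nbd_image_preim Ux)
      (u n (preim_opens U (nbd x)) (ext0_sec s))
  | right _ => 0
  end).
Proof.
case: pselect => Ux s t; last by rewrite subrr.
by rewrite -(raddfB (res (I n) _)) -raddfB.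
Qed.

Definition ext0_adj_stalk n x : {additive ext0 n (nbd x) -> I n (nbd x)} :=
  mk_additive (@ext0_adj_stalkB n x).

Lemma ext0_adj_stalkE n x (Ux : U x) s : ext0_adj_stalk n x s =
  res (I n) (nbd_image_preim Ux) (u n (preim_opens U (nbd x)) (ext0_sec s)).
Proof.
rewrite /=; case: pselect => // Ux'.
by rewrite (Prop_irrelevance Ux' Ux).
Qed.

Lemma ext0_adj_stalk_res n x y (h : nbd y `<=` nbd x) s :
  ext0_adj_stalk n y (res (ext0 n) h s) = res (I n) h (ext0_adj_stalk n x s).
Proof.
have [Ux|xU] := pselect (U x); last by rewrite (supp_nbd0 s xU) !raddf0.
have Uy : U y.
  by apply: (nbd_sub (V := Opens Uo) Ux); apply: h; exact: nbd_id.
rewrite !ext0_adj_stalkE.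
rewrite -[ext0_sec _]/(res (A n) (preim_opensS h) (ext0_sec s)) app_res.
have l := subset_trans h (nbd_image_preim Ux).
rewrite [RHS](res_comp _ _ l).
rewrite -[X in res _ (nbd_image_preim Uy) X]/(
  res (I n) (open_imageS (preim_opensS h)) _).
by rewrite (res_comp _ _ l).
Qed.

(** The transpose under the adjunction, given on stalks: [u] at the points of U and zero elsewhere,
    where the source has zero stalk. *)
Lemma ext0_adj : exists v : cmap ext0 I,
  forall n W s, v n (oi W) (ext0_unit n W s) = u n W s.
Proof.
have /(_ _)/cid v n := mor_of_stalks (@ext0_adj_stalk_res n).
have vd p q (e : q = p + 1) (V : opens X) s :
    sval (v q) V (dif ext0 e V s) = dif I e V (sval (v p) V s).
  rewrite -[RHS]/(mor_comp (dif I e) (sval (v p)) V s).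
  rewrite -[LHS]/(mor_comp (sval (v q)) (dif ext0 e) V s).
  move: V s; apply: mor_ext_stalks => x s.
  rewrite [LHS](svalP (v q)) -[RHS]/(dif I e _ (sval (v p) _ s)) (svalP (v p)).
  have [Ux|xU] := pselect (U x); last by rewrite (supp_nbd0 s xU) !raddf0.
  rewrite !ext0_adj_stalkE [RHS]app_res.
  by rewrite -[ext0_sec (dif _ _ _ _)]/(dif A e _ (ext0_sec s)) cm_dif.
exists (Cmap vd) => n W s.
apply: nbd_sep => x Wx; rewrite /germ -[LHS]app_res [LHS](svalP (v n)).
have Ux : U x := image_sub Wx.
rewrite ext0_adj_stalkE.
have PW : preim_opens U (nbd x) `<=` W.
  by rewrite -[W](preim_image Uo); apply: preim_opensS; exact: nbd_sub.
rewrite -[ext0_sec _]/(res (A n) (preim_opensS (nbd_sub Wx))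
  (res (A n) (@preim_image_sub W) s)).
rewrite (res_comp _ _ PW) app_res.
rewrite -[X in res _ (nbd_image_preim Ux) X]/(res (I n) (open_imageS PW) _).
by rewrite (res_comp _ _ (nbd_sub Wx)).
Qed.
End Adjunction.
End ExtensionByZero.

Lemma restr_Kinjective (X : finspace) (U : set X) (Uo : open U) (I : complex X) :
  Kinjective I -> Kinjective (restr Uo I).
Proof.
move=> IK A u /acyclicP Aa; have [v vu] := ext0_adj u.
have [|h hE] := IK _ v.
  apply/acyclicP => n x z; apply: fgq_true.
  by apply: (ext0_coh_fg Uo) => y; apply: fgq_zero; exact: Aa.
exists (fun p q e => mor_comp (pull_mor (open_imageS (Uo := Uo)) (h p q e))
  (ext0_unit Uo A p)).
move=> q p r e e' W s; rewrite -vu (hE q p r e e').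
by rewrite -[dif (ext0 A) e' _ _]/(dif (restr Uo (ext0 A)) e' W _) -cm_dif.
Qed.

Lemma restr_Dbc (X : finspace) (U : set X) (Uo : open U) (F : complex X) :
  Dbc F -> Dbc (restr Uo F).
Proof.
move=> /DbcP[Ff [N FN]]; apply/DbcP; split=> [n y|].
  by rewrite restr_coh_fg.
by exists N => n y nN; rewrite restr_coh_fg; exact: FN.
Qed.

Lemma Dc_fg (X : finspace) (F : complex X) :
  Dc F <-> forall n x, coh_fg false F n (nbd x).
Proof. by split=> h n x; apply/stalk_coh_fg. Qed.

Lemma canonical_restr (X : finspace) (U : set X) (Uo : open U) (Omega : complex X) :
  canonical_complex Omega -> canonical_complex (restr Uo Omega).
Proof.
move=> [OD [I Ib]]; split; first exact: restr_Dbc.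
exists (KResolution (restr_qis Uo (Kres_qis I))
  (@restr_Kinjective _ _ Uo _ (@Kres_Kinj _ _ I))) => G /Dc_fg Gc.
apply/D_iso_qis; apply: (bidual_pull (eps := cmap_id (restr Uo I))
  (fun A n => restr_hom_bij Uo A (I n)) (ext0_unit_bij Uo G)).2.
apply: restr_qis; apply/D_iso_qis; apply: Ib; apply/Dc_fg => n x.
by apply: (ext0_coh_fg Uo) => y; exact: Gc.
Qed.

(** * Sections supported in a closed subset *)

Section ClosedSubspace.
Variables (X : finspace) (K : set X) (Kc : closed K).
Local Notation Y := (subspace_of K).
Local Notation pi := (preim_opens K).
Implicit Types V W T : opens X.

Lemma nbd_disj x y : ~ K x -> oset (nbd x) y -> ~ K y.
Proof. by move=> xK; apply: (nbd_sub (V := Opens (closed_openC Kc))). Qed.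

Lemma preim_image_nbd (W : opens Y) : pi (image_nbd W) = W.
Proof.
apply: opens_eq; apply/seteqP; split=> [z|z Wz].
  have [O Oo OE] := oset_open W.
  have WO : incl (A := K) @` W `<=` Opens Oo.
    by move=> _ [y Wy <-]; change ((set_val @^-1` O) y); rewrite OE.
  by move=> /(minopen_sub WO); change (O (incl z) -> oset W z); rewrite -OE.
by apply: sub_minopen; exists z.
Qed.

Lemma image_nbd_sub (W : opens Y) V : W `<=` pi V -> image_nbd W `<=` V.
Proof. by move=> WV; apply: minopen_sub => _ [y /WV Vy <-]. Qed.

Lemma preim_surj (W : opens Y) V : W `<=` pi V ->
  exists2 T : opens X, T `<=` V & W = pi T.
Proof.
move=> WV; exists (image_nbd W); first exact: image_nbd_sub.
by rewrite preim_image_nbd.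
Qed.

Lemma preim_surjT (W : opens Y) : exists V, W = pi V.
Proof. by exists (image_nbd W); rewrite preim_image_nbd. Qed.

Lemma supp_sep (F : sheaf X) V W (h : W `<=` V) (s t : F V) :
  (forall x, oset V x -> K x -> oset W x) ->
  supp_in K s -> supp_in K t -> res F h s = res F h t -> s = t.
Proof.
move=> VW sK tK st; apply: nbd_sep => x Vx.
have [Kx|xK] := pselect (K x); last by rewrite sK // tK.
have Wx := VW x Vx Kx.
by rewrite /germ -!(res_comp h (nbd_sub Wx) (nbd_sub Vx)) st.
Qed.

(** A direct image from K has zero stalks outside K, so its homomorphisms see only the sections of F
    supported in K. *)
Lemma dirc_supp (A : sheaf Y) (F : sheaf X) (V0 : opens X)
    (g : hom (direct_image A) F V0) V (VV0 : V `<=` V0) s :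
  supp_in K (hom_at g VV0 s).
Proof.
move=> x Vx xK; rewrite /germ -(hom_at_res g VV0 (subset_trans (nbd_sub Vx) VV0)).
rewrite [X in hom_at g _ X](_ : _ = 0) ?raddf0 //.
by apply: (sheaf_empty (F := A)) => y /(nbd_disj xK); apply; exact: set_valP.
Qed.

Lemma dirc_mor_supp (A : sheaf Y) (F : sheaf X) (g : mor (direct_image A) F) V s :
  supp_in K (g V s).
Proof.
move=> x Vx xK; rewrite /germ -app_res [X in g _ X](_ : _ = 0) ?raddf0 //.
by apply: (sheaf_empty (F := A)) => y /(nbd_disj xK); apply; exact: set_valP.
Qed.

Lemma dirc_coh_fg b (A : complex Y) n x :
  (forall y, coh_fg b A n (nbd y)) -> coh_fg b (dirc A) n (nbd x).
Proof.
move=> Afg; have [xK|xK] := pselect (K x); last first.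
  apply: fgq_zero => z _; rewrite (_ : z = 0); first exact: (cobound_zclosed _ _ _).1.
  by apply: dirc_empty => y; exact: nbd_disj.
have := Afg (exist _ x (mem_set xK) : Y); rewrite -preim_nbd; exact.
Qed.

Definition dirc_map (A B : complex Y) (u : cmap A B) : cmap (dirc A) (dirc B) :=
  pull_cmap (@preim_opensS X K) (@preim_opens_cover X K) (@preim_opens_meet X K) u.

Lemma dirc_qis (A B : complex Y) (u : cmap A B) : qis (dirc_map u) -> qis u.
Proof.
move=> /qisP uq; apply/qisP => n y.
by have := uq n (incl y); rewrite -(preim_nbd y); exact.
Qed.

(* [eps] identifies J with the subcomplex of I of sections supported in K. *)
Definition coreflection (I : complex X) (J : complex Y) (eps : cmap (dirc J) I) :=
  (forall n V, injective (eps n V)) /\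
  (forall n V t, supp_in K t -> exists s, eps n V s = t).

Section Coreflection.
Variables (I : complex X) (J : complex Y) (eps : cmap (dirc J) I).
Hypothesis epsK : coreflection eps.

(** For the inverse, a section over W is viewed over [image_nbd W], the smallest open of X with
    trace W. Its image under [g] is supported in K, hence comes from J. *)
Lemma coreflection_hom_bij (A : sheaf Y) n V :
  bijective (hom_pull (@preim_opens_cover X K) (@preim_opens_meet X K) A
    (eps n) V).
Proof.
have [einj eimg] := epsK.
apply: inj_surj_bij => [f g fg|g].
  apply: hom_eq => W' W'V s.
  have [W WV WE] := preim_surj W'V; subst W'.
  rewrite !(hom_at_irr _ W'V (preim_opensS WV)); apply: (einj n W).
  exact: (congr1 (fun u : hom (direct_image A) (I n) V => hom_at u WV s) fg).
have e1 (W : opens Y) : W `<=` pi (image_nbd W) by rewrite preim_image_nbd.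
have e2 (W : opens Y) : pi (image_nbd W) `<=` W by rewrite preim_image_nbd.
have sig (W : opens Y) (WV : W `<=` pi V) (s : A W) :
    {t : J n (pi (image_nbd W)) | eps n (image_nbd W) t =
      hom_at g (image_nbd_sub WV) (res A (@e2 W) s : direct_image A _)}.
  by apply: cid; apply: eimg; exact: dirc_supp.
have fB (W : opens Y) (WV : W `<=` pi V) :
    zmod_morphism (fun s : A W => res (J n) (@e1 W) (sval (sig W WV s))).
  move=> s t; rewrite -raddfB; congr (res _ _ _); apply: (einj n (image_nbd W)).
  rewrite [RHS]raddfB !(svalP (sig _ _ _)) -raddfB; congr (hom_at g _ _).
  exact: raddfB.
have fr (W T : opens Y) (WV : W `<=` pi V) (TV : T `<=` pi V) (TW : T `<=` W) s :
    mk_additive (fB T TV) (res A TW s) = res (J n) TW (mk_additive (fB W WV) s).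
  have TW' : image_nbd T `<=` image_nbd W := image_nbdS TW.
  have E : sval (sig T TV (res A TW s)) =
      res (J n) (preim_opensS TW') (sval (sig W WV s)).
    apply: (einj n (image_nbd T)); rewrite (svalP (sig _ _ _)).
    rewrite -[res (J n) _ _]/(res (dirc J n) TW' (sval (sig W WV s))) app_res.
    rewrite (svalP (sig _ _ _)) -(hom_at_res g (image_nbd_sub WV) (image_nbd_sub TV)).
    congr (hom_at g _ _).
    have l := subset_trans (@e2 T) TW.
    by rewrite (res_comp TW _ l) [RHS](res_comp (@e2 W) _ l).
  rewrite -[LHS]/(res (J n) (@e1 T) (sval (sig T TV (res A TW s)))) E.
  rewrite -[RHS]/(res (J n) TW (res (J n) (@e1 W) (sval (sig W WV s)))).
  have l := subset_trans TW (@e1 W).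
  by rewrite (res_comp (preim_opensS TW') _ l) (res_comp _ _ l).
exists (mk_hom fr); apply: hom_eq => W WV s.
pose W2 := image_nbd (pi W).
have W2W : W2 `<=` W by exact: image_nbd_sub.
rewrite -[LHS]/(eps n W (res (J n) (@e1 (pi W))
  (sval (sig (pi W) (preim_opensS WV) s)))).
(* Both sides are supported in K, so it is enough to compare them on the smallest open [W2]
   containing the trace of W. *)
apply: (supp_sep (W := W2) (h := W2W)).
- move=> x Wx Kx; apply: sub_minopen.
  by exists (exist _ x (mem_set Kx)).
- exact: dirc_mor_supp.
- exact: dirc_supp.
rewrite -app_res -[X in eps n W2 X]/(res (J n) (preim_opensS W2W) _).
rewrite (res_comp _ _ (@subset_refl _ _)) res_id (svalP (sig _ _ _)).
rewrite -(hom_at_res g WV (subset_trans W2W WV)).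
rewrite (hom_at_irr g _ (subset_trans W2W WV)); congr (hom_at g _ _).
exact: (res_irr (F := A)).
Qed.

(** A morphism is a global section of the Hom sheaf: the bijection of [coreflection_hom_bij] is
    taken over the whole space. *)
Lemma coreflection_mor (A : sheaf Y) n (v : mor (direct_image A) (I n)) :
  exists u : mor A (J n), forall V s, eps n V (u (pi V) s) = v V s.
Proof.
pose top := Opens (@openT X).
pose g : hom (direct_image A) (I n) top :=
  mk_hom (f := fun W (_ : W `<=` top) => v W)
    (fun W T _ _ TW s => app_res v TW s).
have [k _ kg] := coreflection_hom_bij A n top.
have le (W : opens Y) : W `<=` pi top by [].
have ur (V W : opens Y) (h : W `<=` V) s :
    hom_at (k g) (le W) (res A h s) = res (J n) h (hom_at (k g) (le V) s).
  exact: hom_at_res.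
exists (Mor (app := fun W : opens Y => hom_at (k g) (le W)) ur) => V s.
have Vt : V `<=` top by [].
have := congr1 (fun f : hom (direct_image A) (I n) top => hom_at f Vt s) (kg g).
by rewrite hom_pullE (hom_at_irr _ _ (le (pi V))).
Qed.

Lemma coreflection_cmap (A : complex Y) (v : cmap (dirc A) I) :
  exists u : cmap A J, forall n V s, eps n V (u n (pi V) s) = v n V s.
Proof.
have [einj _] := epsK.
have /(_ _)/cid u n := coreflection_mor (v n : mor (direct_image (A n)) (I n)).
have ud (p q : int) (e : q = p + 1) (W : opens Y) s :
    sval (u q) W (dif A e W s) = dif J e W (sval (u p) W s).
  have [V WE] := preim_surjT W; subst W.
  apply: (einj q V); rewrite (svalP (u q)).
  by rewrite [LHS](cm_dif v e) [RHS](cm_dif eps e) (svalP (u p)).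
by exists (Cmap ud) => n V s; exact: (svalP (u n)).
Qed.

Lemma coreflection_Kinjective : Kinjective I -> Kinjective J.
Proof.
have [einj _] := epsK.
move=> IK A u /acyclicP Aa.
have [|h hE] := IK _ (cmap_comp eps (dirc_map u)).
  apply/acyclicP => n x z; apply: fgq_true.
  by apply: dirc_coh_fg => y; apply: fgq_zero; exact: Aa.
have /(_ _ _ _)/cid k p q e :=
  coreflection_mor (h p q e : mor (direct_image (A p)) (I q)).
exists (fun p q e => sval (k p q e)) => q p r e e' W s.
have [V WE] := preim_surjT W; subst W.
apply: (einj p V); rewrite raddfD.
rewrite [X in _ = X + _](cm_dif eps e) !(svalP (k _ _ _)).
exact: (hE q p r e e' V s).
Qed.

Lemma coreflection_biduality (G : complex Y) :
  qis (bidual (dirc G) I) -> qis (bidual G J).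
Proof.
move=> bG; apply: dirc_qis.
apply/(bidual_pull (eta := cmap_id (dirc G)) (@coreflection_hom_bij)) => //.
by move=> n V; exists id.
Qed.
End Coreflection.

Section Compare.
Variables (I I' : complex X) (J J' : complex Y).
Variables (eps : cmap (dirc J) I) (eps' : cmap (dirc J') I').
Hypotheses (epsK : coreflection eps) (epsK' : coreflection eps').

Lemma coreflection_map (w : cmap I I') : exists u : cmap J J',
  forall n V s, eps' n V (u n (pi V) s) = w n V (eps n V s).
Proof. exact: (coreflection_cmap epsK' (cmap_comp w eps)). Qed.

(** The components of a homotopy are morphisms of sheaves, so they descend to J one by one, and the
    identity between them can be checked after the injective [eps]. *)
Lemma coreflection_homotopy (w : cmap I I') (w' : cmap I' I)
    (u : cmap J J') (u' : cmap J' J)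
    (h : forall p q : int, p = q + 1 -> mor (I p) (I q)) :
  (forall n V s, eps' n V (u n (pi V) s) = w n V (eps n V s)) ->
  (forall n V s, eps n V (u' n (pi V) s) = w' n V (eps' n V s)) ->
  (forall (t p r : int) (e : p = t + 1) (e' : r = p + 1) V s,
    s = w' p V (w p V s) + (dif I e V (h p t e V s) + h r p e' V (dif I e' V s))) ->
  exists k : forall p q : int, p = q + 1 -> mor (J p) (J q),
  forall (t p r : int) (e : p = t + 1) (e' : r = p + 1) (W : opens Y) s,
    s = u' p W (u p W s) + (dif J e W (k p t e W s) + k r p e' W (dif J e' W s)).
Proof.
have [einj _] := epsK.
move=> uE u'E hE.
have /(_ _ _ _)/cid k p q e := coreflection_mor epsK
  (mor_comp (h p q e) (eps p) : mor (direct_image (J p)) (I q)).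
exists (fun p q e => sval (k p q e)) => t p r e e' W s.
have [V WE] := preim_surjT W; subst W.
apply: (einj p V); rewrite !raddfD u'E uE.
rewrite [X in _ = _ + (X + _)](cm_dif eps e) !(svalP (k _ _ _)).
rewrite {1}(hE t p r e e' V (eps p V s)) /=.
by rewrite -(cm_dif eps e').
Qed.
End Compare.
End ClosedSubspace.

(** In cohomology [b] has the right inverse [a] and the left inverse [c], hence it is invertible and
    [a] is its inverse. *)
Lemma qis_of_homotopies (X : finspace) (J J' : complex X) (a : cmap J J')
    (b : cmap J' J) (c : cmap J J')
    (h : forall p q : int, p = q + 1 -> mor (J p) (J q))
    (h' : forall p q : int, p = q + 1 -> mor (J' p) (J' q)) :
  (forall (t p r : int) (e : p = t + 1) (e' : r = p + 1) V s,
    s = b p V (a p V s) + (dif J e V (h p t e V s) + h r p e' V (dif J e' V s))) ->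
  (forall (t p r : int) (e : p = t + 1) (e' : r = p + 1) V s,
    s = c p V (b p V s) + (dif J' e V (h' p t e V s) + h' r p e' V (dif J' e' V s))) ->
  qis a.
Proof.
move=> hE h'E; apply/qisP => n x.
have en : n = (n - 1) + 1 by rewrite subrK.
have ba s : cocycle s -> cobound (s - b n (nbd x) (a n _ s)).
  move=> sc; rewrite {1}(hE _ _ _ en erefl _ s) [dif J _ _ s]sc raddf0 addr0 addrC
    addKr.
  by apply/(coboundP en); exists (h n (n - 1) en _ s).
have cb s : cocycle s -> cobound (s - c n (nbd x) (b n _ s)).
  move=> sc; rewrite {1}(h'E _ _ _ en erefl _ s) [dif J' _ _ s]sc raddf0 addr0 addrC
    addKr.
  by apply/(coboundP en); exists (h' n (n - 1) en _ s).
have Bc := cobound_zclosed J n (nbd x).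
have Bc' := cobound_zclosed J' n (nbd x); split=> z zc.
  move=> az; rewrite -[z](subrK (b n _ (a n _ z))).
  by apply: zclosedD => //; [exact: ba|exact: cobound_cm].
have bz := cocycle_cm b zc; have abz := cocycle_cm a bz.
exists (b n _ z) => //.
have Ec : cocycle (z - a n _ (b n _ z)) by apply: (cocycle_zclosed _ _ _).2.
rewrite -[z - _](subrK (c n _ (b n _ (z - a n _ (b n _ z))))).
apply: zclosedD => //; first exact: cb.
by apply: cobound_cm; rewrite raddfB; exact: ba.
Qed.

Lemma hom_of_stalks (X : finspace) (A F : sheaf X) (V : opens X)
    (m : forall x, oset V x -> {additive A (nbd x) -> F (nbd x)}) :
  (forall x y (Vx : oset V x) (Vy : oset V y) (h : nbd y `<=` nbd x) s,
    m y Vy (res A h s) = res F h (m x Vx s)) ->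
  exists f : hom A F V, forall (W : opens X) (WV : W `<=` V) s x (Wx : oset W x),
    germ F Wx (hom_at f WV s) = m x (WV x Wx) (germ A Wx s).
Proof.
move=> mr.
have ex (W : opens X) (WV : W `<=` V) (s : A W) : {t : F W |
    forall x (Wx : oset W x), germ F Wx t = m x (WV x Wx) (germ A Wx s)}.
  apply/cid/nbd_glue => x y Wx Wy h; rewrite -(mr x y _ (WV y Wy)); congr (m y _ _).
  by rewrite /germ (res_comp _ _ (nbd_sub Wy)).
have uB (W : opens X) (WV : W `<=` V) : zmod_morphism (fun s => sval (ex W WV s)).
  move=> s t; apply: nbd_sep => x Wx; rewrite raddfB.
  by rewrite !(svalP (ex W WV _) x Wx) !raddfB.
have ur (W T : opens X) (WV : W `<=` V) (TV : T `<=` V) (TW : T `<=` W) s :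
    mk_additive (uB T TV) (res A TW s) = res F TW (mk_additive (uB W WV) s).
  apply: nbd_sep => x Tx; have Wx := TW x Tx.
  rewrite [LHS](svalP (ex T TV _) x Tx) /germ (res_comp _ _ (nbd_sub Wx)).
  rewrite (res_comp _ _ (nbd_sub Wx)) [RHS](svalP (ex W WV s) x Wx).
  by rewrite (Prop_irrelevance (TV x Tx) (WV x Wx)).
exists (mk_hom ur) => W WV s x Wx; exact: (svalP (ex W WV s) x Wx).
Qed.

(** * Hom from the constant sheaf of a closed subset *)

Section ClosedHom.
Variables (X : finspace) (K : set X) (Kc : closed K) (I : complex X).
Local Notation Y := (subspace_of K).
Local Notation pi := (preim_opens K).
Local Notation Z := (Z_ext K).
Local Notation H := (homc (conc Z) I).
Implicit Types V W T : opens X.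

Definition Z_one V : Z V := shf_unit (P := const_psh Y int) (V := pi V) 1.

Lemma Z_one_res V W (h : W `<=` V) : res Z h (Z_one V) = Z_one W.
Proof. exact: shf_eq. Qed.

Lemma Z_disj x (s t : Z (nbd x)) : ~ K x -> s = t.
Proof.
move=> xK; apply: (sheaf_empty (F := const_sheaf Y int)) => y.
by move=> /(nbd_disj Kc xK); apply; exact: set_valP.
Qed.

Definition Z_val V (s : Z V) x (Kx : K x) (Vx : oset V x) : int :=
  shf_at (P := const_psh Y int) (V := pi V) s
    (x := exist _ x (mem_set Kx)) Vx.

Lemma Z_nbd x (s : Z (nbd x)) (Kx : K x) :
  s = Z_one (nbd x) *~ Z_val s Kx (nbd_id x).
Proof.
set k := Z_val _ _ _; pose y : Y := exist _ x (mem_set Kx).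
apply: shf_eq => z xz.
have at_B : zmod_morphism (fun t : Z (nbd x) =>
  shf_at (P := const_psh Y int) (V := pi (nbd x)) t xz) by [].
rewrite [RHS](raddfMz (mk_additive at_B)).
rewrite -[X in _ = X *~ _]/(1 : int) -[RHS]/(1 *~ k : int) mulrzz mul1r.
have h : nbd z `<=` nbd y.
  have : oset (nbd y) z by rewrite -preim_nbd.
  exact: nbd_sub.
exact: (shf_at_res s (nbd_id x : oset (pi (nbd x)) y) xz h).
Qed.

Lemma conc_zero p V (s : conc Z p V) : p != 0 -> s = 0.
Proof.
move=> p0; move: s; rewrite /= /conc_ob (negbTE p0) => s.
apply: shf_eq => x Vx; apply: functional_extensionality_dep; by case.
Qed.

Definition bideg0 n : bideg n := @Bideg n 0 n (esym (add0r n)).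

Lemma hom_ev_B n V : zmod_morphism (fun f : H n V =>
  hom_at (f (bideg0 n)) (@subset_refl _ V) (Z_one V) : I n V).
Proof. by []. Qed.

(** Evaluation at the section 1 of Z_K in degree 0, which identifies Hom(Z_K, I) with the sections
    of I supported in K. *)
Definition hom_ev n V : {additive H n V -> I n V} := mk_additive (@hom_ev_B n V).

Lemma hom_evE n V (f : H n V) :
  hom_ev n V f = hom_at (f (bideg0 n)) (@subset_refl _ V) (Z_one V).
Proof. by []. Qed.

Lemma hom_at_one n V (f : H n V) W (WV : W `<=` V) :
  hom_at (f (bideg0 n)) WV (Z_one W) = res (I n) WV (hom_ev n V f).
Proof.
by rewrite hom_evE -(hom_at_res _ _ WV) [X in _ = hom_at _ _ X]Z_one_res.
Qed.

Lemma hom_ev_res n V W (h : W `<=` V) f :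
  hom_ev n W (res (H n) h f) = res (I n) h (hom_ev n V f).
Proof. by rewrite -hom_at_one hom_evE [LHS](hom_resE _ _ _ h). Qed.

Lemma hom_ev_dif n m (e : m = n + 1) V f :
  hom_ev m V (dif H e V f) = dif I e V (hom_ev n V f).
Proof.
rewrite hom_evE [LHS]hom_difE.
rewrite [X in _ - hom_at _ _ X *~ _](_ : _ = 0) // raddf0 mul0rz subr0.
exact: (hom_at_tgt f (erefl (0 + n)) (esym (add0r n)) _ e).
Qed.

(** Components with nonzero source degree start from a zero sheaf. In source degree 0 the stalk of
    Z_K is generated by 1 on K and is zero elsewhere. *)
Lemma hom_ev_inj n V : injective (hom_ev n V).
Proof.
move=> f g fg; apply/eqP; rewrite -subr_eq0; apply/eqP.
have {fg} : hom_ev n V (f - g) = 0 by rewrite raddfB fg subrr.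
move: (f - g) => {}f f0; apply: functional_extensionality_dep => -[p q e].
have [p0|p0] := eqVneq p 0; last first.
  by apply: hom_eq => W WV s; rewrite [s]conc_zero // raddf0.
subst p; have qn : n = q by rewrite e add0r.
move: e; case: _ / qn => e.
rewrite (eq_irrelevance e (esym (add0r n))) -/(bideg0 n).
apply: hom_eq => W WV s; rewrite [RHS]/(0 : I n W).
apply: nbd_sep => x Wx.
have l := subset_trans (nbd_sub Wx) WV.
rewrite raddf0 /germ -(hom_at_res _ WV l).
have [Kx|xK] := pselect (K x); last first.
  by rewrite [X in hom_at _ _ X](Z_disj (res Z (nbd_sub Wx) s) 0 xK) raddf0.
rewrite [X in hom_at _ _ X](Z_nbd (res Z (nbd_sub Wx) s) Kx) raddfMz.
by rewrite hom_at_one f0 raddf0 mul0rz.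
Qed.

(** On stalks the homomorphism sends an integer to that multiple of the germ of [t]. When a point of
    K has a point outside K in its neighbourhood, compatibility holds because [t] vanishes at the
    latter. *)
Lemma hom_ev_surj n V t : supp_in K t -> exists f, hom_ev n V f = t.
Proof.
move=> tK.
pose v x (s : Z (nbd x)) : int :=
  match pselect (K x) with left Kx => Z_val s Kx (nbd_id x) | right _ => 0 end.
have vB x s s' : v x (s - s') = v x s - v x s'.
  by rewrite /v; case: pselect => // _; rewrite subrr.
have mB x (Vx : oset V x) : zmod_morphism (fun s => germ (I n) Vx t *~ v x s).
  by move=> s s'; rewrite vB mulrzBr.
have [|phi phiE] := @hom_of_stalks _ Z (I n) V (fun x Vx => mk_additive (mB x Vx)).
  move=> x y Vx Vy h s.
  rewrite -[LHS]/(germ (I n) Vy t *~ v y (res Z h s)).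
  rewrite -[RHS]/(res (I n) h (germ (I n) Vx t *~ v x s)) raddfMz.
  rewrite [res (I n) h _](res_comp _ _ (nbd_sub Vy)) -/(germ _ _).
  have [Ky|yK] := pselect (K y); last by rewrite tK // !mul0rz.
  have Kx : K x.
    by apply: contrapT => xK; apply: (nbd_disj Kc xK _ Ky); apply: h; exact: nbd_id.
  congr (_ *~ _); rewrite /v; case: pselect => // Ky'; case: pselect => // Kx'.
  pose x' : Y := exist _ x (mem_set Kx'); pose y' : Y := exist _ y (mem_set Ky').
  have h' : nbd y' `<=` nbd x' by rewrite -!preim_nbd; exact: preim_opensS.
  exact: (shf_at_res s (x := x') (y := y') (nbd_id x)
    (preim_opensS h (nbd_id y : oset (pi (nbd y)) y')) h').


(* The bidegree with source 0 is unique; every other component starts from a zero sheaf. *)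
pose f : H n V := fun b => match pselect (bideg0 n = b) with
  | left E => match E in _ = b return hom (conc Z (bsrc b)) (I (btgt b)) V with
      erefl => phi end
  | right _ => 0
  end.
have f0 : f (bideg0 n) = phi.
  by rewrite /f; case: pselect => // E; rewrite (Prop_irrelevance E erefl).
exists f; rewrite hom_evE f0.
apply: nbd_sep => x Vx; rewrite [LHS]phiE.
rewrite -[LHS]/(germ (I n) (@subset_refl _ V x Vx) t *~ v x (germ Z Vx (Z_one V))).
have [Kx|xK] := pselect (K x); last by rewrite !tK // mul0rz.
rewrite /v; case: pselect => // Kx'; rewrite [Z_val _ _ _]/(1 : int) mulr1z.
exact: res_irr.
Qed.

Local Notation J := (inv_image K H).

Lemma nbd_image_nbd x (Kx : K x) :
  nbd x `<=` image_nbd (nbd (exist _ x (mem_set Kx) : Y)).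
Proof.
apply: nbd_sub; apply: sub_minopen.
exists (exist _ x (mem_set Kx)) => //; exact: nbd_id.
Qed.

Arguments nbd_image_nbd {x} Kx.

Lemma image_nbd_nbd (y : Y) : image_nbd (nbd y) `<=` nbd (incl y).
Proof. by apply: image_nbd_sub; rewrite preim_nbd. Qed.

Lemma inv_ev_stalkB n x : zmod_morphism (fun s : direct_image (J n) (nbd x) =>
  match pselect (K x) return I n (nbd x) with
  | left Kx => res (I n) (nbd_image_nbd Kx)
      (hom_ev n _ (shf_at (x := exist _ x (mem_set Kx) : Y) s (nbd_id x)))
  | right _ => 0
  end).
Proof.
case: pselect => Kx s t; last by rewrite subrr.
by rewrite -(raddfB (res (I n) _)) -(raddfB (hom_ev n _)).
Qed.

Definition inv_ev_stalk n x : {additive direct_image (J n) (nbd x) -> I n (nbd x)} :=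
  mk_additive (@inv_ev_stalkB n x).

Lemma inv_ev_stalkE n x (Kx : K x) s : inv_ev_stalk n x s =
  res (I n) (nbd_image_nbd Kx)
      (hom_ev n _ (shf_at (x := exist _ x (mem_set Kx) : Y) s (nbd_id x))).
Proof.
rewrite /=; case: pselect => // Kx'.
by rewrite (Prop_irrelevance Kx' Kx).
Qed.

Lemma inv_ev_stalk0 n x s : ~ K x -> inv_ev_stalk n x s = 0.
Proof. by move=> xK; rewrite /=; case: pselect. Qed.

Lemma inv_ev_stalk_res n x y (h : nbd y `<=` nbd x) s :
  inv_ev_stalk n y (res (direct_image (J n)) h s) = res (I n) h (inv_ev_stalk n x s).
Proof.
have [Kx|xK] := pselect (K x); last first.
  rewrite !inv_ev_stalk0 // ?raddf0 //.
  by apply: (nbd_disj Kc xK); apply: h; exact: nbd_id.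
have [Ky|yK] := pselect (K y); last first.
  (* Near a point outside K the section 1 of Z_K is 0, so the value at 1 restricts to 0. *)
  rewrite inv_ev_stalk0 // inv_ev_stalkE.
  rewrite (res_comp _ _ (subset_trans h (nbd_image_nbd Kx))).
  rewrite -hom_at_one [X in hom_at _ _ X](Z_disj (Z_one (nbd y)) 0 yK).
  by rewrite raddf0.
rewrite !inv_ev_stalkE.
pose x' : Y := exist _ x (mem_set Kx); pose y' : Y := exist _ y (mem_set Ky).
have h' : nbd y' `<=` nbd x' by rewrite -!preim_nbd; exact: preim_opensS.
have := shf_at_res s (x := x') (y := y') (nbd_id x)
  (preim_opensS h (nbd_id y : oset (pi (nbd y)) y')) h'.
move=> E; rewrite [RHS](res_comp _ _ (subset_trans h (nbd_image_nbd Kx))).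
rewrite -[X in res _ _ (hom_ev _ _ X) = _]/(
  shf_at s (preim_opensS h (nbd_id y : oset (pi (nbd y)) y'))) E.
rewrite -[X in res _ _ (hom_ev _ _ X) = _]/(
  res (H n) (image_nbdS h') (shf_at s (nbd_id x : oset (pi (nbd x)) x'))).
by rewrite hom_ev_res (res_comp _ _ (subset_trans h (nbd_image_nbd Kx))).
Qed.

(** On stalks over K, a germ of the inverse image is a homomorphism from Z_K near the point, and
    [eps] evaluates it at 1. Injectivity and the image come from [hom_ev_inj] and [hom_ev_surj]. *)
Lemma inv_ev : exists eps : cmap (dirc J) I, coreflection eps.
Proof.
have /(_ _)/cid v n := mor_of_stalks (@inv_ev_stalk_res n).
have vd p q (e : q = p + 1) V s :
    sval (v q) V (dif (dirc J) e V s) = dif I e V (sval (v p) V s).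
  rewrite -[RHS]/(mor_comp (dif I e) (sval (v p)) V s).
  rewrite -[LHS]/(mor_comp (sval (v q)) (dif (dirc J) e) V s).
  move: V s; apply: mor_ext_stalks => x s.
  rewrite [LHS](svalP (v q)) -[RHS]/(dif I e _ (sval (v p) _ s)) (svalP (v p)).
  have [Kx|xK] := pselect (K x); last by rewrite !inv_ev_stalk0 // raddf0.
  rewrite !inv_ev_stalkE [RHS]app_res -hom_ev_dif.
  by congr (res _ _ (hom_ev _ _ _)).
have vE n V s x (Vx : oset V x) : germ (I n) Vx (sval (v n) V s) =
    inv_ev_stalk n x (germ (direct_image (J n)) Vx s).
  by rewrite /germ -[LHS]app_res [LHS](svalP (v n)).
exists (Cmap vd); split=> n V.
  move=> s t st; apply: shf_eq => y Vy.
  have Ky : K (incl y) := set_valP y.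
  have yE : y = exist _ (incl y) (mem_set Ky) by exact: val_inj.
  have := congr1 (germ (I n) (Vy : oset V (incl y))) st.
  rewrite /= !vE !(inv_ev_stalkE Ky).
  have h : image_nbd (nbd (exist _ (incl y) (mem_set Ky) : Y)) `<=` nbd (incl y).
    exact: (image_nbd_nbd (y := exist _ (incl y) (mem_set Ky))).
  move/(congr1 (res (I n) h)).
  rewrite !(res_comp _ _ (@subset_refl _ _)) !res_id => /hom_ev_inj.
  (* A point of the subspace equals the pair of its image and the membership proof only by [yE]. *)
  have eqT (z : Y) (zy : z = y) (Vz : oset (pi V) z) :
    shf_at s Vz = shf_at t Vz -> shf_at s Vy = shf_at t Vy.
    by subst z; rewrite (Prop_irrelevance Vz Vy).
  exact: (eqT _ (esym yE) (preim_opensS (nbd_sub (Vy : oset V (incl y)))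
    (nbd_id (incl y) : oset (pi (nbd (incl y))) (exist _ (incl y) (mem_set Ky))))).
move=> t tK; have [f fE] := hom_ev_surj tK.
have l : image_nbd (pi V) `<=` V by exact: image_nbd_sub.
exists (shf_unit (P := pull_psh (@image_nbdS X K) (H n)) (V := pi V) (res (H n) l f)).
apply: nbd_sep => x Vx; rewrite [LHS]vE.
have [Kx|xK] := pselect (K x); last by rewrite inv_ev_stalk0 // tK.
rewrite inv_ev_stalkE.
set y : Y := exist _ x (mem_set Kx).
have yV : nbd y `<=` pi V by rewrite -preim_nbd; apply: preim_opensS; exact: nbd_sub.
pose Vy : oset (pi V) y := preim_opensS (nbd_sub Vx) (nbd_id x : oset (pi (nbd x)) y).
rewrite -[shf_at _ _]/(res (H n) (image_nbdS (nbd_sub Vy)) (res (H n) l f)).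
rewrite (res_comp _ _ (subset_trans (image_nbdS yV) l)) hom_ev_res fE.
by rewrite (res_comp _ _ (nbd_sub Vx)).
Qed.
End ClosedHom.

(** * Acyclic complexes of constant sheaves *)

Section IntOn.
Variables (X : finspace) (S : set X).
Implicit Types V W T : opens X.

Definition int_fun : zmodType := pi_zmod (fun _ : X => (int : zmodType)).

(* For S locally closed, the sections over V of the constant sheaf Z on S extended
   by zero, as integer functions on X vanishing outside of S and V. *)
Definition int_on V (f : int_fun) :=
  (forall x, ~ (S x /\ oset V x) -> f x = 0) /\
  (forall x y, oset V x -> oset (nbd x) y -> S y -> f y = f x).

Lemma int_on_closed V : zclosed (int_on V).
Proof.
split=> [//|f g [f0 fc] [g0 gc]]; split=> [x xn|x y Vx xy Sy].
  by rewrite -[LHS]/(f x - g x) f0 // g0 // subrr.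
by rewrite -[LHS]/(f y - g y) -[RHS]/(f x - g x) (fc x y) // (gc x y).
Qed.

Definition int_on_sg V : subgroup int_fun := Subgroup (int_on_closed V).

(** Serves both as restriction to a smaller open set and as the canonical map between two constant
    sheaves extended by zero. *)
Definition cut (A : set X) (f : int_fun) : int_fun :=
  fun x => if `[< A x >] then f x else 0.

Lemma cutT (A : set X) f x : A x -> cut A f x = f x.
Proof. by rewrite /cut => /asboolT ->. Qed.

Lemma cutF (A : set X) f x : ~ A x -> cut A f x = 0.
Proof. by rewrite /cut => /asboolF ->. Qed.

Lemma cutB (A : set X) f g : cut A (f - g) = cut A f - cut A g.
Proof.
apply: functional_extensionality_dep => x.
rewrite -[RHS]/(cut A f x - cut A g x) /cut.
by case: ifP => // _; rewrite subrr.
Qed.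

Lemma cut_int_on V W (h : W `<=` V) f : int_on V f -> int_on W (cut W f).
Proof.
move=> [f0 fc]; split=> [x xn|x y Wx xy Sy].
  have [Wx|Wx] := pselect (oset W x); last by rewrite cutF.
  by rewrite cutT // f0 // => -[Sx _]; apply: xn.
rewrite !cutT //; first exact: fc (h x Wx) xy Sy.
exact: (nbd_sub Wx).
Qed.

Section Res.
Variables (V W : opens X) (h : W `<=` V).

Definition int_res_fun (s : sub_zmod (int_on_sg V)) : sub_zmod (int_on_sg W) :=
  sub_mk (S := int_on_sg W) (cut_int_on h (sub_valP s)).

Lemma int_resB : zmod_morphism int_res_fun.
Proof. by move=> s t; apply: sub_val_inj; exact: cutB. Qed.

Definition int_res : {additive sub_zmod (int_on_sg V) -> sub_zmod (int_on_sg W)} :=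
  mk_additive int_resB.

Lemma int_resE s : sub_val (int_res s) = cut W (sub_val s).
Proof. by []. Qed.
End Res.

Lemma int_res_id V (h : V `<=` V) s : int_res h s = s.
Proof.
apply: sub_val_inj; apply: functional_extensionality_dep => x.
rewrite int_resE; have [Vx|Vx] := pselect (oset V x); first by rewrite cutT.
by rewrite cutF // (sub_valP s).1 // => -[].
Qed.

Lemma int_res_comp V W T (h : W `<=` V) (k : T `<=` W) (l : T `<=` V) s :
  int_res k (int_res h s) = int_res l s.
Proof.
apply: sub_val_inj; apply: functional_extensionality_dep => x.
rewrite !int_resE; have [Tx|Tx] := pselect (oset T x); last by rewrite !cutF.
by rewrite !cutT //; exact: k.
Qed.

Definition int_psh : presheaf X := Presheaf int_res_id int_res_comp.

Lemma int_is_sheaf : is_sheaf int_psh.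
Proof.
move=> J V W WV cov; split=> [s t e|s e].
  apply: sub_val_inj; apply: functional_extensionality_dep => x.
  have [Vx|Vx] := pselect (oset V x); last first.
    by rewrite (sub_valP s).1 ?(sub_valP t).1 // => -[].
  have [i _ Wx] := cov x Vx.
  have : cut (W i) (sub_val s) x = cut (W i) (sub_val t) x.
    exact: (congr1 (fun u : int_psh (W i) => sub_val u x) (e i)).
  by rewrite !cutT.
have ch x : oset V x -> {i | oset (W i) x}.
  by move=> Vx; apply: cid; have [i] := cov x Vx; exists i.
have se i j x : oset (W i) x -> oset (W j) x -> sub_val (s i) x = sub_val (s j) x.
  move=> ix jx.
  have : cut (nbd x) (sub_val (s i)) x = cut (nbd x) (sub_val (s j)) x.
    exact: (congr1 (fun u : int_psh (nbd x) => sub_val u x)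
      (e i j (nbd x) (nbd_sub ix) (nbd_sub jx))).
  by rewrite !cutT //; exact: nbd_id.
pose f : int_fun := fun x => match pselect (oset V x) with
  | left Vx => sub_val (s (sval (ch x Vx))) x | right _ => 0 end.
have fE i x : oset (W i) x -> f x = sub_val (s i) x.
  move=> ix; rewrite /f; case: pselect => [Vx|[]]; last exact: WV ix.
  by apply: se => //; exact: svalP (ch x Vx).
have fV : int_on_sg V f.
  split=> [x xn|x y Vx xy Sy].
    have [Vx|Vx] := pselect (oset V x); last by rewrite /f; case: pselect.
    have [i _ ix] := cov x Vx; rewrite (fE i) // (sub_valP (s i)).1 // => -[Sx _].
    exact: xn.
  have [i _ ix] := cov x Vx; rewrite !(fE i) //; last exact: (nbd_sub ix).
  exact: (sub_valP (s i)).2.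
exists (sub_mk fV) => i; apply: sub_val_inj; rewrite int_resE.
apply: functional_extensionality_dep => x.
have [ix|ix] := pselect (oset (W i) x); first by rewrite cutT // -fE.
by rewrite cutF // (sub_valP (s i)).1 // => -[].
Qed.

Definition int_sheaf : sheaf X := Sheaf int_is_sheaf.
End IntOn.

Section IntMor.
Variables (X : finspace) (S S' : set X).
Hypothesis SS' : forall x y, oset (nbd x) y -> S x -> S' y ->
  (S y -> S' x) /\ (S' x -> S y).
Implicit Types V W : opens X.

(** For [y] in [nbd x] with [x] in S and [y] in S', the hypothesis [SS'] leaves two cases: [x] is in
    S' and [y] in S, and the value is kept, or neither holds and both values are 0. *)
Lemma cut_mor V f : int_on S V f -> int_on S' V (cut S' f).
Proof.
move=> [f0 fc]; split=> [x xn|x y Vx xy S'y].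
  have [Sx|Sx] := pselect (S' x); last by rewrite cutF.
  by rewrite cutT // f0 // => -[_ Vx]; apply: xn.
rewrite cutT //; have [Sx|Sx] := pselect (S x); last first.
  have fx : f x = 0 by apply: f0 => -[].
  have -> : cut S' f x = 0.
    by have [S'x|S'x] := pselect (S' x); [rewrite cutT|rewrite cutF].
  have [Sy|Sy] := pselect (S y); first by rewrite (fc x y).
  by apply: f0 => -[].
have [to from] := SS' xy Sx S'y.
have [Sy|Sy] := pselect (S y).
  by rewrite cutT; [exact: fc|exact: to].
by rewrite f0 ?cutF // => [/from|[]].
Qed.

Definition int_mor_fun V (s : int_sheaf S V) : int_sheaf S' V :=
  sub_mk (S := int_on_sg S' V) (cut_mor (sub_valP s)).

Lemma int_morB V : zmod_morphism (@int_mor_fun V).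
Proof. by move=> s t; apply: sub_val_inj; exact: cutB. Qed.

Lemma int_mor_res V W (h : W `<=` V) s :
  mk_additive (@int_morB W) (res (int_sheaf S) h s) =
  res (int_sheaf S') h (mk_additive (@int_morB V) s).
Proof.
apply: sub_val_inj; apply: functional_extensionality_dep => x.
rewrite -[LHS]/(cut S' (cut W (sub_val s)) x) -[RHS]/(cut W (cut S' (sub_val s)) x).
by rewrite /cut; case: ifP; case: ifP.
Qed.

Definition int_mor : mor (int_sheaf S) (int_sheaf S') := Mor int_mor_res.

Lemma int_morE V s : sub_val (int_mor V s) = cut S' (sub_val s).
Proof. by []. Qed.
End IntMor.

Section IntComplex.
Variables (X : finspace) (S : int -> set X).
Hypothesis S_mor : forall p q, q = p + 1 -> forall x y, oset (nbd x) y ->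
  S p x -> S q y -> (S p y -> S q x) /\ (S q x -> S p y).
Hypothesis S_dif : forall p q r, q = p + 1 -> r = q + 1 -> forall x,
  S p x -> S q x -> S r x -> False.
Implicit Types V W : opens X.

Lemma int_dif_dif p q r (e : q = p + 1) (e' : r = q + 1) V s :
  int_mor (S_mor e') V (int_mor (S_mor e) V s) = 0.
Proof.
apply: sub_val_inj; apply: functional_extensionality_dep => x.
rewrite !int_morE [RHS]/(0 : int).
have [rx|rx] := pselect (S r x); last by rewrite cutF.
rewrite cutT //; have [qx|qx] := pselect (S q x); last by rewrite cutF.
rewrite cutT // (sub_valP s).1 // => -[px _]; exact: (S_dif e e' px qx rx).
Qed.

Definition intc : complex X :=
  @Complex X (fun p => int_sheaf (S p)) (fun p q e => int_mor (S_mor e))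
    (@int_dif_dif).

Definition int_val p V (s : intc p V) : X -> int := sub_val s.

Lemma int_val_eq p V (s t : intc p V) : int_val s =1 int_val t -> s = t.
Proof.
by move=> e; apply: sub_val_inj; apply: functional_extensionality_dep.
Qed.

Lemma int_val_dif p q (e : q = p + 1) V s x :
  int_val (dif intc e V s) x = cut (S q) (int_val s) x.
Proof. by []. Qed.

Lemma int_val_res p V W (h : W `<=` V) s x :
  int_val (res (intc p) h s) x = cut W (int_val s) x.
Proof. by []. Qed.

Lemma int_val0 p V (s : intc p V) x : ~ (S p x /\ oset V x) -> int_val s x = 0.
Proof. exact: (sub_valP s).1. Qed.

Lemma int_valc p V (s : intc p V) x y :
  oset V x -> oset (nbd x) y -> S p y -> int_val s y = int_val s x.
Proof. exact: (sub_valP s).2. Qed.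

Lemma int_ind_on p V (A : set X) : A `<=` S p -> A `<=` V ->
  (forall x y, oset V x -> oset (nbd x) y -> S p y -> (A y <-> A x)) ->
  int_on (S p) V (cut A (fun=> 1)).
Proof.
move=> AS AV Ac; split=> [x xn|x y Vx xy Sy].
  by rewrite cutF // => Ax; apply: xn; split; [exact: AS|exact: AV].
have AE := Ac x y Vx xy Sy.
have [Ax|Ax] := pselect (A x); first by rewrite !cutT //; apply/AE.
by rewrite !cutF // => /AE.
Qed.

(** Over [nbd x] a section is determined by its value at [x]. If [x] lies in the next set, a cocycle
    has value 0. Otherwise [x] lies in the previous set, and the constant function with that value
    there is a primitive. *)
Lemma intc_acyclic :
  (forall p x y z, oset (nbd x) y -> oset (nbd y) z -> S p x -> S p z -> S p y) ->
  (forall p q r x, q = p + 1 -> r = q + 1 -> S q x -> S r x \/ S p x) ->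
  acyclic intc.
Proof.
move=> S_convex S_exact; apply/acyclicP => n x z zc.
have zx y : oset (nbd x) y -> S n y -> int_val z y = int_val z x.
  by apply: int_valc; exact: nbd_id.
have z_0 : int_val z x = 0 -> z = 0.
  move=> z0; apply: int_val_eq => y; rewrite [RHS]/(0 : int).
  have [Sy|Sy] := pselect (S n y); last by rewrite int_val0 // => -[].
  have [xy|xy] := pselect (oset (nbd x) y); first by rewrite zx.
  by rewrite int_val0 // => -[].
have zb : int_val z x = 0 -> cobound z.
  by move=> /z_0 ->; exact: (cobound_zclosed _ _ _).1.
have [Sx|Sx] := pselect (S n x); last by apply: zb; rewrite int_val0 // => -[].
have e : n = (n - 1) + 1 by rewrite subrK.
have [Sx'|Sx'] := S_exact _ _ _ _ e (erefl (n + 1)) Sx.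
  apply: zb; have := congr1 (fun u : intc (n + 1) (nbd x) => int_val u x) zc.
  by rewrite int_val_dif cutT.
pose A : set X := S (n - 1) `&` nbd x.
have Aon : int_on_sg (S (n - 1)) (nbd x) (cut A (fun=> int_val z x)).
  split=> [y yn|y t xy yt St]; first by rewrite cutF.
  have xt : oset (nbd x) t by exact: (nbd_sub xy).
  have Sy := S_convex _ _ _ _ xy yt Sx' St.
  by rewrite !cutT.
apply/(coboundP e); exists (sub_mk Aon); apply: int_val_eq => y.
rewrite int_val_dif -[int_val (sub_mk Aon)]/(cut A (fun=> int_val z x)).
have [Sy|Sy] := pselect (S n y); last by rewrite cutF // int_val0 // => -[].
rewrite cutT //; have [xy|xy] := pselect (oset (nbd x) y); last first.
  by rewrite cutF ?int_val0 // => -[].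
rewrite cutT ?zx //; split=> //; exact: (S_mor e xy Sx' Sy).2.
Qed.

Section Map.
Variables (I : complex X) (g : forall p x, stalk (I p) x).
Hypothesis g_supp : forall p x, ~ S p x -> g p x = 0.
Hypothesis g_res : forall p x y (h : nbd y `<=` nbd x),
  S p x -> res (I p) h (g p x) = g p y.
Hypothesis g_dif : forall p q (e : q = p + 1) x,
  S p x -> dif I e (nbd x) (g p x) = g q x.

(** The germ [g p x] is the image of 1 at [x]; the hypotheses say that these images respect
    supports, restrictions and differentials. *)
Lemma intc_map : exists u : cmap intc I,
  forall p V s x (Vx : oset V x), germ (I p) Vx (u p V s) = g p x *~ int_val s x.
Proof.
have mB p x : zmod_morphism (fun s : intc p (nbd x) => g p x *~ int_val s x).
  by move=> s t; rewrite -mulrzBr.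
have mr p x y (h : nbd y `<=` nbd x) s :
    mk_additive (mB p y) (res (intc p) h s) = res (I p) h (mk_additive (mB p x) s).
  rewrite -[LHS]/(g p y *~ int_val (res (intc p) h s) y).
  rewrite -[RHS]/(res (I p) h (g p x *~ int_val s x)).
  rewrite int_val_res cutT; last exact: nbd_id.
  have xy : oset (nbd x) y by apply: h; exact: nbd_id.
  rewrite raddfMz; have [Sx|Sx] := pselect (S p x).
    rewrite g_res //; have [Sy|Sy] := pselect (S p y).
      by rewrite (int_valc s (nbd_id x) xy Sy).
    by rewrite g_supp // !mul0rz.
  rewrite (g_supp Sx) raddf0 mul0rz; have [Sy|Sy] := pselect (S p y).
    by rewrite (int_valc s (nbd_id x) xy Sy) int_val0 // => -[].
  by rewrite g_supp // mul0rz.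
have /(_ _)/cid v p := mor_of_stalks (mr p).
have vE p V s x (Vx : oset V x) :
    germ (I p) Vx (sval (v p) V s) = g p x *~ int_val s x.
  rewrite /germ -app_res (svalP (v p)).
  rewrite -[LHS]/(g p x *~ int_val (res (intc p) (nbd_sub Vx) s) x).
  rewrite int_val_res cutT //.
  exact: nbd_id.
have vd p q (e : q = p + 1) V s :
    sval (v q) V (dif intc e V s) = dif I e V (sval (v p) V s).
  apply: nbd_sep => x Vx; rewrite vE /germ -app_res -/(germ (I p) Vx _) vE.
  rewrite raddfMz int_val_dif; have [Sx|Sx] := pselect (S p x); last first.
    have sx : int_val s x = 0 by rewrite int_val0 // => -[].
    rewrite (g_supp Sx) raddf0 mul0rz /cut sx; by case: ifP.
  rewrite g_dif //; have [Sq|Sq] := pselect (S q x); first by rewrite cutT.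
  by rewrite (g_supp Sq) !mul0rz.
by exists (Cmap vd).
Qed.
End Map.
End IntComplex.

(** * The localization sequence of a K-injective complex *)

Section Localization.
Variables (X : finspace) (I : complex X).
Implicit Types V W : opens X.

Section CastGerm.
Variables (q : int) (V : opens X) (a : I q V).

(** Extension by zero to all degrees and points, so that sections living in three degrees combine
    into one family. *)
Definition cast_germ p x : stalk (I p) x :=
  match pselect (q = p), pselect (oset V x) with
  | left E, left Vx => castm I E (nbd x) (germ (I q) Vx a)
  | _, _ => 0
  end.

Lemma cast_germE x (Vx : oset V x) : cast_germ q x = germ (I q) Vx a.
Proof.
rewrite /cast_germ; case: pselect => // E; case: pselect => // Vx'.
by rewrite castm_id (Prop_irrelevance Vx' Vx).
Qed.

Lemma cast_germ_deg p x : q <> p -> cast_germ p x = 0.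
Proof. by rewrite /cast_germ; case: pselect. Qed.

Lemma cast_germ_out p x : ~ oset V x -> cast_germ p x = 0.
Proof. by rewrite /cast_germ; case: pselect => // E; case: pselect. Qed.
End CastGerm.

Variables (k k1 k2 : int) (e1 : k1 = k + 1) (e2 : k2 = k1 + 1).
Variables (V V1 : opens X) (V1V : V1 `<=` V).

Definition loc_set (p : int) : set X :=
  [set x | (p = k /\ oset V1 x) \/ (p = k1 /\ oset V x) \/
           (p = k2 /\ oset V x /\ ~ oset V1 x)].

Lemma loc_set0 x : loc_set k x <-> oset V1 x.
Proof.
split=> [[[_]|[[e _]|[e _]]] //|]; last by left.
  by move: e; rewrite e1; lia.
by move: e; rewrite e2 e1; lia.
Qed.

Lemma loc_set1 x : loc_set k1 x <-> oset V x.
Proof.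
split=> [[[e _]|[[_]|[e _]]] //|]; last by right; left.
  by move: e; rewrite e1; lia.
by move: e; rewrite e2; lia.
Qed.

Lemma loc_set2 x : loc_set k2 x <-> oset V x /\ ~ oset V1 x.
Proof.
split=> [[[e _]|[[e _]|[_]]] //|]; last by right; right.
  by move: e; rewrite e2 e1; lia.
by move: e; rewrite e2; lia.
Qed.

Lemma loc_set_out p x : p <> k -> p <> k1 -> p <> k2 -> ~ loc_set p x.
Proof. by move=> p0 p1 p2 [[]|[[]|[]]]. Qed.

Lemma loc_cases p : [\/ p = k, p = k1, p = k2 | [/\ p <> k, p <> k1 & p <> k2]].
Proof.
have [->|p0] := pselect (p = k); first by constructor 1.
have [->|p1] := pselect (p = k1); first by constructor 2.
have [->|p2] := pselect (p = k2); first by constructor 3.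
by constructor 4.
Qed.

Lemma loc_mor p q : q = p + 1 -> forall x y, oset (nbd x) y ->
  loc_set p x -> loc_set q y ->
  (loc_set p y -> loc_set q x) /\ (loc_set q x -> loc_set p y).
Proof.
move=> e x y xy px qy.
have V_y W : oset W x -> oset W y by move=> Wx; exact: (nbd_sub Wx).
have [pE|pE|pE|[p0 p1 p2]] := loc_cases p; last by case: (loc_set_out p0 p1 p2 px).
- have qE : q = k1 by rewrite e pE e1.
  move: px qy; rewrite pE qE !loc_set0 !loc_set1 => V1x Vy; split=> // _.
    exact: V1V.
  exact: V_y.
- have qE : q = k2 by rewrite e pE e2.
  move: px qy; rewrite pE qE !loc_set1 !loc_set2 => Vx [Vy V1y]; split=> // _.
  by split=> // /V_y.
- have qE : q = k2 + 1 by rewrite e pE.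
  have : ~ loc_set q y by apply: loc_set_out; rewrite qE e2 e1; lia.
  by [].
Qed.

Lemma loc_dif p q r : q = p + 1 -> r = q + 1 -> forall x,
  loc_set p x -> loc_set q x -> loc_set r x -> False.
Proof.
move=> e e' x px qx rx.
have [pE|pE|pE|[p0 p1 p2]] := loc_cases p; last by case: (loc_set_out p0 p1 p2 px).
- have rE : r = k2 by rewrite e' e pE e2 e1.
  by move: px rx; rewrite pE rE loc_set0 loc_set2 => ? [].
- have : ~ loc_set r x by apply: loc_set_out; rewrite e' e pE e1 ?e2 ?e1; lia.
  by [].
- have : ~ loc_set r x by apply: loc_set_out; rewrite e' e pE e2 e1; lia.
  by [].
Qed.

Local Notation L := (intc loc_mor loc_dif).

Lemma loc_acyclic : acyclic L.
Proof.
apply: intc_acyclic => [p x y z xy yz px pz|p q r x e e' qx].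
  have V_y W : oset W x -> oset W y by move=> Wx; exact: (nbd_sub Wx).
  have V_z W : oset W y -> oset W z by move=> Wy; exact: (nbd_sub Wy).
  have [pE|pE|pE|[p0 p1 p2]] := loc_cases p; last by case: (loc_set_out p0 p1 p2 px).
  - by move: px; rewrite pE !loc_set0; exact: V_y.
  - by move: px; rewrite pE !loc_set1; exact: V_y.
  - move: px pz; rewrite pE !loc_set2 => -[Vx _] [Vz V1z]; split; first exact: V_y.
    by move=> /V_z.
have [qE|qE|qE|[p0 p1 p2]] := loc_cases q; last by case: (loc_set_out p0 p1 p2 qx).
- left; have -> : r = k1 by rewrite e' qE e1.
  by move: qx; rewrite qE loc_set0 loc_set1; exact: V1V.
- move: qx; rewrite qE loc_set1 => Vx.
  have [V1x|V1x] := pselect (oset V1 x); last first.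
    by left; have -> : r = k2 by [rewrite e' qE e2]; apply/loc_set2.
  right; have -> : p = k by apply: (addIr 1); rewrite -e qE e1.
  exact/loc_set0.
- right; have -> : p = k1 by apply: (addIr 1); rewrite -e qE e2.
  by move: qx; rewrite qE loc_set1 loc_set2 => -[].
Qed.

(* A K-injective complex sees the acyclic complex Z_V1 -> Z_V -> Z_(V \ V1),
   placed in degrees k, k1, k2, as contractible: the data (c, b, a) is a chain map
   from it to I, and a', b' are components of a null homotopy. *)
Lemma Kinj_localization (a : I k2 V) (b : I k1 V) (c : I k V1) :
  Kinjective I -> res (I k2) V1V a = 0 -> a = dif I e2 V b ->
  dif I e1 V1 c = res (I k1) V1V b ->
  exists (a' : I k1 V) (b' : I k V),
    [/\ res (I k1) V1V a' = 0, a = dif I e2 V a' & b = dif I e1 V b' + a'].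
Proof.
move=> IK a0 ab cb.
(* In each degree at most one of the three terms is nonzero. *)
pose g p x := cast_germ c p x + cast_germ b p x + cast_germ a p x.
have n01 : k <> k1 by rewrite e1; lia.
have n02 : k <> k2 by rewrite e2 e1; lia.
have n12 : k1 <> k2 by rewrite e2; lia.
have g0 x : g k x = cast_germ c k x.
  by rewrite /g (cast_germ_deg b) ?(cast_germ_deg a) ?addr0 //; exact: nesym.
have g1 x : g k1 x = cast_germ b k1 x.
  by rewrite /g (cast_germ_deg c) ?(cast_germ_deg a) ?addr0 ?add0r //; exact: nesym.
have g2 x : g k2 x = cast_germ a k2 x.
  by rewrite /g (cast_germ_deg c) ?(cast_germ_deg b) ?addr0 ?add0r.
have a1 x (V1x : oset V1 x) (Vx : oset V x) : germ (I k2) Vx a = 0.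
  by rewrite /germ -(res_comp V1V (nbd_sub V1x)) a0 raddf0.
have [||p q e x|u uE] := @intc_map _ _ loc_mor loc_dif I g.
- move=> p x px.
  have [pE|pE|pE|[p0 p1 p2]] := loc_cases p.
  + by move: px; rewrite pE loc_set0 g0; exact: cast_germ_out.
  + by move: px; rewrite pE loc_set1 g1; exact: cast_germ_out.
  + move: px; rewrite pE loc_set2 g2 => px.
    have [Vx|Vx] := pselect (oset V x); last exact: cast_germ_out.
    rewrite (cast_germE _ Vx); apply: a1; apply: contrapT => V1x; exact: px.
  + by rewrite /g !cast_germ_deg ?addr0 //; exact: nesym.
- move=> p x y h px.
  have V_y W : oset W x -> oset W y.
    by move=> Wx; apply: (nbd_sub Wx); apply: h; exact: nbd_id.
  have [pE|pE|pE|[p0 p1 p2]] := loc_cases p; last by case: (loc_set_out p0 p1 p2 px).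
  + move: px h; rewrite pE loc_set0 => V1x h; rewrite !g0 (cast_germE _ V1x).
    rewrite (cast_germE _ (V_y _ V1x)) /germ.
    exact: res_comp.
  + move: px h; rewrite pE loc_set1 => Vx h; rewrite !g1 (cast_germE _ Vx).
    rewrite (cast_germE _ (V_y _ Vx)) /germ.
    exact: res_comp.
  + move: px h; rewrite pE loc_set2 => -[Vx _] h; rewrite !g2 (cast_germE _ Vx).
    rewrite (cast_germE _ (V_y _ Vx)) /germ.
    exact: res_comp.
- move=> px.
  have [pE|pE|pE|[p0 p1 p2]] := loc_cases p; last by case: (loc_set_out p0 p1 p2 px).
  + have qE : q = k1 by rewrite e pE e1.
    move: e px; rewrite pE qE => e /loc_set0 V1x.
    rewrite g0 (cast_germE _ V1x) g1 (cast_germE _ (V1V V1x)) /germ [LHS]app_res.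
    by rewrite (eq_irrelevance e e1) cb (res_comp _ _ (nbd_sub (V1V V1x))).
  + have qE : q = k2 by rewrite e pE e2.
    move: e px; rewrite pE qE => e /loc_set1 Vx.
    rewrite g1 (cast_germE _ Vx) g2 (cast_germE _ Vx) /germ [LHS]app_res.
    by rewrite (eq_irrelevance e e2) ab.
  + move: e px; rewrite pE => e /loc_set2 [Vx _].
    rewrite g2 (cast_germE _ Vx) /germ [LHS]app_res ab dif_dif raddf0.
    by rewrite /g !cast_germ_deg ?addr0 // e e2 e1; lia.
have [h hE] := IK _ u loc_acyclic.
have i2 : int_on_sg (loc_set k2) V (cut (loc_set k2) (fun=> 1)).
  apply: int_ind_on => // [x|x y Vx xy]; first by move/loc_set2 => [].
  rewrite !loc_set2 => -[Vy V1y]; split=> // _; split=> // V1x.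
  by apply: V1y; exact: (nbd_sub V1x).
have i1 : int_on_sg (loc_set k1) V (cut (oset V) (fun=> 1)).
  apply: int_ind_on => // [x|x y Vx xy]; first by move/loc_set1.
  by rewrite loc_set1.
have i0 : int_on_sg (loc_set k) V1 (cut (oset V1) (fun=> 1)).
  apply: int_ind_on => // [x|x y V1x xy]; first by move/loc_set0.
  by rewrite loc_set0.
pose s2 : L k2 V := sub_mk (S := int_on_sg (loc_set k2) V) i2.
pose s1 : L k1 V := sub_mk (S := int_on_sg (loc_set k1) V) i1.
have d1 : dif L e2 V s1 = s2.
  apply: int_val_eq => x; rewrite int_val_dif.
  rewrite -[int_val s1]/(cut (oset V) (fun=> 1)).
  rewrite -[int_val s2]/(cut (loc_set k2) (fun=> 1)).
  have [Sx|Sx] := pselect (loc_set k2 x); last by rewrite !cutF.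
  by rewrite !cutT //; case/loc_set2: Sx.
have d2 : dif L (erefl (k2 + 1)) V s2 = 0 by rewrite -d1 dif_dif.
have r2 : res (L k2) V1V s2 = 0.
  apply: int_val_eq => x; rewrite int_val_res [RHS]/(0 : int).
  rewrite -[int_val s2]/(cut (loc_set k2) (fun=> 1)).
  have [V1x|V1x] := pselect (oset V1 x); last by rewrite cutF.
  by rewrite cutT // cutF // loc_set2 => -[].
have e0 : k = (k - 1) + 1 by rewrite subrK.
have u2 : u k2 V s2 = a.
  apply: nbd_sep => x Vx; rewrite uE g2 (cast_germE _ Vx).
  rewrite -[int_val s2]/(cut (loc_set k2) (fun=> 1)).
  have [Sx|Sx] := pselect (loc_set k2 x); first by rewrite cutT.
  have V1x : oset V1 x by apply: contrapT => V1x; apply: Sx; apply/loc_set2.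
  by rewrite a1 // mul0rz.
have u1 : u k1 V s1 = b.
  apply: nbd_sep => x Vx; rewrite uE g1 (cast_germE _ Vx).
  by rewrite -[int_val s1]/(cut (oset V) (fun=> 1)) cutT.
(* Here [s1] and [s2] are the sections 1 on V and on V minus V1. The homotopy identity at the
   cocycle [s2] gives a = d a'; at [s1], whose differential is [s2], it gives b = d b' + a'. As [s2]
   vanishes on V1, so does a'. *)
exists (h k2 k1 e2 V s2), (h k1 k e1 V s1); split.
- by rewrite -app_res r2 raddf0.
- by rewrite -u2 (hE k1 k2 _ e2 erefl V s2) d2 raddf0 addr0.
- by rewrite -u1 (hE k k1 _ e1 e2 V s1) d1.
Qed.
End Localization.

(** * Counting the points of open sets *)

Section OpenCard.
Variable X : finspace.
Implicit Types V W : opens X.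

Definition open_card V := #|` fset_set (oset V)|%N.

Lemma fin_open V : finite_set (oset V).
Proof. exact: sub_finite_set (fs_finite X). Qed.

Lemma mem_open_fset V x : reflect (oset V x) (x \in fset_set (oset V)).
Proof.
rewrite in_fset_set; last exact: fin_open.
by apply: (iffP idP); [exact: set_mem|exact: mem_set].
Qed.

Lemma open_cardS V W : V `<=` W -> (open_card V <= open_card W)%N.
Proof.
move=> VW; apply: fsubset_leq_card; apply/fsubsetP => x.
by move=> /mem_open_fset Vx; apply/mem_open_fset; exact: VW.
Qed.

Lemma open_card_lt V W x : V `<=` W -> oset W x -> ~ oset V x ->
  (open_card V < open_card W)%N.
Proof.
move=> VW Wx Vx; apply: fproper_ltn_card; rewrite fproperE; apply/andP; split.
  apply/fsubsetP => y /mem_open_fset Vy; apply/mem_open_fset; exact: VW.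
by apply/negP => /fsubsetP/(_ x (introT (mem_open_fset _ _) Wx))/mem_open_fset.
Qed.

(** Take [nbd x] with the most points: if [x] is in [nbd y], then [nbd y] contains [nbd x] and
    cannot be larger. *)
Lemma open_max V : (exists x, oset V x) ->
  exists2 x, oset V x & forall y, oset V y -> oset (nbd y) x -> oset (nbd x) y.
Proof.
move=> [x0 Vx0].
pose P n := `[< exists2 x, oset V x & open_card (nbd x) = n >].
have exP : exists n, P n.
  by exists (open_card (nbd x0)); apply/asboolP; exists x0.
have leP n : P n -> (n <= open_card V)%N.
  by move=> /asboolP[x Vx <-]; apply: open_cardS; exact: nbd_sub.
case: (ex_maxnP exP leP) => n /asboolP[x Vx xn] nmax.
exists x => // y Vy yx; apply: contrapT => xy.
have := nmax (open_card (nbd y)); rewrite /P => /(_ (asboolT _)).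
rewrite leqNgt -xn (open_card_lt (nbd_sub yx) (nbd_id y) xy) => h.
by have : false by apply: h; exists y.
Qed.
End OpenCard.

(** * Finiteness of the cohomology of open subsets *)

Section Devissage.
Variables (X : finspace) (I : complex X).
Hypothesis IK : Kinjective I.
Implicit Types V W : opens X.

Section Relative.
Variables (V V1 : opens X) (h : V1 `<=` V).

Definition rel_cocycle n (z : I n V) := res (I n) h z = 0 /\ cocycle z.

Definition rel_cobound n (z : I n V) :=
  exists p (e : n = p + 1) (y : I p V), res (I p) h y = 0 /\ z = dif I e V y.

Lemma rel_coboundP n m (e : n = m + 1) (z : I n V) :
  rel_cobound z <-> exists y, res (I m) h y = 0 /\ z = dif I e V y.
Proof.
split=> [[p [e' [y [y0 ->]]]]|[y [y0 ->]]]; last by exists m, e, y.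
have pm : p = m by apply: (addIr 1); rewrite -e -e'.
by subst p; exists y; rewrite (eq_irrelevance e e').
Qed.

Lemma rel_cocycle_zclosed n : zclosed (@rel_cocycle n).
Proof.
split=> [|y z [y0 yc] [z0 zc]].
  by split; [exact: raddf0|exact: (cocycle_zclosed _ _ _).1].
by split; [rewrite raddfB y0 z0 subrr|exact: (cocycle_zclosed _ _ _).2].
Qed.

Lemma rel_cobound_zclosed n : zclosed (@rel_cobound n).
Proof.
have e : n = (n - 1) + 1 by rewrite subrK.
split=> [|x y /(rel_coboundP e)[s [s0 ->]] /(rel_coboundP e)[t [t0 ->]]];
  apply/(rel_coboundP e).
  by exists 0; rewrite !raddf0.
by exists (s - t); rewrite !raddfB s0 t0 subrr.
Qed.

Lemma rel_cobound_cobound n (z : I n V) : rel_cobound z -> cobound z.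
Proof. by move=> [p [e [y [_ ->]]]]; exists p, e, y. Qed.

Definition rel_fg b n := fgq b (@rel_cocycle n) (@rel_cobound n).

(** The piece H^(n-1)(V1) -> H^n(V, V1) -> H^n(V) of the long exact sequence, with K the kernel of
    the second map on cocycles. *)
Lemma rel_fg_of_coh b n :
  coh_fg b I n V -> coh_fg b I (n - 1) V1 -> rel_fg b n.
Proof.
move=> Vfg V1fg.
have e : n = (n - 1) + 1 by rewrite subrK.
have e' : n - 1 = (n - 1 - 1) + 1 by rewrite subrK.
have Rc := rel_cocycle_zclosed n.
apply: (fgq_ext (K := fun z => rel_cocycle z /\ cobound z)) => [z []//||].
  pose rho m z := m = z /\ @rel_cocycle n z.
  apply: (fgq_rel (rho := rho)) Vfg.
  - exact: cocycle_zclosed.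
  - exact: cobound_zclosed.
  - by apply: zclosed_pair => [|m z m' z' [-> zr] [-> z'r]]; split => //;
      [exact: Rc.1|exact: Rc.2].
  - by move=> m z [].
  - by move=> z zr; exists z => //; exact: zr.2.
  - by move=> m z mb [mz zr]; rewrite -mz in zr *.
(* The connecting homomorphism as a relation. When [c] is a coboundary, [Kinj_localization] replaces
   [y] by a primitive of [z] vanishing on V1. *)
pose rho (c : I (n - 1) V1) (z : I n V) := exists y : I (n - 1) V,
  [/\ z = dif I e V y, c = res (I (n - 1)) h y & rel_cocycle z].
apply: (fgq_rel (rho := rho)) V1fg.
- exact: cocycle_zclosed.
- exact: cobound_zclosed.
- apply: zclosed_pair => [|m z m' z' [y [zy my zr]] [y' [z'y' m'y' z'r]]].
    by exists 0; rewrite !raddf0; split=> //; exact: Rc.1.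
  by exists (y - y'); rewrite !raddfB -zy -z'y' -my -m'y'; split=> //; exact: Rc.2.
- by move=> m z [y [zy _ zr]]; split=> //; apply/(coboundP e); exists y.
- move=> z [zr /(coboundP e)[y zy]]; exists (res (I (n - 1)) h y); last by exists y.
  by apply/(cocycleE e); rewrite app_res -zy zr.1.
- move=> m z /(coboundP e')[c mc] [y [zy my zr]].
  have [a' [_ [a'0 za' _]]] :=
    Kinj_localization (V1V := h) IK zr.1 zy (etrans (esym mc) my).
  by apply/(rel_coboundP e); exists a'.
Qed.

(** The piece H^n(V, V1) -> H^n(V) -> H^n(V1). A cocycle that is exact on V1 is moved by a
    coboundary to one vanishing on V1, by [Kinj_localization] with a = 0. *)
Lemma coh_fg_of_rel b n : rel_fg b n -> coh_fg b I n V1 -> coh_fg b I n V.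
Proof.
move=> Rfg V1fg.
have e : n = (n - 1) + 1 by rewrite subrK.
have Zc := cocycle_zclosed I n V; have Bc := cobound_zclosed I n V.
have Bc1 := cobound_zclosed I n V1.
pose K0 z := @cocycle X I n V z /\ cobound (res (I n) h z).
apply: (fgq_ext (K := K0)) => [z []//||].
  pose rho (m : I n V1) z := m = res (I n) h z /\ @cocycle X I n V z.
  apply: (fgq_rel (rho := rho)) V1fg.
  - exact: cocycle_zclosed.
  - exact: cobound_zclosed.
  - apply: zclosed_pair => [|m z m' z' [-> zr] [-> z'r]]; split;
      [by rewrite raddf0|exact: Zc.1|by rewrite raddfB|exact: Zc.2].
  - by move=> m z [].
  - by move=> z zc; exists (res (I n) h z) => //; exact: cocycle_res.
  - by move=> m z mb [mz zr]; split=> //; rewrite -mz.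
have K0c : zclosed K0.
  split; first by split; [exact: Zc.1|rewrite raddf0; exact: Bc1.1].
  move=> x y [xc xb] [yc yb]; split; first exact: Zc.2.
  by rewrite raddfB; exact: Bc1.2.
pose rho a z := [/\ @rel_cocycle n a, K0 z & cobound (z - a)].
apply: (fgq_rel (rho := rho)) Rfg.
- exact: rel_cocycle_zclosed.
- exact: rel_cobound_zclosed.
- apply: zclosed_pair => [|m z m' z' [mr zK mz] [m'r z'K m'z']].
    split; [exact: (rel_cocycle_zclosed n).1|exact: K0c.1|].
    by rewrite subrr; exact: Bc.1.
  split; [exact: (rel_cocycle_zclosed n).2|exact: K0c.2|].
  by rewrite subrACA; exact: Bc.2.
- by move=> m z [].
- move=> z [zc /(coboundP e)[c zrc]].
  have [||a' [b' [a'0 da' zE]]] :=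
      Kinj_localization (V1V := h) (a := 0) (b := z) (e2 := erefl (n + 1))
        IK _ _ (esym zrc).
  + exact: raddf0.
  + by rewrite [RHS]zc.
  have a'r : rel_cocycle a' by split=> //; rewrite /cocycle -da'.
  exists a' => //; split=> //.
    by split=> //; apply/(coboundP e); exists c.
  by rewrite {1}zE addrK; apply/(coboundP e); exists b'.
- move=> m z /rel_cobound_cobound mb [_ _ mz]; rewrite -[z](subrK m).
  exact: zclosedD.
Qed.
End Relative.

Lemma extend_zero (F : sheaf X) (V V1 N N1 : opens X) (V1V : V1 `<=` V) (NV : N `<=` V)
    (N1N : N1 `<=` N) (y : F N) :
  (forall x, oset V x -> oset N x \/ oset V1 x) ->
  (forall x, oset N x -> oset V1 x -> oset N1 x) ->
  res F N1N y = 0 ->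
  exists t : F V, res F NV t = y /\ res F V1V t = 0.
Proof.
move=> cov NV1 y0.
have g0 x (Nx : oset N x) : oset V1 x -> germ F Nx y = 0.
  move=> V1x; rewrite /germ -(res_comp N1N (nbd_sub (NV1 x Nx V1x))) y0.
  exact: raddf0.
pose s x (Vx : oset V x) : stalk F x :=
  match pselect (oset N x) with left Nx => germ F Nx y | right _ => 0 end.
have sN x (Vx : oset V x) (Nx : oset N x) : s x Vx = germ F Nx y.
  by rewrite /s; case: pselect => // Nx'; rewrite (Prop_irrelevance Nx' Nx).
have s0 x (Vx : oset V x) : oset V1 x -> s x Vx = 0.
  by move=> V1x; rewrite /s; case: pselect => // Nx; exact: g0.
have [x z Vx Vz xz|t tE] := @nbd_glue _ F V s.
  have V_z W : oset W x -> oset W z.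
    by move=> Wx; apply: (nbd_sub Wx); apply: xz; exact: nbd_id.
  have [Nx|V1x] := cov x Vx.
    by rewrite (sN x Vx Nx) (sN z Vz (V_z _ Nx)) /germ; exact: res_comp.
  by rewrite !s0 ?raddf0 //; exact: V_z.
exists t; split; apply: nbd_sep => x Wx.
  by rewrite /germ (res_comp _ _ (nbd_sub (NV x Wx))) -/(germ _ _) tE (sN x _ Wx).
by rewrite /germ (res_comp _ _ (nbd_sub (V1V x Wx))) -/(germ _ _) tE s0 // raddf0.
Qed.

(** Restriction to N keeps relative classes apart: a primitive on N vanishing on N1 extends by zero
    across V1. *)
Lemma rel_fg_excision b n (V V1 N N1 : opens X) (V1V : V1 `<=` V) (NV : N `<=` V)
    (N1N : N1 `<=` N) :
  N1 `<=` V1 ->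
  (forall x, oset V x -> oset N x \/ oset V1 x) ->
  (forall x, oset N x -> oset V1 x -> oset N1 x) ->
  rel_fg N1N b n -> rel_fg V1V b n.
Proof.
move=> N1V1 cov NV1.
have e : n = (n - 1) + 1 by rewrite subrK.
have Rc := rel_cocycle_zclosed V1V n.
pose rho m z := m = res (I n) NV z /\ @rel_cocycle _ _ V1V n z.
apply: (fgq_rel (rho := rho)).
- exact: rel_cocycle_zclosed.
- exact: rel_cobound_zclosed.
- apply: zclosed_pair => [|m z m' z' [-> zr] [-> z'r]]; split;
    [by rewrite raddf0|exact: Rc.1|by rewrite raddfB|exact: Rc.2].
- by move=> m z [].
- move=> z zr; exists (res (I n) NV z) => //; split; last exact: cocycle_res zr.2.
  have l := subset_trans N1V1 V1V.
  by rewrite (res_comp _ _ l) -(res_comp V1V N1V1) zr.1 raddf0.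
- move=> m z /(rel_coboundP N1N e)[y [y0 my]] [mz zr].
  have [t [ty t0]] := extend_zero V1V NV cov NV1 y0.
  apply/(rel_coboundP _ e); exists t; split=> //.
  apply: nbd_sep => x Vx; have [Nx|V1x] := cov x Vx.
    rewrite /germ -!(res_comp NV (nbd_sub Nx) (nbd_sub Vx)) -mz my.
    by congr (res _ _ _); rewrite -ty app_res.
  rewrite /germ -!(res_comp V1V (nbd_sub V1x) (nbd_sub Vx)) zr.1.
  by congr (res _ _ _); rewrite -app_res t0 raddf0.
Qed.

Section Degrees.
(* [D j] is the set of degrees in which finiteness is known for open sets with at
   most j points: each inductive step may lose one degree. *)
Variables (b : bool) (D : nat -> int -> Prop).
Hypothesis D_S : forall j n, D j.+1 n -> D j n /\ D j (n - 1).
Hypothesis fg_nbd : forall n x, D 0%N n -> coh_fg b I n (nbd x).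

Lemma D_0 j n : D j n -> D 0%N n.
Proof. by elim: j => // j IH /D_S[/IH]. Qed.

Lemma coh_fg_empty n V : (forall x, ~ oset V x) -> coh_fg b I n V.
Proof.
move=> V0; apply: fgq_zero => z _.
rewrite (_ : z = 0); first exact: (cobound_zclosed _ _ _).1.
exact: sheaf_empty.
Qed.

(* Induction on the number of points: for x maximal in V the open set V is the
   union of [nbd x] and a smaller open set V1, and the cohomology of the pair
   (V, V1) is that of the pair (nbd x, nbd x :&: V1). *)
Lemma coh_fg_open j V n : (open_card V <= j)%N -> D j n -> coh_fg b I n V.
Proof.
elim: j V n => [|j IH] V n Vj Dn; have [V0|] := pselect (exists x, oset V x);
  try by move=> V0; apply: coh_fg_empty => x Vx; apply: V0; exists x.
  have [x Vx] := V0.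
  (* With j = 0 a point of V is impossible, as it makes the cardinal of V positive. *)
  have lt : (open_card (Opens (@open0 X)) < open_card V)%N by exact: open_card_lt Vx _.
  by have := leq_trans lt Vj.
have [x Vx xmax] := open_max V0.
(* V1 is the union of the neighbourhoods, at points of V, that miss [x]. It omits [x], so induction
   applies, and by the choice of [x] every other point of V lies in [nbd x]. *)
have V1o : open (\bigcup_(z in [set z | oset V z /\ ~ oset (nbd z) x]) oset (nbd z)).
  by apply: bigcup_open => z _; exact: oset_open.
pose V1 := Opens V1o.
have V1V : V1 `<=` V by move=> y [z [Vz _]]; exact: nbd_sub.
have V1x : ~ oset V1 x by move=> [z [_ zx]].
have V1j : (open_card V1 <= j)%N.
  by rewrite -ltnS; apply: leq_trans Vj; exact: open_card_lt Vx V1x.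
pose N1 := opensI (nbd x) V1.
have N1N : N1 `<=` nbd x by move=> y [].
have N1V1 : N1 `<=` V1 by move=> y [].
have N1j : (open_card N1 <= j)%N by apply: leq_trans V1j; exact: open_cardS.
have [Dj Dj'] := D_S Dn.
apply: (coh_fg_of_rel (h := V1V)); last exact: IH.
apply: (@rel_fg_excision b n V V1 (nbd x) N1 V1V (nbd_sub Vx) N1N) => //.
- move=> y Vy; have [yx|yx] := pselect (oset (nbd y) x).
    by left; exact: xmax.
  by right; exists y => //; exact: nbd_id.
- apply: rel_fg_of_coh; last exact: IH.
  by apply: fg_nbd; exact: D_0 Dn.
Qed.
End Degrees.
End Devissage.

(** * Finiteness of sections with closed support, and the theorem *)

Section ClosedFinite.
Variables (X : finspace) (K : set X) (Kc : closed K) (I : complex X).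
Variables (J : complex (subspace_of K)) (eps : cmap (dirc J) I).
Hypotheses (epsK : coreflection eps) (IK : Kinjective I).

(** The stalk complex of J at [y] consists of the sections of I on V = [nbd (incl y)] that vanish on
    V minus K, so its cohomology is that of the pair. The successor in the bound pays for the
    connecting map. *)
Lemma coreflection_coh_fg b (D : nat -> int -> Prop) :
  (forall j n, D j.+1 n -> D j n /\ D j (n - 1)) ->
  (forall n x, D 0%N n -> coh_fg b I n (nbd x)) ->
  forall n y, D (open_card (Opens (@openT X))).+1 n -> coh_fg b J n (nbd y).
Proof.
move=> D_S fg n y /D_S[Dn Dn1].
have [einj eimg] := epsK.
set V := nbd (incl y).
pose V1 := opensI V (Opens (closed_openC Kc)).
have V1V : V1 `<=` V by move=> x [].
have e : n = (n - 1) + 1 by rewrite subrK.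
have Rfg : rel_fg I V1V b n.
  have le (W : opens X) : (open_card W <= open_card (Opens (@openT X)))%N.
    exact: open_cardS.
  by apply: rel_fg_of_coh => //; apply: (coh_fg_open IK D_S fg (le _)).
have supp p (t : I p V) : res (I p) V1V t = 0 <-> supp_in K t.
  split=> [t0 x Vx xK|tK].
    have V1x : oset V1 x by split.
    by rewrite /germ -(res_comp V1V (nbd_sub V1x)) t0 raddf0.
  apply: nbd_sep => x V1x; rewrite /germ (res_comp _ _ (nbd_sub (V1V x V1x))) raddf0.
  by apply: tK; exact: V1x.2.
have esupp p s : supp_in K (eps p V s) by exact: (dirc_mor_supp Kc (eps p)).
rewrite -(preim_nbd y) -/V.
pose rho m z := m = eps n V z /\ @cocycle _ (dirc J) n V z.
have Jc := cocycle_zclosed (dirc J) n V.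
apply: (fgq_rel (rho := rho)) Rfg.
- exact: rel_cocycle_zclosed.
- exact: rel_cobound_zclosed.
- apply: zclosed_pair => [|m z m' z' [-> zr] [-> z'r]]; split;
    [by rewrite raddf0|exact: Jc.1|by rewrite raddfB|exact: Jc.2].
- by move=> m z [].
- move=> z zc; exists (eps n V z) => //; split; first exact/supp.
  exact: cocycle_cm.
- move=> m z /(rel_coboundP V1V e)[t [/supp tK mt]] [mz _].
  have [s st] := eimg _ _ _ tK; apply/(coboundP (F := J) e); exists s.
  by apply: (einj n V); rewrite -mz mt -st [RHS](cm_dif eps e).
Qed.

Lemma coreflection_Dbc : Dbc I -> Dbc J.
Proof.
move=> /DbcP[If [N IN]]; apply/DbcP; split=> [n y|].
  by apply: (coreflection_coh_fg (D := fun _ _ => True)).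
set m := open_card (Opens (@openT X)).
(* The upper bound grows by one for each of the [m] points and once more for the pair. Below [- N]
   passing from n to n - 1 costs nothing. *)
exists (N + m.+1)%N => n y nN.
apply: (coreflection_coh_fg (D := fun j n => n < - N%:Z \/ n > (N + j)%:Z)) => //.
- by move=> j k; lia.
- by move=> k x h; apply: IN; lia.
- lia.
Qed.
End ClosedFinite.

(* The given resolution I need not be the one for which biduality is known, I0;
   the homotopy equivalence between them makes the complex of I0 a resolution of
   that of I. *)
Lemma canonical_closed (X : finspace) (Omega : complex X) (K : set X)
    (I : Kresolution Omega) : canonical_complex Omega -> closed K ->
  canonical_complex (inv_image K (RHom (conc (Z_ext K)) I)).
Proof.
move=> [OD [I0 I0b]] Kc.
have [eps epsK] := inv_ev Kc I; have [eps0 epsK0] := inv_ev Kc I0.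
rewrite /RHom; set J := inv_image K _ in eps epsK *.
set J0 := inv_image K _ in eps0 epsK0 *.
have qI : qis (Kres_map I) := Kres_qis I.
have KI := @Kres_Kinj _ _ I; have KI0 := @Kres_Kinj _ _ I0.
have [w [h hE]] := Kinj_lift (Kres_map I0) KI0 qI.
have qw : qis w := qis_of_comp hE (Kres_qis I0) qI.
(* Lifting an identity along the preceding quasi-isomorphism gives homotopies from w' w and from w''
   w' to identities, the form needed by [qis_of_homotopies]. *)
have [w' [h' h'E]] := Kinj_lift (cmap_id I) KI qw.
have qw' : qis w' := qis_of_comp h'E (@qis_id _ I) qw.
have [w'' [h'' h''E]] := Kinj_lift (cmap_id I0) KI0 qw'.
have [u uE] := coreflection_map Kc eps epsK0 w.
have [u' u'E] := coreflection_map Kc eps0 epsK w'.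
have [u'' u''E] := coreflection_map Kc eps epsK0 w''.
have [k kE] := coreflection_homotopy Kc epsK uE u'E h'E.
have [k' k'E] := coreflection_homotopy Kc epsK0 u'E u''E h''E.
have qu : qis u := qis_of_homotopies kE k'E.
split.
  apply: (coreflection_Dbc Kc epsK KI); apply/DbcP.
  have /DbcP[Of [N ON]] := OD; split=> [n x|].
    by apply/(qis_coh_fg _ _ _ qI).
  by exists N => n x nN; apply/(qis_coh_fg _ _ _ qI); exact: ON.
exists (KResolution qu (coreflection_Kinjective Kc epsK0 KI0)) => G /Dc_fg Gc.
apply/D_iso_qis; apply: (coreflection_biduality Kc epsK0).
apply/D_iso_qis; apply: I0b; apply/Dc_fg => n x.
by apply: (dirc_coh_fg Kc) => y; exact: Gc.
Qed.

Theorem theorem4p5 (X : finspace) (Omega : complex X) (hOmega : canonical_complex Omega) :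
  (forall (U : set X) (Uo : open U), canonical_complex (restr Uo Omega)) /\
  (forall (K : set X), closed K -> forall I : Kresolution Omega,
     canonical_complex (inv_image K (RHom (conc (Z_ext K)) I))).
Proof.
split=> [U Uo|K Kc I]; first exact: canonical_restr.
exact: canonical_closed.
Qed.
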